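(* Let $\mathcal{B},\mathcal{C}$ be $C^*$-algebras, let $E$ be a full Hilbert $\mathcal{B}$-module, let $F$ be a Hilbert $\mathcal{C}$-module, and let $u\colon E\to F$ be a map. Then the following conditions are equivalent: 1. $u$ is a generalized isometry. 2. $u$ is a ternary homomorphism. 3. $u$ extends to a (blockwise, unique) homomorphism $\Phi=\begin{pmatrix}\varphi & u^* \\ u & \phi\end{pmatrix}\colon\begin{pmatrix}\mathcal{B} & E^* \\ E & \mathscr{K}(E)\end{pmatrix}\to\begin{pmatrix}\mathcal{C} & F^* \\ F & \mathscr{K}(F)\end{pmatrix}$ between the linking algebras. Moreover, for arbitrary (not necessarily full) $E$, the map $u$ is a ternary homomorphism if and only if $u$ extends to a (blockwise, unique) homomorphism $\Phi\colon\begin{pmatrix}\mathcal{B}_E & E^* \\ E & \mathscr{K}(E)\end{pmatrix}\to\begin{pmatrix}\mathcal{C}_F & F^* \\ F & \mathscr{K}(F)\end{pmatrix}$ between the reduced linking algebras; and in this case $\Phi$ is surjective if and only if $u$ is surjective, and $\Phi$ is injective if and only if $u$ is injective.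
   Context: Hilbert modules are right modules with inner product linear in the second variable. Homomorphisms between $C^*$-algebras are $*$-homomorphisms. $\mathcal{B}_E=\overline{\mathrm{span}}\,\langle E,E\rangle$ is the range ideal of $E$ (similarly $\mathcal{C}_F$); $E$ is full if $\mathcal{B}_E=\mathcal{B}$. For $x\in E$, $x^*=\langle x,\cdot\rangle$, $E^*=\{x^*:x\in E\}$, $xy^*\colon z\mapsto x\langle y,z\rangle$, and $\mathscr{K}(E)=\overline{\mathrm{span}}\,EE^*$ is the algebra of compact operators. The linking algebra of $E$ is $\mathscr{K}\begin{pmatrix}\mathcal{B} \\ E\end{pmatrix}=\begin{pmatrix}\mathcal{B} & E^* \\ E & \mathscr{K}(E)\end{pmatrix}$ (compact operators on $\mathcal{B}\oplus E$), the reduced linking algebra is $\mathscr{K}\begin{pmatrix}\mathcal{B}_E \\ E\end{pmatrix}=\begin{pmatrix}\mathcal{B}_E & E^* \\ E & \mathscr{K}(E)\end{pmatrix}$; $E$ sits in them as the $21$-corner. A homomorphism $\Phi$ between such matrix algebras is blockwise if it maps the $ij$-corner into the $ij$-corner for all $i,j$; ''$\Phi$ extends $u$'' means that the restriction of $\Phi$ to the $21$-corner $E$ is $u$, with values in the $21$-corner $F$; $u^*$ denotes the map $x^*\mapsto(ux)^*$. A map $u\colon E\to F$ is a generalized isometry if there is a homomorphism $\varphi\colon\mathcal{B}\to\mathcal{C}$ with $\langle ux,ux'\rangle=\varphi(\langle x,x'\rangle)$ for all $x,x'\in E$. A ternary homomorphism is a linear map $u\colon E\to F$ with $u(x\langle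 y,z\rangle)=(ux)\langle uy,uz\rangle$ for all $x,y,z\in E$. *)

(* Defs.v *)
From HB Require Import structures.
From mathcomp Require Import all_boot all_order all_algebra.
From mathcomp Require Import mathcomp_extra boolp classical_sets functions.
From mathcomp Require Import reals topology normedtype.
Set Implicit Arguments.
Unset Strict Implicit.
Unset Printing Implicit Defensive.
Import Order.TTheory GRing.Theory Num.Theory.
Import numFieldNormedType.Exports.
Local Open Scope classical_set_scope.
Local Open Scope ring_scope.

(* No unit is assumed, hence no MathComp ring structure. *)
HB.mixin Record Lmodule_isStarAlgebra (K : numClosedFieldType) A
    & GRing.Lmodule K A := {
  amul : A -> A -> A;
  star : A -> A;
  amulA : associative amul;
  amulDl : left_distributive amul +%R;
  amulDr : right_distributive amul +%R;
  amulZl : forall (c : K) a b, amul (c *: a) b = c *: amul a b;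
  amulZr : forall (c : K) a b, amul a (c *: b) = c *: amul a b;
  starK : involutive star;
  starD : {morph star : a b / a + b};
  starZ : forall (c : K) a, star (c *: a) = c^* *: star a;
  starM : forall a b, star (amul a b) = amul (star b) (star a)
}.

#[short(type="starAlgType")]
HB.structure Definition StarAlgebra (K : numClosedFieldType) :=
  {A of Lmodule_isStarAlgebra K A & GRing.Lmodule K A}.

Notation "a ** b" := (amul a b) (at level 40, left associativity) : ring_scope.

(* These are the usual C*-algebras when K = R[i] for R : realType. Norms are
   K-valued. *)
HB.mixin Record StarAlgebra_isCstarAlgebra (K : numClosedFieldType) A
    & StarAlgebra K A & CompleteNormedModule K A := {
  ler_normaM : forall a b : A, `|a ** b| <= `|a| * `|b|;
  cstar_norm : forall a : A, `|star a ** a| = `|a| ^+ 2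
}.

#[short(type="cstarAlgType")]
HB.structure Definition CstarAlgebra (K : numClosedFieldType) :=
  {A of StarAlgebra_isCstarAlgebra K A & StarAlgebra K A
      & CompleteNormedModule K A}.

(* Positive elements. *)
Definition apos (K : numClosedFieldType) (A : starAlgType K) (a : A) :=
  exists b, a = star b ** b.

Definition star_hom (K : numClosedFieldType) (A B : starAlgType K)
    (f : A -> B) :=
  [/\ linear f, forall a b, f (a ** b) = f a ** f b
    & forall a, f (star a) = star (f a)].

(* Right B-modules with a nondegenerate Hermitian B-valued form. Positivity and
   the norm come with Hilbert modules below, which makes ip_nondeg redundant
   there; it is listed here so that adjoints are unique on B (+) E. *)
HB.mixin Record Lmodule_isInnerModule (K : numClosedFieldType)
    (B : cstarAlgType K) E & GRing.Lmodule K E := {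
  ract : E -> B -> E;
  ip : E -> E -> B;
  ractDl : forall x y b, ract (x + y) b = ract x b + ract y b;
  ractDr : forall x b c, ract x (b + c) = ract x b + ract x c;
  ractZl : forall (a : K) x b, ract (a *: x) b = a *: ract x b;
  ractZr : forall (a : K) x b, ract x (a *: b) = a *: ract x b;
  ractA : forall x b c, ract (ract x b) c = ract x (b ** c);
  ipDr : forall x y z, ip x (y + z) = ip x y + ip x z;
  ipZr : forall (a : K) x y, ip x (a *: y) = a *: ip x y;
  ip_ract : forall x y b, ip x (ract y b) = ip x y ** b;
  ip_star : forall x y, star (ip x y) = ip y x;
  ip_nondeg : forall x, (forall y, ip y x = 0) -> x = 0
}.

#[short(type="innerModType")]
HB.structure Definition InnerModule (K : numClosedFieldType)
    (B : cstarAlgType K) :=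
  {E of Lmodule_isInnerModule K B E & GRing.Lmodule K E}.

HB.mixin Record InnerModule_isHilbertModule (K : numClosedFieldType)
    (B : cstarAlgType K) E
    & InnerModule K B E & CompleteNormedModule K E := {
  ip_ge0 : forall x : E, apos (ip x x : B);
  norm_ip : forall x : E, `|x| ^+ 2 = `|ip x x : B|
}.

#[short(type="hilbModType")]
HB.structure Definition HilbertModule (K : numClosedFieldType)
    (B : cstarAlgType K) :=
  {E of InnerModule_isHilbertModule K B E & InnerModule K B E
      & CompleteNormedModule K E}.

Definition lspan (K : numClosedFieldType) (V : lmodType K) (A : set V) : set V :=
  [set v | exists n (a : 'I_n -> K) (w : 'I_n -> V),
     (forall i, A (w i)) /\ v = \sum_(i < n) a i *: w i].

Section LinearSpan.
Variables (K : numClosedFieldType) (V : lmodType K) (A : set V).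

Lemma lspan0 : lspan A 0.
Proof. by exists 0%N, (fun=> 0), (fun=> 0); split=> [[]|]; rewrite ?big_ord0. Qed.

Lemma lspan_gen v : A v -> lspan A v.
Proof.
by move=> Av; exists 1%N, (fun=> 1), (fun=> v); rewrite big_ord1 scale1r.
Qed.

Lemma lspanZ c v : lspan A v -> lspan A (c *: v).
Proof.
move=> [n [a [w [Aw ->]]]]; exists n, (fun i => c * a i), w; split=> //.
by rewrite scaler_sumr; apply: eq_bigr => i _; rewrite scalerA.
Qed.

Lemma lspanD u v : lspan A u -> lspan A v -> lspan A (u + v).
Proof.
move=> [m [a [w [Aw ->]]]] [n [a' [w' [Aw' ->]]]]; exists (m + n)%N.
exists (fun i => match fintype.split i with inl j => a j | inr j => a' j end).
exists (fun i => match fintype.split i with inl j => w j | inr j => w' j end).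
split=> [i|]; first by case: (fintype.split i).
rewrite big_split_ord; congr (_ + _); apply: eq_bigr => i _.
  by rewrite (unsplitK (inl i)).
by rewrite (unsplitK (inr i)).
Qed.

Lemma lspan_ind (P : V -> Prop) :
  P 0 -> (forall u v, P u -> P v -> P (u + v)) ->
  (forall c u, P u -> P (c *: u)) -> (forall u, A u -> P u) ->
  forall v, lspan A v -> P v.
Proof.
move=> P0 PD PZ PA v [n [a [w [Aw ->]]]].
by elim/big_ind : _ => // i _; exact/PZ/PA.
Qed.

End LinearSpan.

Record starSubalg (K : numClosedFieldType) (A : starAlgType K) := StarSubalg {
  sa_set : set A;
  sa0 : sa_set 0;
  saD : forall a b, sa_set a -> sa_set b -> sa_set (a + b);
  saZ : forall (c : K) a, sa_set a -> sa_set (c *: a);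
  saM : forall a b, sa_set a -> sa_set b -> sa_set (a ** b);
  saS : forall a, sa_set a -> sa_set (star a)
}.

Record subalg (K : numClosedFieldType) (A : starAlgType K) (S : starSubalg A) :=
  Subalg { sa_val :> A; sa_valP : sa_set S sa_val }.

Section Subalgebra.
Variables (K : numClosedFieldType) (A : starAlgType K) (S : starSubalg A).
Implicit Types a b c : subalg S.

Lemma sa_val_inj : injective (@sa_val K A S).
Proof. by move=> [a Sa] [b Sb] /= ab; subst b; congr Subalg. Qed.

HB.instance Definition _ := gen_eqMixin (subalg S).
HB.instance Definition _ := gen_choiceMixin (subalg S).

Let sub0 : subalg S := Subalg (sa0 S).
Let subD a b : subalg S := Subalg (saD (sa_valP a) (sa_valP b)).
Let subZ (k : K) a : subalg S := Subalg (saZ k (sa_valP a)).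
Let subN a : subalg S := subZ (- 1) a.
Let subM a b : subalg S := Subalg (saM (sa_valP a) (sa_valP b)).
Let subS a : subalg S := Subalg (saS (sa_valP a)).

Fact subalg_addA : associative subD.
Proof. by move=> a b c; apply: sa_val_inj => /=; rewrite addrA. Qed.
Fact subalg_addC : commutative subD.
Proof. by move=> a b; apply: sa_val_inj => /=; rewrite addrC. Qed.
Fact subalg_add0 : left_id sub0 subD.
Proof. by move=> a; apply: sa_val_inj => /=; rewrite add0r. Qed.
Fact subalg_addN : left_inverse sub0 subN subD.
Proof. by move=> a; apply: sa_val_inj => /=; rewrite scaleN1r addNr. Qed.
HB.instance Definition _ := GRing.isZmodule.Build (subalg S)
  subalg_addA subalg_addC subalg_add0 subalg_addN.

Fact subalg_scaleA k l a : subZ k (subZ l a) = subZ (k * l) a.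
Proof. by apply: sa_val_inj => /=; rewrite scalerA. Qed.
Fact subalg_scale1 : left_id 1 subZ.
Proof. by move=> a; apply: sa_val_inj => /=; rewrite scale1r. Qed.
Fact subalg_scaleDr : right_distributive subZ +%R.
Proof. by move=> k a b; apply: sa_val_inj => /=; rewrite scalerDr. Qed.
Fact subalg_scaleDl a : {morph subZ^~ a : k l / k + l}.
Proof. by move=> k l; apply: sa_val_inj => /=; rewrite scalerDl. Qed.
HB.instance Definition _ := GRing.Zmodule_isLmodule.Build K (subalg S)
  subalg_scaleA subalg_scale1 subalg_scaleDr subalg_scaleDl.

Fact subalg_mulA : associative subM.
Proof. by move=> a b c; apply: sa_val_inj => /=; rewrite amulA. Qed.
Fact subalg_mulDl : left_distributive subM +%R.
Proof. by move=> a b c; apply: sa_val_inj => /=; rewrite amulDl. Qed.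
Fact subalg_mulDr : right_distributive subM +%R.
Proof. by move=> a b c; apply: sa_val_inj => /=; rewrite amulDr. Qed.
Fact subalg_mulZl k a b : subM (k *: a) b = k *: subM a b.
Proof. by apply: sa_val_inj => /=; rewrite amulZl. Qed.
Fact subalg_mulZr k a b : subM a (k *: b) = k *: subM a b.
Proof. by apply: sa_val_inj => /=; rewrite amulZr. Qed.
Fact subalg_starK : involutive subS.
Proof. by move=> a; apply: sa_val_inj => /=; rewrite starK. Qed.
Fact subalg_starD : {morph subS : a b / a + b}.
Proof. by move=> a b; apply: sa_val_inj => /=; rewrite starD. Qed.
Fact subalg_starZ k a : subS (k *: a) = k^* *: subS a.
Proof. by apply: sa_val_inj => /=; rewrite starZ. Qed.
Fact subalg_starM a b : subS (subM a b) = subM (subS b) (subS a).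
Proof. by apply: sa_val_inj => /=; rewrite starM. Qed.
HB.instance Definition _ := Lmodule_isStarAlgebra.Build K (subalg S)
  subalg_mulA subalg_mulDl subalg_mulDr subalg_mulZl subalg_mulZr
  subalg_starK subalg_starD subalg_starZ subalg_starM.

End Subalgebra.

Section InnerModuleTheory.
Variables (K : numClosedFieldType) (B : cstarAlgType K) (E : innerModType B).
Implicit Types (x y z : E) (b : B) (a : K).

Lemma ipDl x y z : ip (x + y) z = ip x z + ip y z.
Proof. by rewrite -ip_star ipDr starD !ip_star. Qed.

Lemma ipZl a x y : ip (a *: x) y = a^* *: ip x y.
Proof. by rewrite -ip_star ipZr starZ ip_star. Qed.

Lemma ip_ractl x y b : ip (ract x b) y = star b ** ip x y.
Proof. by rewrite -ip_star ip_ract starM ip_star. Qed.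

Lemma ip0r x : ip x 0 = 0.
Proof. by rewrite -(scale0r 0) ipZr scale0r. Qed.

Lemma ip0l x : ip 0 x = 0.
Proof. by rewrite -(scale0r 0) ipZl conjC0 scale0r. Qed.

Lemma ipNr x y : ip x (- y) = - ip x y.
Proof. by rewrite -scaleN1r ipZr scaleN1r. Qed.

Lemma ipNl x y : ip (- x) y = - ip x y.
Proof. by rewrite -ip_star ipNr -scaleN1r starZ rmorphN1 scaleN1r ip_star. Qed.

Lemma ip_injr x y : (forall z, ip z x = ip z y) -> x = y.
Proof.
move=> h; apply/eqP; rewrite -subr_eq0; apply/eqP; apply: ip_nondeg => z.
by rewrite ipDr ipNr h subrr.
Qed.

Lemma ract0r x : ract x 0 = 0.
Proof. by rewrite -(scale0r (0 : B)) ractZr scale0r. Qed.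

Lemma ract0l b : ract (0 : E) b = 0.
Proof. by rewrite -{1}(scale0r (0 : E)) ractZl scale0r. Qed.

End InnerModuleTheory.

(* Adjointable operators; linearity follows from the adjoint relation. *)
Record adjop (K : numClosedFieldType) (B : cstarAlgType K)
    (E : innerModType B) := AdjOp {
  adj_fun :> E -> E;
  adj_adj : E -> E;
  adjopP : forall x y, ip (adj_fun x) y = ip x (adj_adj y)
}.

Section AdjointableOperators.
Variables (K : numClosedFieldType) (B : cstarAlgType K) (E : innerModType B).
Implicit Types (S T : adjop E).

Lemma adjopE S T : adj_fun S =1 adj_fun T -> S = T.
Proof.
case: S T => [f f' fP] [g g' gP] /= fg; have {fg} fg := funext fg; subst g.
have fg' : f' = g' by apply/funext => y; apply: ip_injr => x; rewrite -fP gP.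
by subst g'; congr AdjOp.
Qed.

Lemma adjopP' T x y : ip x (T y) = ip (adj_adj T x) y.
Proof. by rewrite -ip_star adjopP ip_star. Qed.

Lemma adjop_add T x y : T (x + y) = T x + T y.
Proof. by apply: ip_injr => z; rewrite ipDr !adjopP' ipDr. Qed.

Lemma adjop_scale T a x : T (a *: x) = a *: T x.
Proof. by apply: ip_injr => z; rewrite ipZr !adjopP' ipZr. Qed.

Lemma adjop_ract T x b : T (ract x b) = ract (T x) b.
Proof. by apply: ip_injr => z; rewrite ip_ract !adjopP' ip_ract. Qed.

HB.instance Definition _ := gen_eqMixin (adjop E).
HB.instance Definition _ := gen_choiceMixin (adjop E).

Fact adjop0_subproof x y : ip (0 : E) y = ip x (0 : E).
Proof. by rewrite ip0l ip0r. Qed.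
Let op0 : adjop E := AdjOp adjop0_subproof.

Fact adjopD_subproof S T x y :
  ip (S x + T x) y = ip x (adj_adj S y + adj_adj T y).
Proof. by rewrite ipDl ipDr !adjopP. Qed.
Let opD S T : adjop E := AdjOp (adjopD_subproof S T).

Fact adjopN_subproof T x y : ip (- T x) y = ip x (- adj_adj T y).
Proof. by rewrite ipNl ipNr adjopP. Qed.
Let opN T : adjop E := AdjOp (adjopN_subproof T).

Fact adjopZ_subproof (a : K) T x y : ip (a *: T x) y = ip x (a^* *: adj_adj T y).
Proof. by rewrite ipZl ipZr adjopP. Qed.
Let opZ a T : adjop E := AdjOp (adjopZ_subproof a T).

Fact adjopM_subproof S T x y : ip (S (T x)) y = ip x (adj_adj T (adj_adj S y)).
Proof. by rewrite !adjopP. Qed.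
Let opM S T : adjop E := AdjOp (adjopM_subproof S T).

Fact adjopS_subproof T x y : ip (adj_adj T x) y = ip x (T y).
Proof. by rewrite adjopP'. Qed.
Let opS T : adjop E := AdjOp (adjopS_subproof T).

Fact adjop_addA : associative opD.
Proof. by move=> S T U; apply: adjopE => x /=; rewrite addrA. Qed.
Fact adjop_addC : commutative opD.
Proof. by move=> S T; apply: adjopE => x /=; rewrite addrC. Qed.
Fact adjop_add0 : left_id op0 opD.
Proof. by move=> S; apply: adjopE => x /=; rewrite add0r. Qed.
Fact adjop_addN : left_inverse op0 opN opD.
Proof. by move=> S; apply: adjopE => x /=; rewrite addNr. Qed.
HB.instance Definition _ := GRing.isZmodule.Build (adjop E)
  adjop_addA adjop_addC adjop_add0 adjop_addN.

Fact adjop_scaleA k l T : opZ k (opZ l T) = opZ (k * l) T.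
Proof. by apply: adjopE => x /=; rewrite scalerA. Qed.
Fact adjop_scale1 : left_id 1 opZ.
Proof. by move=> T; apply: adjopE => x /=; rewrite scale1r. Qed.
Fact adjop_scaleDr : right_distributive opZ +%R.
Proof. by move=> k S T; apply: adjopE => x /=; rewrite scalerDr. Qed.
Fact adjop_scaleDl T : {morph opZ^~ T : k l / k + l}.
Proof. by move=> k l; apply: adjopE => x /=; rewrite scalerDl. Qed.
HB.instance Definition _ := GRing.Zmodule_isLmodule.Build K (adjop E)
  adjop_scaleA adjop_scale1 adjop_scaleDr adjop_scaleDl.

Fact adjop_mulA : associative opM.
Proof. by move=> S T U; apply: adjopE. Qed.
Fact adjop_mulDl : left_distributive opM +%R.
Proof. by move=> S T U; apply: adjopE. Qed.
Fact adjop_mulDr : right_distributive opM +%R.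
Proof. by move=> S T U; apply: adjopE => x /=; rewrite adjop_add. Qed.
Fact adjop_mulZl k S T : opM (k *: S) T = k *: opM S T.
Proof. by apply: adjopE. Qed.
Fact adjop_mulZr k S T : opM S (k *: T) = k *: opM S T.
Proof. by apply: adjopE => x /=; rewrite adjop_scale. Qed.
Fact adjop_starK : involutive opS.
Proof. by move=> T; apply: adjopE. Qed.
Fact adjop_starD : {morph opS : S T / S + T}.
Proof. by move=> S T; apply: adjopE. Qed.
Fact adjop_starZ k T : opS (k *: T) = k^* *: opS T.
Proof. by apply: adjopE. Qed.
Fact adjop_starM S T : opS (opM S T) = opM (opS T) (opS S).
Proof. by apply: adjopE. Qed.
HB.instance Definition _ := Lmodule_isStarAlgebra.Build K (adjop E)
  adjop_mulA adjop_mulDl adjop_mulDr adjop_mulZl adjop_mulZr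
  adjop_starK adjop_starD adjop_starZ adjop_starM.

Lemma adjop_addE S T x : (S + T) x = S x + T x. Proof. by []. Qed.
Lemma adjop_scaleE a T x : (a *: T) x = a *: T x. Proof. by []. Qed.
Lemma adjop_oppE T x : (- T) x = - T x. Proof. by []. Qed.
Lemma adjop_mulE S T x : (S ** T) x = S (T x). Proof. by []. Qed.

Fact rank1_subproof (x y z w : E) :
  ip (ract x (ip y z)) w = ip z (ract y (ip x w)).
Proof. by rewrite ip_ract ip_ractl ip_star. Qed.

(* The operator x y^*. *)
Definition rank1 (x y : E) : adjop E := AdjOp (rank1_subproof x y).

End AdjointableOperators.

Section CstarTheory.
Variables (K : numClosedFieldType) (B : cstarAlgType K).
Implicit Types a b : B.

Lemma norm_star a : `|star a| = `|a|.
Proof.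
have le b : `|b| <= `|star b|.
  have [->|b0] := eqVneq b 0; first by rewrite normr0.
  have nb0 : 0 < `|b| by rewrite normr_gt0.
  by rewrite -(ler_pM2r nb0) -expr2 -cstar_norm ler_normaM.
by apply/eqP; rewrite eq_le le andbT -{2}(starK a) le.
Qed.

Lemma closureE (V : normedModType K) (A : set V) v :
  closure A v <-> forall e : K, 0 < e -> exists2 w, A w & `|v - w| < e.
Proof.
split=> [clA e e0|h U].
  have [w [Aw /=]] := clA _ (nbhsx_ballx v e e0).
  by rewrite -ball_normE /=; exists w.
rewrite -nbhs_ballE => -[e /= e0 sub].
have [w Aw vw] := h e e0; exists w; split=> //; apply: sub.
by rewrite -ball_normE.
Qed.

End CstarTheory.

Section HilbertModuleTheory.
Variables (K : numClosedFieldType) (B : cstarAlgType K) (E : hilbModType B).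
Implicit Types (x y z : E).

Lemma norm_ip_weak x y : `|ip x y| <= 4%:R * (`|x| * `|y|).
Proof.
suff le (u v : E) : `|ip u v : B| <= (`|u| + `|v| : K) ^+ 2.
  have [->|x0] := eqVneq x 0; first by rewrite ip0l !normr0 mul0r mulr0.
  have [->|y0] := eqVneq y 0; first by rewrite ip0r !normr0 !mulr0.
  have nx : 0 < `|x| by rewrite normr_gt0.
  have ny : 0 < `|y| by rewrite normr_gt0.
  have := le (`|x|^-1 *: x) (`|y|^-1 *: y).
  rewrite ipZl ipZr !normrZ norm_conjC !normfV !normr_id.
  rewrite !mulVf ?gt_eqF// (_ : (1 + 1) ^+ 2 = 4%:R :> K); last first.
    by rewrite -(natrD _ 1 1) -natrX.
  by rewrite mulrA -invfM mulrC ler_pdivrMr ?mulr_gt0// mulrC.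
pose r (c : K) : B := (ip u v *+ 2) + (c^* ^+ 2 *: ip v u) *+ 2.
have pol (c : K) : `|c| = 1 -> `|r c| <= ((`|u| + `|v|) ^+ 2 : K) *+ 2.
  move=> c1; have cc : c * c^* = 1 by rewrite -normCK c1 expr1n.
  have Q (d : K) : `|d| = 1 ->
      `|d^* *: ip (u + d *: v) (u + d *: v) : B| <= (`|u| + `|v| : K) ^+ 2.
    move=> d1; rewrite normrZ norm_conjC d1 mul1r -norm_ip.
    rewrite lerXn2r ?nnegrE ?addr_ge0//.
    by apply: (le_trans (ler_normD _ _)); rewrite normrZ d1 mul1r.
  have -> : r c = c^* *: ip (u + c *: v) (u + c *: v)
                + (- c)^* *: ip (u + (- c) *: v) (u + (- c) *: v).
    have Qe (d : K) : d * d^* = 1 ->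
        d^* *: ip (u + d *: v) (u + d *: v) =
        (d^* *: (ip u u + ip v v)) + (ip u v + d^* ^+ 2 *: ip v u).
      move=> dd; rewrite !(ipDl, ipDr, ipZl, ipZr) !scalerDr !scalerA.
      rewrite (mulrC _ d) dd -mulrA (mulrC _ d) dd mulr1 scale1r -expr2.
      by rewrite (addrC (_ *: ip v u)) addrACA.
    rewrite !Qe ?rmorphN ?mulrNN// sqrrN scaleNr addrACA subrr add0r.
    by rewrite /r !mulr2n addrACA.
  by rewrite (le_trans (ler_normD _ _))// mulr2n lerD ?Q ?normrN.
have rr : r 1 + r 'i = ip u v *+ 4.
  rewrite /r conjC1 expr1n conjCi sqrrN sqrCi scaleN1r scale1r.
  by rewrite mulNrn addrACA subrr addr0 -mulrnDr.
have := le_trans (ler_normD (r 1) (r 'i)) (lerD (pol 1 _) (pol 'i _)).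
rewrite rr -mulrnDr normrMn lerMn2r /=; apply; [exact: normr1|].
exact: normCi.
Qed.

Definition range_ideal : set B :=
  closure (lspan [set b | exists x y : E, b = ip x y]).

Definition full := range_ideal = setT.

Definition finite_rank : set (adjop E) :=
  lspan [set T | exists x y : E, T = rank1 x y].

(* The closure of finite_rank in the operator norm. *)
Definition compact_op : set (adjop E) :=
  [set T | forall e : K, 0 < e ->
     exists2 S, finite_rank S & forall x, `|T x - S x| <= e * `|x|].

Local Notation I0 := (lspan [set b | exists x y : E, b = ip x y]).

Lemma range_ideal_ip x y : range_ideal (ip x y).
Proof. by apply: subset_closure; apply: lspan_gen; exists x, y. Qed.

Lemma range_ideal0 : range_ideal 0.
Proof. by apply: subset_closure; exact: lspan0. Qed.

Lemma range_idealD a b :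
  range_ideal a -> range_ideal b -> range_ideal (a + b).
Proof.
move=> /closureE Ia /closureE Ib; apply/closureE => e e0.
have e20 : 0 < e / 2%:R by rewrite divr_gt0.
have [v Iv av] := Ia _ e20; have [w Iw bw] := Ib _ e20.
exists (v + w); first exact: lspanD.
rewrite opprD addrACA (splitr e).
by rewrite (le_lt_trans (ler_normD _ _))// ltrD.
Qed.

Lemma range_idealZ (c : K) a : range_ideal a -> range_ideal (c *: a).
Proof.
move=> /closureE Ia; apply/closureE => e e0.
have c0 : 0 < `|c| + 1 by rewrite ltr_wpDl.
have [v Iv av] := Ia _ (divr_gt0 e0 c0).
exists (c *: v); first exact: lspanZ.
rewrite -scalerBr normrZ; move: av; rewrite ltr_pdivlMr// => av.
by rewrite (le_lt_trans _ av)// mulrC ler_wpM2l// lerDl.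
Qed.

Lemma lspan_ip_star a : I0 a -> I0 (star a).
Proof.
move: a; apply: lspan_ind => [|a b Ia Ib|c a Ia|_ [x [y ->]]].
- by rewrite -(scale0r (0 : B)) starZ conjC0 scale0r; exact: lspan0.
- by rewrite starD; exact: lspanD.
- by rewrite starZ; exact: lspanZ.
- by rewrite ip_star; apply: lspan_gen; exists y, x.
Qed.

Lemma lspan_ip_mulr a b : I0 a -> I0 (a ** b).
Proof.
move: a; apply: lspan_ind => [|a c Ia Ic|c a Ia|_ [x [y ->]]].
- rewrite -(scale0r (0 : B)) amulZl scale0r; exact: lspan0.
- by rewrite amulDl; exact: lspanD.
- by rewrite amulZl; exact: lspanZ.
- by rewrite -ip_ract; apply: lspan_gen; exists x, (ract y b).
Qed.

Lemma range_idealS a : range_ideal a -> range_ideal (star a).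
Proof.
move=> /closureE Ia; apply/closureE => e e0.
have [v Iv av] := Ia _ e0; exists (star v); first exact: lspan_ip_star.
by rewrite -scaleN1r -(rmorphN1 Num.conj) -starZ scaleN1r -starD norm_star.
Qed.

Lemma range_ideal_mulr a b : range_ideal a -> range_ideal (a ** b).
Proof.
move=> /closureE Ia; apply/closureE => e e0.
have b0 : 0 < `|b| + 1 by rewrite ltr_wpDl.
have [v Iv av] := Ia _ (divr_gt0 e0 b0).
exists (v ** b); first exact: lspan_ip_mulr.
rewrite -scaleN1r -amulZl scaleN1r -amulDl.
rewrite (le_lt_trans (ler_normaM _ _))//.
move: av; rewrite ltr_pdivlMr// => av.
by rewrite (le_lt_trans _ av)// ler_wpM2l// lerDl.
Qed.

Lemma adjop_comp_rank1 (T : adjop E) x y : T ** rank1 x y = rank1 (T x) y.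
Proof. by apply: adjopE => z /=; rewrite adjop_ract. Qed.

Lemma rank1_comp_adjop (T : adjop E) x y :
  rank1 x y ** T = rank1 x (star T y).
Proof. by apply: adjopE => z /=; rewrite adjopP'. Qed.

Lemma rank1_star x y : star (rank1 x y) = rank1 y x.
Proof. by apply: adjopE. Qed.

Lemma finite_rank_bounded (T : adjop E) : finite_rank T ->
  exists2 M : K, 0 < M & forall x, `|T x| <= M * `|x|.
Proof.
move: T; apply: lspan_ind => [|S T [M M0 SM] [N N0 TN]|c T [M M0 TM]|].
- by exists 1 => // x; rewrite normr0 mul1r.
- exists (M + N) => [|x]; first exact: addr_gt0.
  by rewrite mulrDl (le_trans (ler_normD _ _))// lerD.
- exists ((`|c| + 1) * M) => [|x]; first by rewrite mulr_gt0// ltr_wpDl.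
  rewrite adjop_scaleE normrZ -mulrA ler_pM//.
  by rewrite lerDl.
move=> _ [x [y ->]]; exists (4%:R * (`|y| * `|x|) + 1) => [|z].
  by rewrite ltr_wpDl// !mulr_ge0.
have le : `|ract x (ip y z)| <= `|x| * `|ip y z : B|.
  rewrite -(@ler_pXn2r _ 2)// ?nnegrE ?mulr_ge0//.
  rewrite norm_ip ip_ract ip_ractl (le_trans (ler_normaM _ _))//.
  rewrite (le_trans (ler_wpM2r _ (ler_normaM _ _)))// norm_star -norm_ip.
  by rewrite mulrAC -expr2 mulrC -exprMn.
rewrite /= (le_trans le)// mulrDl mul1r ler_wpDr//.
rewrite (le_trans (ler_wpM2l _ (norm_ip_weak y z)))//.
by rewrite mulrCA -!mulrA [`|x| * _]mulrCA [`|x| * _]mulrC.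
Qed.

Lemma compact_bounded (T : adjop E) : compact_op T ->
  exists2 M : K, 0 < M & forall x, `|T x| <= M * `|x|.
Proof.
move=> /(_ 1 ltr01)[S /finite_rank_bounded[M M0 SM] TS].
exists (1 + M) => [|x]; first exact: addr_gt0.
rewrite -(subrK (S x) (T x)) mulrDl (le_trans (ler_normD _ _))//.
by rewrite lerD.
Qed.

Lemma compact_rank1 x y : compact_op (rank1 x y).
Proof.
move=> e e0; exists (rank1 x y); first by apply: lspan_gen; exists x, y.
by move=> z; rewrite subrr normr0 mulr_ge0// ltW.
Qed.

Lemma compact0 : compact_op 0.
Proof.
move=> e e0; exists 0; first exact: lspan0.
by move=> z; rewrite subrr normr0 mulr_ge0// ltW.
Qed.

Lemma compactD S T : compact_op S -> compact_op T -> compact_op (S + T).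
Proof.
move=> cS cT e e0.
have e20 : 0 < e / 2%:R by rewrite divr_gt0.
have [V fV SV] := cS _ e20; have [W fW TW] := cT _ e20.
exists (V + W) => [|x]; first exact: lspanD.
rewrite !adjop_addE opprD addrACA (le_trans (ler_normD _ _))//.
by rewrite (splitr e) mulrDl lerD.
Qed.

Lemma compactZ (c : K) T : compact_op T -> compact_op (c *: T).
Proof.
move=> cT e e0.
have c0 : 0 < `|c| + 1 by rewrite ltr_wpDl.
have [V fV TV] := cT _ (divr_gt0 e0 c0).
exists (c *: V) => [|x]; first exact: lspanZ.
rewrite !adjop_scaleE -scalerBr normrZ.
rewrite (le_trans (ler_wpM2l _ (TV x)))// mulrA ler_wpM2r//.
by rewrite mulrCA ger_pMr// ler_pdivrMr// mul1r lerDl.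
Qed.

Lemma compactM S T : compact_op S -> compact_op T -> compact_op (S ** T).
Proof.
move=> cS /compact_bounded[M M0 TM] e e0.
have [V fV SV] := cS _ (divr_gt0 e0 M0).
exists (V ** T) => [|x].
  move: V fV {SV}; apply: lspan_ind => [|V W fV fW|c V fV|_ [x [y ->]]].
  - by rewrite -(scale0r (0 : adjop E)) amulZl scale0r; exact: lspan0.
  - by rewrite amulDl; exact: lspanD.
  - by rewrite amulZl; exact: lspanZ.
  - by rewrite rank1_comp_adjop; apply: lspan_gen; exists x, (star T y).
rewrite !adjop_mulE (le_trans (SV _))//.
rewrite (le_trans (ler_wpM2l (ltW (divr_gt0 e0 M0)) (TM x)))//.
by rewrite mulrA divfK// lt0r_neq0.
Qed.

Lemma compactS T : compact_op T -> compact_op (star T).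
Proof.
move=> cT e e0.
have e40 : 0 < e / 4%:R by rewrite divr_gt0.
have [V fV TV] := cT _ e40.
exists (star V) => [|x].
  move: V fV {TV}; apply: lspan_ind => [|V W fV fW|c V fV|_ [x [y ->]]].
  - by rewrite -(scale0r (0 : adjop E)) starZ conjC0 scale0r; exact: lspan0.
  - by rewrite starD; exact: lspanD.
  - by rewrite starZ; exact: lspanZ.
  - by rewrite rank1_star; apply: lspan_gen; exists y, x.
set z := _ - _.
have [->|z0] := eqVneq z 0; first by rewrite normr0 mulr_ge0// ltW.
have nz : 0 < `|z| by rewrite normr_gt0.
rewrite -(ler_pM2r nz) -expr2 norm_ip.
have -> : ip z z = ip (T z - V z) x :> B.
  rewrite ipDl ipNl {2}/z ipDr ipNr -!(adjopP T) -!(adjopP V).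
  by [].
rewrite (le_trans (norm_ip_weak _ _))//.
rewrite (le_trans (ler_wpM2l _ (ler_wpM2r _ (TV z))))//.
by rewrite !mulrA (mulrC 4%:R) mulfK ?pnatr_eq0// mulrAC.
Qed.

Definition compact_subalg : starSubalg (adjop E) :=
  StarSubalg compact0 compactD compactZ compactM compactS.

End HilbertModuleTheory.

Section DirectSum.
Variables (K : numClosedFieldType) (B : cstarAlgType K) (E : hilbModType B).

(* B (+) E with ip (b, x) (c, z) = star b ** c + ip x z. *)
Definition dsum : Type := (B * E)%type.

HB.instance Definition _ := GRing.Lmodule.copy dsum (B * E)%type.

Let dract (p : dsum) (c : B) : dsum := (p.1 ** c, ract p.2 c).
Let dip (p q : dsum) : B := star p.1 ** q.1 + ip p.2 q.2.

Fact dsum_ractDl p q c : dract (p + q) c = dract p c + dract q c.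
Proof. by rewrite /dract /= amulDl ractDl. Qed.
Fact dsum_ractDr p b c : dract p (b + c) = dract p b + dract p c.
Proof. by rewrite /dract /= amulDr ractDr. Qed.
Fact dsum_ractZl (a : K) p c : dract (a *: p) c = a *: dract p c.
Proof. by rewrite /dract /= amulZl ractZl. Qed.
Fact dsum_ractZr (a : K) p c : dract p (a *: c) = a *: dract p c.
Proof. by rewrite /dract /= amulZr ractZr. Qed.
Fact dsum_ractA p b c : dract (dract p b) c = dract p (b ** c).
Proof. by rewrite /dract /= amulA ractA. Qed.
Fact dsum_ipDr p q r : dip p (q + r) = dip p q + dip p r.
Proof. by rewrite /dip /= amulDr ipDr addrACA. Qed.
Fact dsum_ipZr (a : K) p q : dip p (a *: q) = a *: dip p q.
Proof. by rewrite /dip /= amulZr ipZr scalerDr. Qed.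
Fact dsum_ip_ract p q c : dip p (dract q c) = dip p q ** c.
Proof. by rewrite /dip /= amulDl ip_ract amulA. Qed.
Fact dsum_ip_star p q : star (dip p q) = dip q p.
Proof. by rewrite /dip starD starM starK ip_star. Qed.

Fact amul0r (a : B) : a ** 0 = 0.
Proof. by rewrite -{1}(scale0r (0 : B)) amulZr scale0r. Qed.
Fact amul0l (a : B) : 0 ** a = 0.
Proof. by rewrite -{1}(scale0r (0 : B)) amulZl scale0r. Qed.
Fact star0 : star 0 = 0 :> B.
Proof. by rewrite -{1}(scale0r (0 : B)) starZ conjC0 scale0r. Qed.

Fact dsum_ip_nondeg p : (forall q, dip q p = 0) -> p = 0.
Proof.
case: p => c z h; congr pair.
  have := h (c, 0); rewrite /dip /= ip0l addr0 => cc.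
  by apply/eqP; rewrite -normr_eq0 -sqrf_eq0 -cstar_norm cc normr0.
apply: ip_nondeg => x.
by have := h (0, x); rewrite /dip /= star0 amul0l add0r.
Qed.

HB.instance Definition _ := Lmodule_isInnerModule.Build K B dsum
  dsum_ractDl dsum_ractDr dsum_ractZl dsum_ractZr dsum_ractA
  dsum_ipDr dsum_ipZr dsum_ip_ract dsum_ip_star dsum_ip_nondeg.

End DirectSum.

Section LinkingAlgebra.
Variables (K : numClosedFieldType) (B : cstarAlgType K) (E : hilbModType B).
Implicit Types (b c : B) (x y z : E) (k l : adjop E).

Fact blockop_subproof b x y k (p q : dsum E) :
  ip ((b ** p.1 + ip x p.2, ract y p.1 + k p.2) : dsum E) q =
  ip p ((star b ** q.1 + ip y q.2, ract x q.1 + star k q.2) : dsum E).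
Proof.
rewrite /ip /= starD starM ip_star amulDl amulDr ipDl ipDr.
rewrite ip_ractl ip_ract amulA adjopP -!addrA; congr (_ + _).
by rewrite addrCA.
Qed.

(* The matrix (b, x^*; y, k), acting on columns (c, z) in B (+) E. *)
Definition blockop b x y k : adjop (dsum E) := AdjOp (blockop_subproof b x y k).

Lemma blockop_inj b x y k b' x' y' k' :
  blockop b x y k = blockop b' x' y' k' -> [/\ b = b', x = x', y = y' & k = k'].
Proof.
move=> eqM; have eqf (p : dsum E) : blockop b x y k p = blockop b' x' y' k' p.
  by rewrite eqM.
have eql c : b ** c = b' ** c /\ ract y c = ract y' c.
  by have := eqf (c, 0) => -[] /=; rewrite !ip0r !addr0
    -(scale0r (0 : E)) !adjop_scale !scale0r !addr0.
have eqr z : ip x z = ip x' z /\ k z = k' z.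
  by have := eqf (0, z) => -[] /=; rewrite !amul0r !ract0r !add0r.
split.
- have h c : (b - b') ** c = 0.
    by rewrite -scaleN1r amulDl amulZl (eql c).1 scaleN1r subrr.
  apply/eqP; rewrite -subr_eq0 -normr_eq0 -norm_star -sqrf_eq0 -normr_eq0.
  by rewrite -cstar_norm starK h !normr0.
- by apply: ip_injr => z; rewrite -ip_star (eqr z).1 ip_star.
- have h c : ract (y - y') c = 0.
    by rewrite -scaleN1r ractDl ractZl (eql c).2 scaleN1r subrr.
  set d := y - y' in h.
  have dd : ip d d ** ip d d = 0 by rewrite -ip_ract h ip0r.
  apply/eqP; rewrite -subr_eq0 -/d -normr_eq0 -sqrf_eq0 norm_ip -sqrf_eq0.
  by rewrite -cstar_norm ip_star dd normr0.
- by apply: adjopE => z; exact: (eqr z).2.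
Qed.

(* The possible 11-corners: *-subalgebras of B containing <E, E>. *)
Record corner11 := Corner11 {
  c11 :> starSubalg B;
  c11_ip : forall x y, sa_set c11 (ip x y)
}.

Variable I : corner11.

Definition linking_set : set (adjop (dsum E)) :=
  [set M | exists b x y k,
     [/\ sa_set I b, compact_op k & M = blockop b x y k]].

Lemma linking0 : linking_set 0.
Proof.
exists 0, 0, 0, 0; split; [exact: sa0|exact: compact0|].
by apply: adjopE => -[c z] /=; rewrite amul0l ract0l ip0l !addr0.
Qed.

Lemma linkingD M N : linking_set M -> linking_set N -> linking_set (M + N).
Proof.
move=> [b [x [y [k [Ib kk ->]]]]] [b' [x' [y' [k' [Ib' kk' ->]]]]].
exists (b + b'), (x + x'), (y + y'), (k + k').
split; [exact: saD|exact: compactD|].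
apply: adjopE => -[c z]; apply: (congr2 pair) => /=.
  by rewrite amulDl ipDl addrACA.
by rewrite ractDl addrACA.
Qed.

Lemma linkingZ (a : K) M : linking_set M -> linking_set (a *: M).
Proof.
move=> [b [x [y [k [Ib kk ->]]]]].
exists (a *: b), (a^* *: x), (a *: y), (a *: k).
split; [exact: saZ|exact: compactZ|].
apply: adjopE => -[c z]; apply: (congr2 pair) => /=.
  by rewrite amulZl ipZl conjCK scalerDr.
by rewrite ractZl scalerDr.
Qed.

Lemma linkingM M N : linking_set M -> linking_set N -> linking_set (M ** N).
Proof.
move=> [b [x [y [k [Ib kk ->]]]]] [b' [x' [y' [k' [Ib' kk' ->]]]]].
exists (b ** b' + ip x y'), (ract x' (star b) + star k' x),
  (ract y b' + k y'), (rank1 y x' + k ** k').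
split; first by apply: saD; [exact: saM|exact: c11_ip].
  by apply: compactD; [exact: compact_rank1|exact: compactM].
apply: adjopE => -[c z]; apply: (congr2 pair) => /=.
  rewrite amulDl ipDl amulDr ipDr amulA ip_ractl starK ip_ract.
  by rewrite -(adjopP' k') addrACA.
by rewrite ractDr ractDl adjop_add ractA adjop_ract addrACA.
Qed.

Lemma linkingS M : linking_set M -> linking_set (star M).
Proof.
move=> [b [x [y [k [Ib kk ->]]]]].
exists (star b), y, x, (star k); split; [exact: saS|exact: compactS|].
exact: adjopE.
Qed.

Definition linking_subalg : starSubalg (adjop (dsum E)) :=
  StarSubalg linking0 linkingD linkingZ linkingM linkingS.

Definition linking_over := subalg linking_subalg.

Fact linkmx_subproof (b : subalg I) x y (k : subalg (compact_subalg E)) :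
  linking_set (blockop (sa_val b) x y (sa_val k)).
Proof.
exists (sa_val b), x, y, (sa_val k).
by split; [exact: (sa_valP b)|exact: (sa_valP k)|].
Qed.

Definition linkmx (b : subalg I) x y (k : subalg (compact_subalg E)) :
  linking_over := Subalg (linkmx_subproof b x y k : sa_set linking_subalg _).

Lemma linkmxP (M : linking_over) :
  exists (b : subalg I) x y (k : subalg (compact_subalg E)), M = linkmx b x y k.
Proof.
case: M => M /[dup] LM [b [x [y [k [Ib kk eM]]]]].
by exists (Subalg Ib), x, y, (Subalg (kk : sa_set (compact_subalg E) k));
  apply: sa_val_inj.
Qed.

Lemma linkmx_inj (b b' : subalg I) x x' y y'
    (k k' : subalg (compact_subalg E)) :
  linkmx b x y k = linkmx b' x' y' k' -> [/\ b = b', x = x', y = y' & k = k'].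
Proof.
move=> /(congr1 (@sa_val _ _ _)) /blockop_inj[bb xx yy kk].
by split=> //; exact: sa_val_inj.
Qed.

Definition e11 (b : subalg I) := linkmx b 0 0 0.
Definition e12 x := linkmx 0 x 0 0.
Definition e21 y := linkmx 0 0 y 0.
Definition e22 (k : subalg (compact_subalg E)) := linkmx 0 0 0 k.

End LinkingAlgebra.

Section LinkingAlgebras.
Variables (K : numClosedFieldType) (B : cstarAlgType K) (E : hilbModType B).

Definition full_subalg : starSubalg B :=
  @StarSubalg K B setT Logic.I (fun _ _ _ _ => Logic.I) (fun _ _ _ => Logic.I)
    (fun _ _ _ _ => Logic.I) (fun _ _ => Logic.I).

Definition full_corner : corner11 E :=
  @Corner11 K B E full_subalg (fun _ _ => Logic.I).

Definition range_corner : corner11 E :=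
  @Corner11 K B E (StarSubalg (range_ideal0 E) (@range_idealD K B E)
    (@range_idealZ K B E) (fun a b Ia _ => range_ideal_mulr Ia)
    (@range_idealS K B E)) (@range_ideal_ip K B E).

Definition linking := linking_over full_corner.

(* As a *-algebra, K(B_E (+) E) is the *-algebra of these matrices; here they act
   on B (+) E, in which B_E (+) E sits. *)
Definition reduced_linking := linking_over range_corner.

End LinkingAlgebras.

Section Maps.
Variables (K : numClosedFieldType) (B C : cstarAlgType K).
Variables (E : hilbModType B) (F : hilbModType C).

Definition generalized_isometry (u : E -> F) :=
  exists2 phi : B -> C, star_hom phi
    & forall x x', ip (u x) (u x') = phi (ip x x').

Definition ternary_hom (u : E -> F) :=
  linear u /\
  forall x y z, u (ract x (ip y z)) = ract (u x) (ip (u y) (u z)).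

Variables (I : corner11 E) (J : corner11 F).
Implicit Types (Phi : linking_over I -> linking_over J) (u : E -> F).

Definition extends Phi u := forall x, Phi (e21 I x) = e21 J (u x).

Definition blockwise Phi :=
  [/\ Phi @` range (@e11 K B E I) `<=` range (@e11 K C F J),
      Phi @` range (@e12 K B E I) `<=` range (@e12 K C F J),
      Phi @` range (@e21 K B E I) `<=` range (@e21 K C F J)
    & Phi @` range (@e22 K B E I) `<=` range (@e22 K C F J)].

(* Phi = (phi, u^*; u, psi), where u^* : x^* |-> (u x)^*; the 12-entry of linkmx
   is x^*, given by x. *)
Definition block_form Phi u :=
  exists (phi : subalg I -> subalg J)
         (psi : subalg (compact_subalg E) -> subalg (compact_subalg F)),
  forall b x y k,
    Phi (linkmx b x y k) = linkmx (phi b) (u x) (u y) (psi k).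

Definition hom_extension Phi u := star_hom Phi /\ extends Phi u.

End Maps.

(* Main.v *)
(** A linear map [u] with [u (x <y,z>) = u x <u y, u z>] prescribes *-homomorphisms
    [phi : <x,y> |-> <u x, u y>] and [psi : x y^* |-> (u x) (u y)^*] on the algebraic
    spans.  They are well defined because [c = sum <u x_i, u y_i>] is determined by
    the products [(u x) c = u (x b)], and dually for [psi].  They are contractive: for
    self-adjoint [a] with [|a| <= 1] the element [d = 1 - sqrt (1 - a^2)] lies in the
    ideal where the map is defined, and the relation [(1 - d)^2 + a^2 = 1] is
    preserved, so the images of [(1 - d) + i a] and its adjoint are isometric.  Hence
    they extend to the closures and assemble to the homomorphism of linking algebras.

    The same contraction argument, now with values in the operators on [C (+) F],
    shows that an arbitrary extension is continuous on the diagonal corners and is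
    therefore determined by [u].  Cauchy-Schwarz in [C (+) F] needs sums of elements
    [b^* b] to be positive, hence the Kelley-Vaught theorem.  Surjectivity passes from
    the dense range to the closure by lifting with controlled norm, via the functional
    calculus [b |-> b / (1 + b^2 / 4)]. *)

Require Import Defs.
From HB Require Import structures.
From mathcomp Require Import all_boot all_order all_algebra.
From mathcomp Require Import complex ring lra.
From mathcomp Require Import boolp classical_sets functions reals topology normedtype.
Set Implicit Arguments.
Unset Strict Implicit.
Unset Printing Implicit Defensive.
Import Order.TTheory GRing.Theory Num.Theory.
Local Open Scope ring_scope.
Local Open Scope complex_scope.

(** * Normalisation in noncommutative algebras *)

(** No spectrum is used. Algebras act on inner modules, where [idop] supplies the unit that the
    algebra itself may lack, and sizes are compared through [opbd T m] (m bounds T) instead of an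
    operator norm. The tool behind most bounds is [opbd_commuting]: if [star Y ** X = star X ** Y],
    a bound m^2 of [star Y ** Y + star X ** X] makes m a bound of X. Maps defined on incomplete
    spans are handled as graphs ([star_rel]), since their single-valuedness has to be proved. The
    obstacle in [dsum F] is that it comes with no norm: its length [vn] satisfies the triangle
    inequality only after Cauchy-Schwarz. Positivity is therefore first applied to operators on
    [selfmod B], where Cauchy-Schwarz is the submultiplicativity of the norm, and then yields
    Cauchy-Schwarz for the other modules. The corners [I] and [J] stay arbitrary until the end, so
    that the linking and the reduced linking algebras are treated together. *)

Section NoncommutativeNormalForm.
Variable K : numClosedFieldType.

(** Syntax for reflection: an identity in a unital algebra is checked by comparing, word by word,
    the coefficients of its noncommutative normal form. *)
Inductive ncexpr :=
  | NCvar of nat | NCone | NCzero | NCadd of ncexpr & ncexpr | NCopp of ncexpr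
  | NCmul of ncexpr & ncexpr | NCscale of K & ncexpr.

Variables (A : starAlgType K) (o : A).
Hypotheses (omul : forall a, o ** a = a) (mulo : forall a, a ** o = a).
Variable env : seq A.

Fixpoint nceval e : A :=
  match e with
  | NCvar i => nth 0 env i
  | NCone => o
  | NCzero => 0
  | NCadd e f => nceval e + nceval f
  | NCopp e => - nceval e
  | NCmul e f => nceval e ** nceval f
  | NCscale c e => c *: nceval e
  end.

(** List operations are redefined so that [nc_zero] can unfold exactly these with [lazy] and leave
    the coefficient arithmetic to [ring] and [field]. *)
Fixpoint nccat T (s t : seq T) :=
  match s with [::] => t | x :: s' => x :: nccat s' t end.

Fixpoint ncscale (c : K) (w : seq nat) (p : seq (K * seq nat)) :=
  match p with
  | [::] => [::]
  | m :: p' => (c * m.1, nccat w m.2) :: ncscale c w p'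
  end.

Fixpoint ncmul (p q : seq (K * seq nat)) :=
  match p with
  | [::] => [::]
  | m :: p' => nccat (ncscale m.1 m.2 q) (ncmul p' q)
  end.

Fixpoint ncnorm e : seq (K * seq nat) :=
  match e with
  | NCvar i => [:: (1, [:: i])]
  | NCone => [:: (1, [::])]
  | NCzero => [::]
  | NCadd e f => nccat (ncnorm e) (ncnorm f)
  | NCopp e => ncscale (- 1) [::] (ncnorm e)
  | NCmul e f => ncmul (ncnorm e) (ncnorm f)
  | NCscale c e => ncscale c [::] (ncnorm e)
  end.

Fixpoint ncword (w : seq nat) : A :=
  match w with [::] => o | i :: w' => nth 0 env i ** ncword w' end.

Fixpoint ncpoly (p : seq (K * seq nat)) : A :=
  match p with [::] => 0 | m :: p' => m.1 *: ncword m.2 + ncpoly p' end.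

Lemma nccatE T (s t : seq T) : nccat s t = s ++ t.
Proof. by elim: s => //= x s ->. Qed.

Lemma ncpoly_cat p q : ncpoly (p ++ q) = ncpoly p + ncpoly q.
Proof. by elim: p => [|m p /= ->]; rewrite ?add0r ?addrA. Qed.

Lemma ncword_cat v w : ncword (v ++ w) = ncword v ** ncword w.
Proof. by elim: v => [|i v /= ->]; rewrite ?omul ?amulA. Qed.

Fact amulr0 (a : A) : a ** 0 = 0.
Proof. by rewrite -{1}(scale0r (0 : A)) amulZr scale0r. Qed.
Fact amull0 (a : A) : 0 ** a = 0.
Proof. by rewrite -{1}(scale0r (0 : A)) amulZl scale0r. Qed.

Lemma ncpoly_scale c w p : ncpoly (ncscale c w p) = c *: (ncword w ** ncpoly p).
Proof.
elim: p => [|m p /= ->]; first by rewrite amulr0 scaler0.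
by rewrite nccatE ncword_cat amulDr scalerDr amulZr !scalerA.
Qed.

Lemma ncpoly_mul p q : ncpoly (ncmul p q) = ncpoly p ** ncpoly q.
Proof.
elim: p => [|m p /= IH]; first by rewrite amull0.
by rewrite nccatE ncpoly_cat ncpoly_scale IH amulDl amulZl.
Qed.

Lemma ncnormE e : nceval e = ncpoly (ncnorm e).
Proof.
elim: e => /= [i|||e -> f ->|e ->|e -> f ->|c e ->].
- by rewrite mulo scale1r addr0.
- by rewrite scale1r addr0.
- by [].
- by rewrite nccatE ncpoly_cat.
- by rewrite ncpoly_scale /= omul scaleN1r.
- by rewrite ncpoly_mul.
- by rewrite ncpoly_scale /= omul.
Qed.

Fixpoint nceqn (m n : nat) :=
  match m, n with
  | O, O => true | S m', S n' => nceqn m' n' | _, _ => false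
  end.

Fixpoint nceqw (v w : seq nat) :=
  match v, w with
  | [::], [::] => true
  | i :: v', j :: w' => if nceqn i j then nceqw v' w' else false
  | _, _ => false
  end.

Fixpoint nccoef (w : seq nat) (p : seq (K * seq nat)) : K :=
  match p with
  | [::] => 0
  | m :: p' => if nceqw w m.2 then m.1 + nccoef w p' else nccoef w p'
  end.

Fixpoint ncdrop (w : seq nat) (p : seq (K * seq nat)) :=
  match p with
  | [::] => [::]
  | m :: p' => if nceqw w m.2 then ncdrop w p' else m :: ncdrop w p'
  end.

(** The fuel [n] bounds the number of distinct words; the length of [p] suffices, since each round
    removes at least the head. *)
Fixpoint ncvanish n (p : seq (K * seq nat)) : Prop :=
  match n with
  | O => p = [::]
  | S n' => match p with
            | [::] => True
            | m :: p' => m.1 + nccoef m.2 p' = 0 /\ ncvanish n' (ncdrop m.2 p')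
            end
  end.

Lemma nceqwP v w : nceqw v w -> v = w.
Proof.
have nP m n : nceqn m n -> m = n by elim: m n => [|m IH] [|n] //= /IH ->.
elim: v w => [|i v IH] [|j w] //=.
by case: ifP => // /nP -> /IH ->.
Qed.

Lemma ncpoly_split w p :
  ncpoly p = nccoef w p *: ncword w + ncpoly (ncdrop w p).
Proof.
elim: p => [|m p /= ->]; first by rewrite scale0r addr0.
case: ifP => [/nceqwP ->|_ /=]; first by rewrite scalerDl addrA.
by rewrite addrCA.
Qed.

Lemma ncpoly_vanish n p : ncvanish n p -> ncpoly p = 0.
Proof.
elim: n p => [|n IH] p /=; first by move->.
case: p => [//|m p] [m0 /IH] /=.
by rewrite (ncpoly_split m.2 p) addrA -scalerDl m0 scale0r add0r.
Qed.

Fixpoint nclen T (s : seq T) : nat :=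
  match s with [::] => O | _ :: s' => S (nclen s') end.

Lemma nc_vanish e : (let p := ncnorm e in ncvanish (nclen p) p) -> nceval e = 0.
Proof. by move=> h; rewrite ncnormE; exact: ncpoly_vanish h. Qed.

End NoncommutativeNormalForm.

(** Lets a hypothesis be used modulo the algebra axioms: what remains is a formal identity, which
    [alg_by] settles by normal form. *)
Lemma lin_comb (V : zmodType) (x y a b : V) :
  a = b -> x - y - (a - b) = 0 -> x = y.
Proof. by move=> ->; rewrite subrr subr0 => /eqP; rewrite subr_eq0 => /eqP. Qed.

Lemma subr0_imp (V : zmodType) (x y : V) : x - y = 0 -> x = y.
Proof. by move=> /eqP; rewrite subr_eq0 => /eqP. Qed.

Ltac nc_index x l :=
  lazymatch l with
  | ?y :: ?l' => match x with
                 | y => constr:(O)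
                 | _ => let n := nc_index x l' in constr:(S n)
                 end
  end.

Ltac nc_mem x l :=
  lazymatch l with
  | [::] => constr:(false)
  | ?y :: ?l' => match x with y => constr:(true) | _ => nc_mem x l' end
  end.

Ltac nc_atoms o t l :=
  lazymatch t with
  | ?a + ?b => let l' := nc_atoms o a l in nc_atoms o b l'
  | - ?a => nc_atoms o a l
  | ?a ** ?b => let l' := nc_atoms o a l in nc_atoms o b l'
  | ?c *: ?a => nc_atoms o a l
  | 0 => l
  | o => l
  | _ => let b := nc_mem t l in
         lazymatch b with true => l | false => constr:(t :: l) end
  end.

Ltac nc_reify K o l t :=
  lazymatch t with
  | ?a + ?b => let a' := nc_reify K o l a in let b' := nc_reify K o l b in
               constr:(NCadd a' b')
  | - ?a => let a' := nc_reify K o l a in constr:(NCopp a')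
  | ?a ** ?b => let a' := nc_reify K o l a in let b' := nc_reify K o l b in
                constr:(NCmul a' b')
  | ?c *: ?a => let a' := nc_reify K o l a in constr:(@NCscale K c a')
  | 0 => constr:(@NCzero K)
  | o => constr:(@NCone K)
  | _ => let n := nc_index t l in constr:(@NCvar K n)
  end.

(* Reduces [t = 0] to one scalar equation per word in the atoms of [t]. *)
Ltac nc_zero K A o omul mulo :=
  lazymatch goal with
  | |- ?t = _ =>
    let l := nc_atoms o t (@nil A) in
    let e := nc_reify K o l t in
    refine (@nc_vanish K A o omul mulo l e _);
    lazy beta iota zeta delta [ncnorm ncmul ncscale nccat nceqn nceqw nccoef
      ncdrop ncvanish nclen fst snd];
    repeat apply: conj; try exact: Logic.I; try first [by ring | by field]
  end.

(** * The seminorm of an inner module *)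

Section RealNorm.
Variables (R : realType) (V : normedZmodType R[i]).
Implicit Types x y : V.

(** Norms take values in R[i]; the estimates need a real field, where [lra] and [nra] apply. *)
Definition nr x : R := complex.Re `|x|.

Lemma nrE x : `|x| = (nr x)%:C.
Proof.
by have := normr_ge0 x; rewrite /nr; case: `|x| => a b; rewrite lecE /= => /andP[/eqP ->].
Qed.

Lemma nr_ge0 x : 0 <= nr x.
Proof. by rewrite -lecR -nrE normr_ge0. Qed.

Lemma nrD x y : nr (x + y) <= nr x + nr y.
Proof. by rewrite -lecR rmorphD /= -!nrE ler_normD. Qed.

Lemma nrN x : nr (- x) = nr x.
Proof. by rewrite /nr normrN. Qed.

Lemma nr0 : nr 0 = 0.
Proof. by rewrite /nr normr0. Qed.

Lemma nr_eq0 x : nr x = 0 -> x = 0.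
Proof. by move=> x0; apply/eqP; rewrite -normr_eq0 nrE x0. Qed.

End RealNorm.

Section ScalarNorm.
Variable R : realType.

Lemma nr_real (r : R) : nr (r%:C : R[i]) = `|r|.
Proof. by rewrite /nr normc_def /= expr0n addr0 sqrtr_sqr. Qed.

Lemma nr_i : nr ('i : R[i]) = 1.
Proof. by rewrite /nr normc_def /= expr0n expr1n add0r sqrtr1. Qed.

Lemma nrZ (V : normedModType R[i]) (c : R[i]) (x : V) : nr (c *: x) = nr c * nr x.
Proof. by apply: complexI; rewrite rmorphM /= -!nrE normrZ. Qed.

Lemma nrconj (c : R[i]) : nr (c^* : R[i]) = nr c.
Proof. by rewrite /nr norm_conjC. Qed.

Variable B : cstarAlgType R[i].
Implicit Types a b : B.

Lemma nrM a b : nr (a ** b) <= nr a * nr b.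
Proof. by rewrite -lecR rmorphM /= -!nrE ler_normaM. Qed.

Lemma nr_star a : nr (star a) = nr a.
Proof. by rewrite /nr norm_star. Qed.

Lemma nr_cstar a : nr (star a ** a) = nr a ^+ 2.
Proof. by apply: complexI; rewrite rmorphXn /= -!nrE cstar_norm. Qed.

End ScalarNorm.

Section Seminorm.
Variables (R : realType) (B : cstarAlgType R[i]) (V : innerModType B).
Implicit Types (x y z : V) (S T : adjop V) (c : R[i]).

(** On a Hilbert module this is the norm, on [dsum E] the usual length in a direct sum; the triangle
    inequality awaits Cauchy-Schwarz. *)
Definition vn z : R := Num.sqrt (nr (ip z z : B)).

Definition cauchy_schwarz := forall x y, nr (ip x y : B) <= vn x * vn y.

Lemma vn_ge0 z : 0 <= vn z. Proof. exact: sqrtr_ge0. Qed.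

Lemma vn_sqr z : vn z ^+ 2 = nr (ip z z : B).
Proof. by rewrite sqr_sqrtr ?nr_ge0. Qed.

Lemma vnZ c z : vn (c *: z) = nr c * vn z.
Proof.
rewrite /vn ipZr ipZl scalerA nrZ -[X in X * Num.sqrt _]ger0_norm ?nr_ge0//.
rewrite -sqrtr_sqr -sqrtrM ?sqr_ge0//; congr (Num.sqrt (_ * _)).
by apply: complexI; rewrite rmorphXn /= -!nrE normrM norm_conjC expr2.
Qed.

Lemma vnN z : vn (- z) = vn z.
Proof. by rewrite /vn ipNr ipNl opprK. Qed.

Lemma vn0 : vn 0 = 0.
Proof. by rewrite /vn ip0r nr0 sqrtr0. Qed.

Hypothesis CS : cauchy_schwarz.

Lemma vnD x y : vn (x + y) <= vn x + vn y.
Proof.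
rewrite -(@ler_pXn2r _ 2) ?nnegrE ?addr_ge0 ?vn_ge0//.
rewrite vn_sqr ipDr !ipDl.
have := CS x y; have := CS y x; have := vn_sqr x; have := vn_sqr y.
have := nrD (ip x x + ip y x) (ip x y + ip y y : B).
have := nrD (ip x x) (ip y x : B); have := nrD (ip x y) (ip y y : B).
by move: (nr (_ + _ + _)) (nr (_ + _)) (nr (_ + _)) => *; nra.
Qed.

Lemma vn_eq0 z : vn z = 0 -> z = 0.
Proof.
move=> z0; apply: ip_nondeg => y; apply: nr_eq0; apply/le_anti.
by rewrite nr_ge0 andbT (le_trans (CS _ _))// z0 mulr0.
Qed.

End Seminorm.

(** * Bounds of operators *)

Section OperatorBound.
Variables (R : realType) (B : cstarAlgType R[i]) (V : innerModType B).
Implicit Types (x y z : V) (S T : adjop V) (c : R[i]) (m n : R).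

Definition opbd T m := 0 <= m /\ forall z, vn (T z) <= m * vn z.

Definition bounded T := exists m, opbd T m.

Fact idop_subproof x y : ip x y = ip x y. Proof. by []. Qed.
Definition idop : adjop V := AdjOp idop_subproof.

Lemma idopl T : idop ** T = T. Proof. exact: adjopE. Qed.
Lemma idopr T : T ** idop = T. Proof. exact: adjopE. Qed.
Lemma star_idop : star idop = idop. Proof. exact: adjopE. Qed.

Lemma opbd_ge0 T m : opbd T m -> 0 <= m. Proof. by case. Qed.

Lemma opbd_le T m n : m <= n -> opbd T m -> opbd T n.
Proof.
move=> mn [m0 Tm]; split=> [|z]; first exact: le_trans mn.
by rewrite (le_trans (Tm z))// ler_wpM2r ?vn_ge0.
Qed.

Lemma opbd1 : opbd idop 1.
Proof. by split=> // z; rewrite mul1r. Qed.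

Lemma opbd0 : opbd 0 0.
Proof. by split=> // z; rewrite mul0r vn0. Qed.

Lemma opbdN T m : opbd T m -> opbd (- T) m.
Proof. by move=> [m0 Tm]; split=> // z; rewrite adjop_oppE vnN. Qed.

Lemma opbdM S T m n : opbd S m -> opbd T n -> opbd (S ** T) (m * n).
Proof.
move=> [m0 Sm] [n0 Tn]; split=> [|z]; first exact: mulr_ge0.
by rewrite (le_trans (Sm _))// -mulrA ler_wpM2l.
Qed.

Lemma opbdZ c T m : opbd T m -> opbd (c *: T) (nr c * m).
Proof.
move=> [m0 Tm]; split=> [|z]; first by rewrite mulr_ge0 ?nr_ge0.
by rewrite adjop_scaleE vnZ -mulrA ler_wpM2l ?nr_ge0.
Qed.

Lemma opbdZr (r : R) T m : opbd T m -> opbd (r%:C *: T) (`|r| * m).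
Proof. by rewrite -nr_real; exact: opbdZ. Qed.

Lemma opbd_lim T m : (forall e, 0 < e -> opbd T (m + e)) -> opbd T m.
Proof.
move=> h; split=> [|z].
  by apply/ler_addgt0Pr => e e0; have [] := h _ e0.
apply/ler_addgt0Pr => e e0.
have p0 : 0 < vn z + 1 by rewrite ltr_wpDl ?vn_ge0.
have [_ /(_ z) Tz] := h _ (divr_gt0 e0 p0).
rewrite (le_trans Tz)// mulrDl lerD2l -mulrA ger_pMr// mulrC ler_pdivrMr//.
by rewrite mul1r lerDl.
Qed.

Hypothesis CS : cauchy_schwarz V.

Lemma opbdD S T m n : opbd S m -> opbd T n -> opbd (S + T) (m + n).
Proof.
move=> [m0 Sm] [n0 Tn]; split=> [|z]; first exact: addr_ge0.
by rewrite mulrDl (le_trans (vnD CS _ _))// lerD.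
Qed.

Lemma opbdB S T m n : opbd S m -> opbd T n -> opbd (S - T) (m + n).
Proof. by move=> Sm /opbdN; exact: opbdD. Qed.

Lemma vn_sqr_le (x z : V) (m : R) : 0 <= m -> vn x ^+ 2 <= m * vn x * vn z ->
  vn x <= m * vn z.
Proof.
move=> m0; have := vn_ge0 x; rewrite le_eqVlt => /predU1P[<- _|x0].
  by rewrite mulr_ge0 ?vn_ge0.
by rewrite expr2 mulrAC ler_pM2r.
Qed.

Lemma opbd_star T m : opbd T m -> opbd (star T) m.
Proof.
move=> [m0 Tm]; split=> // z; apply: vn_sqr_le => //.
rewrite vn_sqr -(adjopP T (star T z) z) (le_trans (CS _ _))//.
by rewrite ler_wpM2r ?vn_ge0.
Qed.

Lemma opbd_cstar T m : 0 <= m -> opbd (star T ** T) (m ^+ 2) -> opbd T m.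
Proof.
move=> m0 [_ Tm]; split=> // z.
rewrite -(@ler_pXn2r _ 2) ?nnegrE ?mulr_ge0 ?vn_ge0//.
rewrite vn_sqr adjopP (le_trans (CS _ _))// exprMn [vn z ^+ 2]expr2 mulrCA.
by apply: ler_wpM2l; [exact: vn_ge0|exact: Tm].
Qed.

Lemma opbd_eq0 T : (forall e, 0 < e -> opbd T e) -> T = 0.
Proof.
move=> h; apply: adjopE => z; apply: (vn_eq0 CS); apply/le_anti.
rewrite vn_ge0 andbT -(mul0r (vn z)).
by have [_] : opbd T 0 by apply: opbd_lim => e; rewrite add0r; exact: h.
Qed.

(* [Y + i X] and [Y - i X] have the same modulus. *)
Lemma opbd_commuting (X Y W : adjop V) m : star Y ** X = star X ** Y ->
  star Y ** Y + star X ** X = W -> 0 <= m -> opbd W (m ^+ 2) -> opbd X m.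
Proof.
move=> YX <- m0 [_ Wm]; split=> // z.
have YXz : ip (Y z) (X z) = ip (X z) (Y z).
  by rewrite !adjopP; congr ip; have := congr1 (fun T : adjop V => T z) YX.
(* Used for c = i and c = -i: the cross terms carry the factor c + c^* = 0, so Y + c X has the same
   modulus for both, and 2 i X is the difference of the two. *)
have h (c : R[i]) : c * c^* = 1 -> c + c^* = 0 -> vn (Y z + c *: X z) <= m * vn z.
  move=> cc c0; rewrite -(@ler_pXn2r _ 2) ?nnegrE ?mulr_ge0 ?vn_ge0//.
  rewrite vn_sqr ipDr !ipDl !(ipZl, ipZr) scalerA (mulrC _ c) cc scale1r YXz.
  have -> : ip (Y z) (Y z) + c^* *: ip (X z) (Y z)
      + (c *: ip (X z) (Y z) + ip (X z) (X z))
      = ip z ((star Y ** Y + star X ** X) z) :> B.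
    rewrite adjop_addE !adjop_mulE ipDr -!adjopP -addrA; congr (_ + _).
    by rewrite addrA -scalerDl addrC addrC (addrC c^*) c0 scale0r add0r.
  rewrite (le_trans (CS _ _))// exprMn [vn z ^+ 2]expr2 mulrCA.
  by apply: ler_wpM2l; [exact: vn_ge0|exact: Wm].
have ii : 'i * 'i^* = 1 :> R[i] by rewrite -normCK normCi expr1n.
have i0 : 'i + 'i^* = 0 :> R[i] by rewrite conjCi subrr.
have hp := h _ ii i0.
have hm : vn (Y z + (- 'i) *: X z) <= m * vn z.
  by apply: h; rewrite rmorphN ?mulrNN// -opprD i0 oppr0.
have : vn (('i *+ 2) *: X z) <= m * vn z + m * vn z.
  have -> : ('i *+ 2) *: X z = (Y z + 'i *: X z) - (Y z + (- 'i) *: X z).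
    by rewrite opprD addrACA subrr add0r scaleNr opprK mulr2n scalerDl.
  rewrite (le_trans (vnD CS _ _))// vnN lerD ?hp ?hm//.
rewrite vnZ -mulr2n -[m * _ *+ 2]mulr_natl.
have -> : nr ('i *+ 2 : R[i]) = 2%:R.
  by rewrite /nr normrMn normCi.
by rewrite ler_pM2l// ltr0n.
Qed.

End OperatorBound.

Ltac alg V :=
  lazymatch type of V with
  | @InnerModule.type ?K ?B =>
    apply: subr0_imp;
    nc_zero K (@adjop K B V) (idop V) (@idopl _ B V) (@idopr _ B V)
  end.

Ltac alg_by V h :=
  apply: (lin_comb h);
  lazymatch type of V with
  | @InnerModule.type ?K ?B =>
    nc_zero K (@adjop K B V) (idop V) (@idopl _ B V) (@idopr _ B V)
  end.

(** * Limits of operators *)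

Section RealSequences.
Variable R : realType.

(** Approach to the supremum gives the Cauchy property; applied to negated geometric sequences it
    also shows that these tend to 0. *)
Lemma bounded_increasing_cauchy (d : nat -> R) M :
  (forall n, d n <= d n.+1) -> (forall n, d n <= M) ->
  forall e, 0 < e -> exists N, forall n k, (N <= n)%N -> (n <= k)%N -> d k - d n <= e.
Proof.
move=> d_incr dM e e0.
have mono n k : (n <= k)%N -> d n <= d k.
  by move=> /subnK <-; elim: (k - n)%N => //= j IH; exact: le_trans IH (d_incr _).
have hs : has_sup (range d).
  by split; [exists (d 0%N), 0%N|exists M => _ [n _ <-]].
have [_ [N _ <-] dN] := sup_adherent e0 hs.
exists N => n k Nn nk.
have dk : d k <= sup (range d) by apply: ub_le_sup; [exact: hs.2|exists k].
by have := mono _ _ Nn; lra.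
Qed.

End RealSequences.

Section Limits.
Variables (R : realType) (B : cstarAlgType R[i]) (V : innerModType B).
Implicit Types (x y z : V) (S T : adjop V) (c : R[i]) (m : R).

(* Completeness, tested on sequences with a convergent majorant. *)
Definition complete_module := forall (s : nat -> V) (d : nat -> R) M,
  (forall n, d n <= d n.+1) -> (forall n, d n <= M) ->
  (forall n, vn (s n.+1 - s n) <= d n.+1 - d n) ->
  exists l, forall e, 0 < e -> exists N, forall n, (N <= n)%N -> vn (l - s n) <= e.

Definition oplim (s : nat -> adjop V) T :=
  forall e, 0 < e -> exists N, forall n, (N <= n)%N -> opbd (T - s n) e.

Hypothesis CS : cauchy_schwarz V.

Lemma vn_telescope (s : nat -> V) (d : nat -> R) :
  (forall n, vn (s n.+1 - s n) <= d n.+1 - d n) ->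
  forall n k, (n <= k)%N -> vn (s k - s n) <= d k - d n.
Proof.
move=> sd n k /subnK <-; elim: (k - n)%N => [|j IH]; first by rewrite !subrr vn0.
rewrite addSn -(subrK (s (j + n)%N) (s (j + n).+1)) -addrA.
by rewrite (le_trans (vnD CS _ _))//; have := sd (j + n)%N; lra.
Qed.

Hypothesis cV : complete_module.

(** The limit must be adjointable, so the adjoints get a pointwise limit of their own;
    Cauchy-Schwarz carries the adjoint relation over to the two limits. *)
Lemma oplim_exists (s : nat -> adjop V) (d : nat -> R) M :
  (forall n, d n <= d n.+1) -> (forall n, d n <= M) ->
  (forall n, opbd (s n.+1 - s n) (d n.+1 - d n)) -> exists T, oplim s T.
Proof.
move=> d_incr dM sd.
have lim (t : nat -> adjop V) : (forall n, opbd (t n.+1 - t n) (d n.+1 - d n)) ->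
    forall z, exists l, forall e, 0 < e ->
      exists N, forall n, (N <= n)%N -> vn (l - t n z) <= e.
  move=> td z; apply: (cV (d := fun n => d n * vn z) (M := `|M| * vn z)) => n.
  - by rewrite ler_wpM2r ?vn_ge0.
  - by rewrite ler_wpM2r ?vn_ge0// (le_trans (dM n))// ler_norm.
  - by rewrite -mulrBl; exact: (td n).2.
have sd' n : opbd (star (s n.+1) - star (s n)) (d n.+1 - d n).
  have -> : star (s n.+1) - star (s n) = star (s n.+1 - s n) by exact: adjopE.
  exact: opbd_star.
have [f fP] := choice (lim _ sd).
have [g gP] := choice (lim _ sd').
have fg x y : ip (f x) y = ip x (g y) :> B.
  apply/eqP; rewrite -subr_eq0; apply/eqP; apply: nr_eq0; apply/le_anti.
  rewrite nr_ge0 andbT; apply/ler_addgt0Pr => e e0; rewrite add0r.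
  have p0 : 0 < vn x + vn y + 1 by rewrite ltr_wpDl ?addr_ge0 ?vn_ge0.
  have e'0 : 0 < e / (vn x + vn y + 1) by rewrite divr_gt0.
  have [N1 hf] := fP x _ e'0; have [N2 hg] := gP y _ e'0.
  set k := maxn N1 N2.
  have -> : ip (f x) y - ip x (g y)
      = ip (f x - s k x) y - ip x (g y - star (s k) y) :> B.
    by rewrite ipDl ipNl ipDr ipNr -(adjopP (s k)) opprB addrA subrK.
  rewrite (le_trans (nrD _ _))// nrN.
  have := CS (f x - s k x) y; have := CS x (g y - star (s k) y).
  have := hf k (leq_maxl _ _); have := hg k (leq_maxr _ _).
  have := vn_ge0 x; have := vn_ge0 y; move: e'0 => /ltW.
  have : e = e / (vn x + vn y + 1) * (vn x + vn y + 1).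
    by rewrite divfK ?gt_eqF.
  move: (e / _) => e' ->.
  by move: (vn (f x - _)) (vn (g y - _)) (nr _) (nr _) => *; nra.
exists (AdjOp fg) => e e0.
have [N hN] := bounded_increasing_cauchy d_incr dM e0.
exists N => n Nn; split=> [|z]; first exact: ltW.
rewrite adjop_addE adjop_oppE /=; apply/ler_addgt0Pr => e' e'0.
have [N' hN'] := fP z _ e'0.
set k := maxn n N'.
rewrite -(subrK (s k z) (f z)) -addrA addrC.
rewrite (le_trans (vnD CS _ _))// lerD ?hN' ?leq_maxr//.
apply: (le_trans (vn_telescope (s := fun n => s n z) (d := fun n => d n * vn z) _ (leq_maxl n N'))).
  by move=> j; rewrite -mulrBl; exact: (sd j).2.
by rewrite -mulrBl ler_wpM2r ?vn_ge0// hN// leq_maxl.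
Qed.

Lemma oplim2 (s t : nat -> adjop V) S T : oplim s S -> oplim t T ->
  forall e, 0 < e -> exists N, forall n, (N <= n)%N -> opbd (S - s n) e /\ opbd (T - t n) e.
Proof.
move=> sS tT e e0; have [N1 h1] := sS _ e0; have [N2 h2] := tT _ e0.
exists (maxn N1 N2) => n; rewrite geq_max => /andP[n1 n2].
by split; [exact: h1|exact: h2].
Qed.

Lemma opbd_eq0_scaled T m : 0 <= m -> (forall e, 0 < e -> opbd T (m * e)) -> T = 0.
Proof.
move=> m0 h; apply: (opbd_eq0 CS) => e e0.
have p0 : 0 < m + 1 by rewrite ltr_wpDl.
apply: opbd_le (h _ (divr_gt0 e0 p0)).
by rewrite mulrCA ger_pMr// ler_pdivrMr// mul1r lerDl.
Qed.

Lemma oplim_comm (s t : nat -> adjop V) S T X : bounded X -> oplim s S -> oplim t T ->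
  (forall n, s n ** X = X ** t n) -> S ** X = X ** T.
Proof.
move=> [m Xm] sS tT st; apply: subr0_imp.
apply: (@opbd_eq0_scaled _ (m + m)) => [|e e0].
  by have := opbd_ge0 Xm; lra.
have [N /(_ N (leqnn N))[hS hT]] := oplim2 sS tT e0.
have -> : S ** X - X ** T = (S - s N) ** X - X ** (T - t N).
  by alg_by V (st N).
rewrite mulrDl; apply: opbdB => //; last exact: opbdM.
by rewrite mulrC; exact: opbdM.
Qed.

Lemma oplim_star (s : nat -> adjop V) S : oplim s S ->
  (forall n, star (s n) = s n) -> star S = S.
Proof.
move=> sS ss; apply: subr0_imp.
apply: (@opbd_eq0_scaled _ 2) => // e e0.
have [N /(_ N (leqnn N)) hS] := sS _ e0.
have -> : star S - S = star (S - s N) - (S - s N).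
  have -> : star (S - s N) = star S - star (s N) by exact: adjopE.
  by rewrite ss; alg V.
by rewrite mulr_natl mulr2n; apply: opbdB => //; exact: opbd_star.
Qed.

(** * Square roots *)

Lemma opbd_half T m : opbd T m -> opbd (2^-1 *: T) (2^-1 * m).
Proof.
move=> /(opbdZ 2^-1); have -> // : nr (2^-1 : R[i]) = 2^-1.
by apply: complexI; rewrite -nrE normfV normr_nat fmorphV /= rmorph_nat.
Qed.

(** A fixed point d of d = (Q + d^2) / 2 satisfies (1 - d)^2 = 1 - Q. The iterates are polynomials
    in Q with nonnegative coefficients, which is why a scalar sequence can dominate them. *)
Fixpoint csqrt_iter (Q : adjop V) n : adjop V :=
  if n is n'.+1 then 2^-1 *: (Q + csqrt_iter Q n' ** csqrt_iter Q n') else 0.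

(* [1 - sqrt (1 - Q)], for [Q] of norm at most 1. *)
Definition csqrt (Q : adjop V) : adjop V := xget 0 [set D | oplim (csqrt_iter Q) D].

(** The same iteration at the scalar Q = 1, increasing and at most 1; it dominates the iterates of
    every Q of bound 1, and their increments as well. *)
Fixpoint csqrt_bound n : R :=
  if n is n'.+1 then 2^-1 * (1 + csqrt_bound n' * csqrt_bound n') else 0.

Lemma csqrt_bound01 n : 0 <= csqrt_bound n <= 1.
Proof. by elim: n => [|n IH] /=; [rewrite lexx ler01|nra]. Qed.

Lemma csqrt_bound_incr n : csqrt_bound n <= csqrt_bound n.+1.
Proof. by have := csqrt_bound01 n => /=; nra. Qed.

Lemma opbd_csqrt_iter Q n : opbd Q 1 -> opbd (csqrt_iter Q n) (csqrt_bound n).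
Proof.
move=> Q1; elim: n => [|n IH] /=; first exact: opbd0.
by apply: opbd_half; apply: opbdD => //; exact: opbdM.
Qed.

Lemma csqrtP Q : opbd Q 1 -> oplim (csqrt_iter Q) (csqrt Q).
Proof.
move=> Q1; rewrite /csqrt; case: xgetP => // /(_ _) h.
suff [D DP] : exists D, oplim (csqrt_iter Q) D by case: (h D).
apply: (@oplim_exists _ csqrt_bound 1) => n; first exact: csqrt_bound_incr.
  by case/andP: (csqrt_bound01 n).
elim: n => [|n IH].
  rewrite /= !subr0; apply: opbd_half; rewrite mul0r; apply: opbdD => //.
  by rewrite amulr0; exact: opbd0.
have -> : csqrt_iter Q n.+2 - csqrt_iter Q n.+1 = 2^-1 *:
    (csqrt_iter Q n.+1 ** (csqrt_iter Q n.+1 - csqrt_iter Q n)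
     + (csqrt_iter Q n.+1 - csqrt_iter Q n) ** csqrt_iter Q n).
  have -> S : csqrt_iter S n.+2 = 2^-1 *: (S + csqrt_iter S n.+1 ** csqrt_iter S n.+1) by [].
  have -> S : csqrt_iter S n.+1 = 2^-1 *: (S + csqrt_iter S n ** csqrt_iter S n) by [].
  by alg V.
have -> : csqrt_bound n.+2 - csqrt_bound n.+1 = 2^-1 *
    (csqrt_bound n.+1 * (csqrt_bound n.+1 - csqrt_bound n)
     + (csqrt_bound n.+1 - csqrt_bound n) * csqrt_bound n).
  have -> : csqrt_bound n.+2 = 2^-1 * (1 + csqrt_bound n.+1 * csqrt_bound n.+1) by [].
  have -> : csqrt_bound n.+1 = 2^-1 * (1 + csqrt_bound n * csqrt_bound n) by [].
  by field.
apply: opbd_half; apply: opbdD => //; apply: opbdM => //; exact: opbd_csqrt_iter.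
Qed.

Lemma opbd_csqrt Q : opbd Q 1 -> opbd (csqrt Q) 1.
Proof.
move=> Q1; apply: opbd_lim => e e0.
have [N /(_ N (leqnn N)) hN] := csqrtP Q1 e0.
rewrite -(subrK (csqrt_iter Q N) (csqrt Q)) addrC; apply: opbdD => //.
apply: opbd_le (opbd_csqrt_iter N Q1).
by case/andP: (csqrt_bound01 N).
Qed.

Lemma csqrt_eq Q : opbd Q 1 -> csqrt Q + csqrt Q - csqrt Q ** csqrt Q = Q.
Proof.
move=> Q1; apply: subr0_imp.
apply: (@opbd_eq0_scaled _ 4) => // e e0.
have [N hN] := csqrtP Q1 e0.
have h0 := hN N (leqnn N); have h1 := hN N.+1 (leqnSn N).
set D := csqrt Q; set T := csqrt_iter Q N.
(* The linear terms are compared with the iterate N + 1, the square with the iterate N; each of the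
   four pieces has bound e. *)
have -> : D + D - D ** D - Q = (D - csqrt_iter Q N.+1) + (D - csqrt_iter Q N.+1)
    - (D ** (D - T) + (D - T) ** T).
  have -> : csqrt_iter Q N.+1 = 2^-1 *: (Q + T ** T) by [].
  by alg V.
have -> : 4%:R * e = e + e + (1 * e + e * 1) by ring.
apply: opbdB; [exact: CS|exact: opbdD|apply: opbdD => //; apply: opbdM => //].
  exact: opbd_csqrt.
apply: opbd_le (opbd_csqrt_iter N Q1).
by case/andP: (csqrt_bound01 N).
Qed.

Lemma csqrt_comm P Q X : opbd P 1 -> opbd Q 1 -> bounded X -> P ** X = X ** Q ->
  csqrt P ** X = X ** csqrt Q.
Proof.
move=> P1 Q1 Xb PX; apply: (oplim_comm Xb (csqrtP P1) (csqrtP Q1)).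
elim=> [|n IH] /=; first by alg V.
rewrite amulZl amulZr amulDl amulDr PX; congr (_ *: (_ + _)).
by rewrite -amulA IH amulA IH amulA.
Qed.

Lemma csqrt_star Q : opbd Q 1 -> star Q = Q -> star (csqrt Q) = csqrt Q.
Proof.
move=> Q1 Qs; apply: (oplim_star (csqrtP Q1)).
elim=> [|n IH] /=; first exact: adjopE.
by rewrite starZ starD starM IH Qs; congr (_ *: _); rewrite fmorphV rmorph_nat.
Qed.

(** M is the sum of the powers E^n for n >= 1, so 1 + M inverts 1 - E. Its partial sums are
    dominated by those of r^n, which stay below r / (1 - r). *)
Lemma neumann (E : adjop V) (r : R) : 0 <= r < 1 -> opbd E r ->
  exists M, [/\ bounded M, M = E + E ** M & M = E + M ** E].
Proof.
move=> /andP[r0 r1] Er.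
pose s := fix s n : adjop V := if n is n'.+1 then E + E ** s n' else 0.
pose d := fix d n : R := if n is n'.+1 then r + r * d n' else 0.
have r1' : 1 - r != 0 by rewrite subr_eq0 gt_eqF.
have dM n : 0 <= d n <= r / (1 - r).
  elim: n => [|n /= IH]; first by rewrite lexx divr_ge0// subr_ge0 ltW.
  have e : r / (1 - r) = r + r * (r / (1 - r)) by field.
  by move: (r / (1 - r)) e IH => c e /andP[d0 dc]; nra.
have d_incr n : 0 <= d n.+1 - d n.
  elim: n => [|n IH] /=; first by rewrite mulr0 addr0 subr0.
  have -> : r + r * (r + r * d n) - (r + r * d n) = r * (r + r * d n - d n) by ring.
  exact: mulr_ge0.
have sd n : opbd (s n.+1 - s n) (d n.+1 - d n).
  elim: n => [|n IH] /=.
    have -> : E + E ** 0 - 0 = E by alg V.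
    by have -> : r + r * 0 - 0 = r by ring.
  have -> : E + E ** (E + E ** s n) - (E + E ** s n) = E ** (E + E ** s n - s n) by alg V.
  have -> : r + r * (r + r * d n) - (r + r * d n) = r * (r + r * d n - d n) by ring.
  exact: opbdM.
have [M MP] : exists M, oplim s M.
  apply: (@oplim_exists s d (r / (1 - r))) => // n; first by rewrite -subr_ge0.
  by case/andP: (dM n).
have sb n : opbd (s n) (d n).
  by elim: n => [|n IH] /=; [exact: opbd0|apply: opbdD => //; exact: opbdM].
have EM : M ** E = E ** M.
  apply: (oplim_comm _ MP MP) => [|n]; first by exists r.
  elim: n => [|n IH] /=; first by alg V.
  by rewrite amulDl amulDr -amulA IH.
have Eq : M = E + E ** M.
  apply: subr0_imp; apply: (@opbd_eq0_scaled _ (1 + r)) => [|e e0].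
    by rewrite addr_ge0.
  have [N hN] := MP _ e0.
  have h0 := hN N (leqnn N); have h1 := hN N.+1 (leqnSn N).
  have -> : M - (E + E ** M) = (M - s N.+1) - E ** (M - s N).
    have -> : s N.+1 = E + E ** s N by [].
    by alg V.
  by rewrite mulrDl mul1r; apply: opbdB => //; exact: opbdM.
exists M; split=> //; last by rewrite EM.
have [N hN] := MP _ ltr01; exists (1 + d N).
by rewrite -(subrK (s N) M); apply: opbdD => //; exact: hN.
Qed.

End Limits.

(** * Positive operators *)

Section Positivity.
Variables (R : realType) (B : cstarAlgType R[i]) (V : innerModType B).
Hypotheses (CS : cauchy_schwarz V) (cV : complete_module V).
Implicit Types (S T X Y P Q H : adjop V) (r t m : R).

Local Notation id := (idop V).

(** The norm criterion for a nonnegative spectrum. In this form, closure under sums is the triangle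
    inequality. *)
Definition pos T := star T = T /\ exists t, opbd (t%:C *: id - T) t.

Lemma starN_op T : star (- T) = - star T. Proof. exact: adjopE. Qed.

Lemma starZr_op r T : star (r%:C *: T) = r%:C *: star T.
Proof. by rewrite starZ; congr (_ *: _); apply/eqP; rewrite eq_complex /= oppr0 !eqxx. Qed.

Lemma bounded_opbd T m : opbd T m -> bounded T. Proof. by exists m. Qed.

Lemma boundedD S T : bounded S -> bounded T -> bounded (S + T).
Proof. by move=> [m Sm] [n Tn]; exists (m + n); exact: opbdD. Qed.

Lemma boundedN T : bounded T -> bounded (- T).
Proof. by move=> [m Tm]; exists m; exact: opbdN. Qed.

Lemma boundedM S T : bounded S -> bounded T -> bounded (S ** T).
Proof. by move=> [m Sm] [n Tn]; exists (m * n); exact: opbdM. Qed.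

Lemma boundedZ (c : R[i]) T : bounded T -> bounded (c *: T).
Proof. by move=> [m Tm]; exists (nr c * m); exact: opbdZ. Qed.

Lemma bounded_star T : bounded T -> bounded (star T).
Proof. by move=> [m Tm]; exists m; exact: opbd_star. Qed.

Lemma bounded_id : bounded id. Proof. by exists 1; exact: opbd1. Qed.

Hint Resolve boundedD boundedN boundedM boundedZ bounded_star bounded_id : core.

Lemma opbd_scalar r : 0 <= r -> opbd (r%:C *: id) r.
Proof.
move=> r0; have := opbdZr r (opbd1 V).
by rewrite mulr1 ger0_norm.
Qed.

Lemma pos_le T t r : opbd (t%:C *: id - T) t -> t <= r -> opbd (r%:C *: id - T) r.
Proof.
move=> Tt tr.
have -> : r%:C *: id - T = (r - t)%:C *: id + (t%:C *: id - T) by alg V.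
have -> : r = (r - t) + t by rewrite subrK.
by rewrite addrK; apply: opbdD => //; apply: opbd_scalar; rewrite subr_ge0.
Qed.

Lemma posD S T : pos S -> pos T -> pos (S + T).
Proof.
move=> [Ss [s Sp]] [Ts [t Tp]]; split; first by rewrite starD Ss Ts.
exists (s + t).
have -> : (s + t)%:C *: id - (S + T) = (s%:C *: id - S) + (t%:C *: id - T) by alg V.
exact: opbdD.
Qed.

Lemma posZ r T : 0 <= r -> pos T -> pos (r%:C *: T).
Proof.
move=> r0 [Ts [t Tp]]; split; first by rewrite starZr_op Ts.
exists (r * t).
have -> : (r * t)%:C *: id - r%:C *: T = r%:C *: (t%:C *: id - T) by alg V.
by rewrite -{2}(ger0_norm r0); exact: opbdZr.
Qed.

Lemma csqrt_complement Q : opbd Q 1 -> (id - csqrt Q) ** (id - csqrt Q) = id - Q.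
Proof. by move=> Q1; alg_by V (esym (csqrt_eq CS cV Q1)). Qed.

Lemma csqrt_complement_star Q : opbd Q 1 -> star Q = Q ->
  star (id - csqrt Q) = id - csqrt Q.
Proof.
by move=> Q1 Qs; rewrite starD starN_op star_idop (csqrt_star CS cV Q1 Qs).
Qed.

Lemma csqrt_complement_comm P Q X : opbd P 1 -> opbd Q 1 -> bounded X ->
  P ** X = X ** Q -> (id - csqrt P) ** X = X ** (id - csqrt Q).
Proof.
move=> P1 Q1 Xb PX; have h := csqrt_comm CS cV P1 Q1 Xb PX.
by alg_by V (esym h).
Qed.

Lemma square_comm S X : S ** X = X ** S -> (S ** S) ** X = X ** (S ** S).
Proof. by move=> SX; rewrite -amulA SX amulA SX amulA. Qed.

(** For c = sqrt (1 - S^2), c commutes with S and c^2 + S^2 = 1, so [opbd_commuting] bounds c. *)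
Lemma opbd_csqrt_complement S : star S = S -> opbd S 1 ->
  opbd (id - csqrt (S ** S)) 1.
Proof.
move=> Ss S1.
have q1 : opbd (S ** S) 1 by rewrite -[X in opbd _ X]mulr1; exact: opbdM.
have qs : star (S ** S) = S ** S by rewrite starM Ss.
apply: (opbd_commuting CS (Y := S) (W := id)) => //.
- rewrite Ss csqrt_complement_star//; apply/esym/csqrt_complement_comm => //.
    by exists 1.
  by rewrite amulA.
- by rewrite Ss csqrt_complement_star// csqrt_complement//; alg V.
- by rewrite expr1n; exact: opbd1.
Qed.

Lemma opbd_one_sub_square S : star S = S -> opbd S 1 -> opbd (id - S ** S) 1.
Proof.
move=> Ss S1.
have q1 : opbd (S ** S) 1 by rewrite -[X in opbd _ X]mulr1; exact: opbdM.
rewrite -csqrt_complement// -[X in opbd _ X]mulr1.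
by apply: opbdM; exact: opbd_csqrt_complement.
Qed.

Lemma bounded_scale T : bounded T ->
  exists r, [/\ 0 < r, opbd (r^-1%:C *: T) 1 & r%:C *: (r^-1%:C *: T) = T].
Proof.
move=> [m Tm]; have m0 := opbd_ge0 Tm.
have r0 : 0 < m + 1 by rewrite ltr_wpDl.
exists (m + 1); split=> //.
  apply: opbd_le (opbdZr _ Tm).
  by rewrite gtr0_norm ?invr_gt0// mulrC ler_pdivrMr// mul1r lerDl.
by rewrite scalerA -rmorphM /= mulfV ?gt_eqF// rmorph1 scale1r.
Qed.

(** After scaling S to bound 1, 1 - S^2 is the square of an operator of bound 1, so t = 1 serves. *)
Lemma pos_square S : star S = S -> bounded S -> pos (S ** S).
Proof.
move=> Ss /bounded_scale[r [r0 S1 <-]].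
set k := r^-1%:C *: S in S1 *.
have ks : star k = k by rewrite starZr_op Ss.
rewrite amulZl amulZr; apply: posZ; first exact: ltW.
apply: posZ; first exact: ltW.
split; first by rewrite starM ks.
by exists 1; rewrite rmorph1 scale1r; exact: opbd_one_sub_square.
Qed.

(** For r = t + 1, positive even if t = 0, q = 1 - T / r has bound 1 and (1 - csqrt q)^2 = T / r.
    The commutation clause provides the hypothesis of [opbd_commuting] in later uses. *)
Lemma pos_sqrt T : pos T -> exists S, [/\ star S = S, bounded S, S ** S = T
  & forall X, bounded X -> T ** X = X ** T -> S ** X = X ** S].
Proof.
move=> [Ts [t Tp]].
have t0 := opbd_ge0 Tp; have r0 : 0 < t + 1 by rewrite ltr_wpDl.
have {}Tp := pos_le Tp (ltW (ltr_pwDr ltr01 (lexx t))).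
set r := t + 1 in Tp r0.
have rr : r * r^-1 = 1 by rewrite mulfV ?gt_eqF.
set q := r^-1%:C *: (r%:C *: id - T).
have q1 : opbd q 1.
  have := opbdZr r^-1 Tp.
  by rewrite ger0_norm ?invr_ge0 ?ltW// mulrC rr.
have qE : q = id - r^-1%:C *: T.
  by rewrite /q scalerBr scalerA -rmorphM /= mulrC rr rmorph1 scale1r.
have qs : star q = q by rewrite qE starD starN_op starZr_op Ts star_idop.
have Db := opbd_csqrt CS cV q1.
pose s := Num.sqrt r; have ss : s * s = r by rewrite -expr2 sqr_sqrtr ?ltW.
exists (s%:C *: (id - csqrt q)); split.
- by rewrite starZr_op csqrt_complement_star.
- by apply: boundedZ; apply: boundedD => //; apply: boundedN; exists 1.
- rewrite amulZl amulZr csqrt_complement// scalerA -rmorphM /= ss qE opprB.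
  by rewrite addrC subrK scalerA -rmorphM /= rr rmorph1 scale1r.
- move=> X Xb TX; rewrite amulZl amulZr; congr (_ *: _).
  apply: csqrt_complement_comm => //; rewrite qE.
  have e : r^-1%:C *: (T ** X) = r^-1%:C *: (X ** T) by rewrite TX.
  by alg_by V (esym e).
Qed.

(** m^2 - S^2 is the sum of the positive operators m^2 - (S^2 + Q^2) and Q^2. Its root W commutes
    with S and W^2 + S^2 = m^2. *)
Lemma opbd_square_sum S Q m : star S = S -> star Q = Q -> bounded S -> bounded Q ->
  0 <= m -> opbd (S ** S + Q ** Q) (m ^+ 2) -> opbd S m.
Proof.
move=> Ss Qs Sb Qb m0 SQ.
pose T : adjop V := (m ^+ 2)%:C *: id - S ** S.
have Tp : pos T.
  have -> : T = ((m ^+ 2)%:C *: id - (S ** S + Q ** Q)) + Q ** Q by rewrite /T; alg V.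
  apply: posD; last exact: pos_square.
  split; first by rewrite starD starN_op starZr_op starD !starM Ss Qs star_idop.
  by exists (m ^+ 2); rewrite opprB addrC subrK.
have [W [Ws Wb WW Wc]] := pos_sqrt Tp.
apply: (opbd_commuting CS (Y := W) (W := (m ^+ 2)%:C *: id)) => //.
- by rewrite Ws Ss; apply: Wc => //; rewrite /T; alg V.
- by rewrite Ws Ss WW /T subrK.
- by apply: opbd_scalar; exact: sqr_ge0.
Qed.

(** L is the square root of |H|: 1 - csqrt (1 - H^2) is |H|, and a second extraction gives its
    root. *)
Lemma modulus_exists H : star H = H -> opbd H 1 -> exists L,
  [/\ star L = L, bounded L, L ** H = H ** L & (L ** L) ** (L ** L) = H ** H].
Proof.
move=> Hs H1; set q := id - H ** H.
have q1 : opbd q 1 by exact: opbd_one_sub_square.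
have qs : star q = q by rewrite starD starN_op starM Hs star_idop.
have Db := opbd_csqrt CS cV q1; have Ds := csqrt_star CS cV q1 qs.
have Hb : bounded H by exists 1.
have DH : csqrt q ** H = H ** csqrt q.
  by apply: csqrt_comm => //; rewrite /q; alg V.
exists (id - csqrt (csqrt q)); split.
- exact: csqrt_complement_star.
- apply: boundedD => //; apply: boundedN; exists 1; exact: opbd_csqrt.
- exact: csqrt_complement_comm.
- by rewrite !csqrt_complement// /q opprB addrC subrK.
Qed.

(** Any bound can be improved geometrically; this avoids speaking of the least one. *)
Lemma opbd_shrink_eq0 T : bounded T ->
  (forall m, 0 < m -> opbd T m -> opbd T (7 / 8 * m)) -> T = 0.
Proof.
move=> /bounded_scale[m [m0 Tm1 Tm]] h.
have Tb : opbd T m.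
  by have := opbdZr m Tm1; rewrite Tm mulr1 gtr0_norm.
pose d n : R := (7 / 8) ^+ n * m.
have d0 n : 0 < d n by rewrite mulr_gt0// exprn_gt0//; lra.
have dS n : d n.+1 = 7 / 8 * d n by rewrite /d exprS mulrA.
have Td n : opbd T (d n).
  by elim: n => [|n IH]; [rewrite /d expr0 mul1r|rewrite dS; exact: h].
apply: (opbd_eq0 CS) => e e0.
have e80 : 0 < e / 8 by lra.
have [] := @bounded_increasing_cauchy _ (fun n => - d n) 0 _ _ _ e80.
- by move=> n; rewrite dS; have := d0 n; lra.
- by move=> n; have := d0 n; lra.
- move=> N /(_ N N.+1 (leqnn N) (leqnSn N)); rewrite dS => dN.
  by apply: opbd_le (Td N); lra.
Qed.

(** Put k = P^2 and f = sqrt (1 - [X ** star X]), of bound 1. Then [star (f ** X) ** (f ** X)]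
    equals -(k + k^2), so k + k^2 has bound 1 and C = sqrt (1 - k - k^2) exists. This forces k^2 <=
    1/2, hence a bound of k, and so of X, below 1. *)
Lemma negative_shrink X P : opbd X 1 -> star P = P -> bounded P ->
  star X ** X = - (P ** P) -> pos (X ** star X) -> opbd X (7 / 8).
Proof.
move=> X1 Ps Pb XX Qp; have Xb : bounded X by exists 1.
have [E [Es Eb EE Ec]] := pos_sqrt Qp.
have Xs1 := opbd_star CS X1.
have Q1 : opbd (X ** star X) 1 by rewrite -[Y in opbd _ Y]mulr1; exact: opbdM.
have P1 : opbd (- (P ** P)) 1 by rewrite -XX -[Y in opbd _ Y]mulr1; exact: opbdM.
have E1 : opbd E 1 by apply: (opbd_cstar CS) => //; rewrite Es EE expr1n.
have f1 := opbd_csqrt_complement Es E1; rewrite EE in f1.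
have fs : star (id - csqrt (X ** star X)) = id - csqrt (X ** star X).
  by apply: csqrt_complement_star => //; rewrite starM starK.
have ff := csqrt_complement Q1.
set f := id - csqrt _ in f1 fs ff.
pose k := P ** P.
have ks : star k = k by rewrite starM Ps.
have kb : bounded k by exact: boundedM.
have j1 : opbd (k + k ** k) 1.
  have -> : k + k ** k = - (star (f ** X) ** (f ** X)).
    rewrite starM fs amulA -(amulA (star X)) ff.
    have -> : star X ** (id - X ** star X) ** X =
      star X ** X - (star X ** X) ** (star X ** X) by alg V.
    by rewrite XX -/k; alg V.
  apply: opbdN; rewrite -[Y in opbd _ Y]mulr1; apply: opbdM.
    by apply: opbd_star => //; rewrite -[Y in opbd _ Y]mulr1; exact: opbdM.
  by rewrite -[Y in opbd _ Y]mulr1; exact: opbdM.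
have js : star (k + k ** k) = k + k ** k by rewrite starD starM ks.
pose C := id - csqrt (k + k ** k).
have Cs : star C = C by exact: csqrt_complement_star.
have CC : C ** C = id - (k + k ** k) by exact: csqrt_complement.
have Cb : bounded C.
  by apply: boundedD => //; apply: boundedN; exists 1; exact: opbd_csqrt.
have CP : C ** P = P ** C.
  by apply: csqrt_complement_comm => //; rewrite /k; alg V.
pose T := 2^-1%:C *: id - k ** k.
have Tp : pos T.
  (* Since C^2 = 1 - k - k^2 and everything commutes, C^2 + k C^2 + k^3 = 1 - 2 k^2; the three terms
     are the squares of C, P C and k P. *)
  have -> : T = 2^-1%:C *: (C ** C + (P ** C) ** (P ** C) + (k ** P) ** (k ** P)).
    have -> : (P ** C) ** (P ** C) = k ** (C ** C).
      have e : P ** (C ** P) ** C = P ** (P ** C) ** C by rewrite CP.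
      by rewrite /k; alg_by V e.
    rewrite CC /T.
    have e : (2^-1)%:C = 2^-1 :> R[i] by rewrite fmorphV /= rmorph_nat.
    by rewrite e /k; alg V.
  apply: posZ; first by rewrite invr_ge0.
  by apply: posD; [apply: posD|]; apply: pos_square; rewrite ?starM ?Ps ?Cs ?ks ?CP//;
    rewrite ?/k; try exact: boundedM; alg V.
have [W [Ws Wb WW Wc]] := pos_sqrt Tp.
(* The constants are rational substitutes for roots: 1/2 <= (3/4)^2 here and 3/4 <= (7/8)^2 at the
   end. *)
have k34 : opbd k (3 / 4).
  apply: (opbd_commuting CS (Y := W) (W := 2^-1%:C *: id)) => //.
  - by rewrite Ws ks; apply: Wc => //; rewrite /T; alg V.
  - by rewrite Ws ks WW /T subrK.
  - by lra.
  - apply: (@opbd_le _ _ _ _ 2^-1); first by lra.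
    by apply: opbd_scalar; rewrite invr_ge0.
apply: (opbd_cstar CS); first by lra.
by rewrite XX; apply: opbdN; apply: opbd_le k34; lra.
Qed.

(** [star X ** X + X ** star X] is half the sum of the squares of the self-adjoint [a] and [b], so a
    negative first term makes the second positive. The usual argument then compares the spectra of
    the two products; here every bound of X improves by the factor 7/8. *)
Lemma star_mul_negative X P : bounded X -> star P = P -> bounded P ->
  star X ** X = - (P ** P) -> X = 0.
Proof.
move=> Xb Ps Pb XX.
have Qp : pos (X ** star X).
  pose a := X + star X; pose b : adjop V := 'i *: (X - star X).
  have as_ : star a = a by rewrite starD starK addrC.
  have bs : star b = b.
    by rewrite starZ starD starN_op starK conjCi scaleNr -scalerN opprB.
  have -> : X ** star X = 2^-1%:C *: (a ** a + b ** b) + P ** P.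
    have e : (2^-1)%:C = 2^-1 :> R[i] by rewrite fmorphV /= rmorph_nat.
    have -> : b ** b = - ((X - star X) ** (X - star X)).
      by rewrite /b amulZl amulZr scalerA -expr2 sqrCi scaleN1r.
    by rewrite e /a; alg_by V (esym XX).
  apply: posD; last exact: pos_square.
  apply: posZ; first by rewrite invr_ge0.
  by apply: posD; apply: pos_square => //; [apply: boundedD => //|
    apply: boundedZ; apply: boundedD => //; apply: boundedN]; exact: bounded_star.
apply: opbd_shrink_eq0 => // m m0 Xm.
have im0 : 0 <= m^-1 by rewrite invr_ge0 ltW.
pose x := m^-1%:C *: X.
have mm : m * m^-1 = 1 by rewrite mulfV ?gt_eqF.
have x1 : opbd x 1.
  by have := opbdZr m^-1 Xm; rewrite (ger0_norm im0) mulrC mm.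
have : opbd x (7 / 8).
  apply: (@negative_shrink x (m^-1%:C *: P)) => //.
  - by rewrite starZr_op Ps.
  - exact: boundedZ.
  - by rewrite starZr_op !amulZl !amulZr XX !scalerN.
  - rewrite starZr_op amulZl amulZr; apply: posZ => //; exact: posZ.
move=> /(opbdZr m); rewrite gtr0_norm// mulrC.
by rewrite scalerA -rmorphM /= mm rmorph1 scale1r.
Qed.

(* Kelley and Vaught: every [star Y ** Y] is the square of a self-adjoint operator. *)
Lemma star_mul_square Y : bounded Y ->
  exists L, [/\ star L = L, bounded L & star Y ** Y = L ** L].
Proof.
move=> /bounded_scale[r [r0 Y1 <-]].
set y := r^-1%:C *: Y in Y1 *.
have yb : bounded y by exists 1.
pose h := star y ** y.
have hs : star h = h by rewrite starM starK.
have h1 : opbd h 1.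
  rewrite -[X in opbd _ X]mulr1; apply: opbdM => //; exact: opbd_star.
have [L [Ls Lb Lh LL]] := modulus_exists hs h1.
have hb : bounded h by exists 1.
(* L^2 is |h|, so g is twice the negative part of h; the aim is g = 0. *)
pose g := L ** L - h.
have Lg : L ** g = g ** L by rewrite /g; alg_by V (esym Lh).
have gs : star g = g by rewrite starD starN_op starM Ls hs.
have gb : bounded g by apply: boundedD; [exact: boundedM|exact: boundedN].
have LLh : (L ** L) ** h = h ** (L ** L) by exact: square_comm.
have yg : y ** g = 0.
  apply: (@star_mul_negative _ (L ** g)) => //.
  - exact: boundedM.
  - by rewrite starM Ls gs.
  - exact: boundedM.
  (* From |h|^2 = h^2, (|h| - h) h = - |h| (|h| - h). Hence g h g is minus the square of L g, and it
     is also [star (y ** g) ** (y ** g)]. *)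
  have gh : g ** h = - ((L ** L) ** g) by rewrite /g; alg_by V LL.
  rewrite starM gs amulA -(amulA g) -/h gh -scaleN1r amulZl scaleN1r; congr (- _).
  have e : L ** (L ** g) ** g = L ** (g ** L) ** g by rewrite Lg.
  by alg_by V e.
have hg : h ** g = 0 by rewrite /h -amulA yg amulr0.
have g0 : g = 0.
  have gg : star g ** g = 0.
    rewrite gs; have -> : g ** g = L ** L ** g - h ** g by rewrite {1}/g; alg V.
    rewrite hg subr0.
    have -> : L ** L ** g = (L ** L) ** (L ** L) - (L ** L) ** h by rewrite /g; alg V.
    have hL : h ** (L ** L) = h ** h by apply: (lin_comb hg); rewrite subr0 /g; alg V.
    by rewrite LL LLh hL subrr.
  apply: (opbd_eq0 CS) => e e0; apply: (opbd_cstar CS); first exact: ltW.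
  by rewrite gg; apply: opbd_le (opbd0 V); exact: sqr_ge0.
exists (r%:C *: L); split; first by rewrite starZr_op Ls.
  exact: boundedZ.
rewrite starZr_op (amulZl _ (star y)) (amulZr _ (star y) y) (amulZl _ L) (amulZr _ L L).
by rewrite (subr0_imp (g0 : L ** L - h = 0)).
Qed.

Lemma star_mul_sum S T : bounded S -> bounded T ->
  exists2 U, bounded U & star S ** S + star T ** T = star U ** U.
Proof.
move=> /star_mul_square[K [Ks Kb ->]] /star_mul_square[L [Ls Lb ->]].
have [U [Us Ub <- _]] := pos_sqrt (posD (pos_square Ks Kb) (pos_square Ls Lb)).
by exists U; rewrite ?Us.
Qed.

Lemma opbd_star_mul_sum S T m : bounded S -> bounded T -> 0 <= m ->
  opbd (star S ** S + star T ** T) (m ^+ 2) -> opbd S m.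
Proof.
move=> Sb Tb m0.
have [K [Ks Kb SK]] := star_mul_square Sb; have [L [Ls Lb ->]] := star_mul_square Tb.
rewrite SK => /(opbd_square_sum Ks Ls Kb Lb m0) Km.
by apply: (opbd_cstar CS m0); rewrite SK; exact: opbdM.
Qed.

End Positivity.

(** * A C*-algebra as a module over itself *)

Section SelfModule.
Variables (K : numClosedFieldType) (B : cstarAlgType K).

(** The alias carries the inner module structure. Left multiplication embeds B isometrically into
    its adjointable operators, among which there is always a unit. *)
Definition selfmod : Type := B.

HB.instance Definition _ := GRing.Lmodule.copy selfmod B.

Let sract (x : selfmod) (b : B) : selfmod := (x : B) ** b.
Let sip (x y : selfmod) : B := star (x : B) ** y.

Fact selfmod_ractDl x y b : sract (x + y) b = sract x b + sract y b.
Proof. exact: amulDl. Qed.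
Fact selfmod_ractDr x b c : sract x (b + c) = sract x b + sract x c.
Proof. exact: amulDr. Qed.
Fact selfmod_ractZl (a : K) x b : sract (a *: x) b = a *: sract x b.
Proof. exact: amulZl. Qed.
Fact selfmod_ractZr (a : K) x b : sract x (a *: b) = a *: sract x b.
Proof. exact: amulZr. Qed.
Fact selfmod_ractA x b c : sract (sract x b) c = sract x (b ** c).
Proof. exact/esym/amulA. Qed.
Fact selfmod_ipDr x y z : sip x (y + z) = sip x y + sip x z.
Proof. exact: amulDr. Qed.
Fact selfmod_ipZr (a : K) x y : sip x (a *: y) = a *: sip x y.
Proof. exact: amulZr. Qed.
Fact selfmod_ip_ract x y b : sip x (sract y b) = sip x y ** b.
Proof. exact: amulA. Qed.
Fact selfmod_ip_star x y : star (sip x y) = sip y x.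
Proof. by rewrite /sip starM starK. Qed.
Fact selfmod_ip_nondeg x : (forall y, sip y x = 0) -> x = 0.
Proof.
move=> /(_ x) xx; apply/eqP.
by rewrite -[x == 0](@normr_eq0 _ B) -sqrf_eq0 -cstar_norm [_ ** _]xx normr0.
Qed.

HB.instance Definition _ := Lmodule_isInnerModule.Build K B selfmod
  selfmod_ractDl selfmod_ractDr selfmod_ractZl selfmod_ractZr selfmod_ractA
  selfmod_ipDr selfmod_ipZr selfmod_ip_ract selfmod_ip_star selfmod_ip_nondeg.

Fact mulop_subproof (b : B) (x y : selfmod) :
  ip (b ** x : selfmod) y = ip x (star b ** y : selfmod).
Proof. by rewrite /ip /= /sip starM amulA. Qed.

Definition mulop (b : B) : adjop selfmod := AdjOp (mulop_subproof b).

Lemma mulopD a b : mulop (a + b) = mulop a + mulop b.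
Proof. by apply: adjopE => x; exact: amulDl. Qed.

Lemma mulopZ (c : K) a : mulop (c *: a) = c *: mulop a.
Proof. by apply: adjopE => x; exact: amulZl. Qed.

Lemma mulopM a b : mulop (a ** b) = mulop a ** mulop b.
Proof. by apply: adjopE => x; exact/esym/amulA. Qed.

Lemma mulop_star a : mulop (star a) = star (mulop a).
Proof. exact: adjopE. Qed.

Lemma mulopB a b : mulop (a - b) = mulop a - mulop b.
Proof. by rewrite -scaleN1r mulopD mulopZ scaleN1r. Qed.

End SelfModule.

Section CompleteModules.
Variable R : realType.

Lemma complete_nr (V : completeNormedModType R[i]) (s : nat -> V) (d : nat -> R) M :
  (forall n, d n <= d n.+1) -> (forall n, d n <= M) ->
  (forall n, nr (s n.+1 - s n) <= d n.+1 - d n) ->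
  exists l, forall e, 0 < e -> exists N, forall n, (N <= n)%N -> nr (l - s n) <= e.
Proof.
move=> d_incr dM sd.
have tel n k : (n <= k)%N -> nr (s k - s n) <= d k - d n.
  move=> /subnK <-; elim: (k - n)%N => [|j IH]; first by rewrite !subrr nr0.
  rewrite addSn -(subrK (s (j + n)%N) (s (j + n).+1)) -addrA.
  by rewrite (le_trans (nrD _ _))//; have := sd (j + n)%N; lra.
have : cvg (s @ \oo)%classic.
  apply: cauchy_cvg; apply: cauchy_exP => e e0.
  have [r r0 re] : exists2 r : R, 0 < r & r%:C <= e / 2.
    exists (complex.Re (e / 2)); last by rewrite -[leLHS]/((complex.Re _)%:C) -[X in _ <= X]RRe_real// ?ger0_real// ltW// divr_gt0.
    have : 0 < e / 2 by rewrite divr_gt0.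
    by rewrite ltcE /= => /andP[].
  have [N hN] := bounded_increasing_cauchy d_incr dM r0.
  exists (s N); exists N => //= n /= Nn.
  rewrite -ball_normE /= -normrN opprB nrE.
  have : (nr (s n - s N))%:C <= r%:C by rewrite lecR (le_trans (tel _ _ Nn))// hN.
  move=> h; rewrite (le_lt_trans (le_trans h re))//.
  by rewrite ltr_pdivrMr// ltr_pMr// ltr1n.
move=> cs; exists (lim (s @ \oo)%classic) => e e0.
have eC : 0 < e%:C :> R[i] by rewrite ltcR.
have /cvgrPdist_le/(_ _ eC)[N _ hN] := cs.
by exists N => n Nn; have := hN n Nn; rewrite /= nrE lecR.
Qed.

Variables (B : cstarAlgType R[i]) (E : hilbModType B).

Lemma vn_selfmod (b : B) : vn (b : selfmod B) = nr b.
Proof. by rewrite /vn -[X in nr X]/(star b ** b) nr_cstar sqrtr_sqr ger0_norm ?nr_ge0. Qed.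

Lemma vn_hilb (x : E) : vn x = nr x.
Proof.
rewrite /vn; have -> : nr (ip x x : B) = nr x ^+ 2.
  by apply: complexI; rewrite -nrE -norm_ip nrE rmorphXn.
by rewrite sqrtr_sqr ger0_norm ?nr_ge0.
Qed.

Lemma selfmod_cauchy_schwarz : cauchy_schwarz (selfmod B).
Proof.
by move=> x y; rewrite !vn_selfmod -(nr_star (x : B)); exact: nrM.
Qed.

Lemma selfmod_complete : complete_module (selfmod B).
Proof.
move=> s d M d_incr dM sd.
have [|l lP] := @complete_nr B s d M d_incr dM.
  by move=> n; have := sd n; rewrite vn_selfmod.
by exists l => e /lP[N hN]; exists N => n /hN; rewrite vn_selfmod.
Qed.

Lemma hilb_complete : complete_module E.
Proof.
move=> s d M d_incr dM sd.
have [|l lP] := @complete_nr E s d M d_incr dM.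
  by move=> n; have := sd n; rewrite vn_hilb.
by exists l => e /lP[N hN]; exists N => n /hN; rewrite vn_hilb.
Qed.

Lemma opbd_mulop (b : B) : opbd (mulop b) (nr b).
Proof. by split=> [|x]; rewrite ?nr_ge0// !vn_selfmod; exact: nrM. Qed.

(** Evaluation at [star b] makes the bound sharp, by the C*-identity. *)
Lemma mulop_opbd (b : B) (m : R) : opbd (mulop b) m -> nr b <= m.
Proof.
move=> [m0 /(_ (star b))]; rewrite !vn_selfmod /= -(nr_star b).
have -> : nr (b ** star b) = nr (star b) ^+ 2 by rewrite -nr_cstar starK.
have := nr_ge0 (star b); rewrite le_eqVlt => /predU1P[<- //|b0].
by rewrite expr2 ler_pM2r.
Qed.

Lemma mulop_inj : injective (@mulop R[i] B).
Proof.
move=> a b ab; apply: subr0_imp; apply: nr_eq0; apply/le_anti; rewrite nr_ge0 andbT.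
by apply: mulop_opbd; rewrite mulopB ab subrr; exact: opbd0.
Qed.

(** * Cauchy-Schwarz from positivity of the form *)

Section PositiveForm.
Variable V : innerModType B.

(** T is asked for only as an operator on [selfmod B]: the roots constructed above are not shown to
    be left multiplications. *)
Definition positive_form := forall z : V,
  exists2 T : adjop (selfmod B), bounded T & mulop (ip z z) = star T ** T.

Hypothesis Vpos : positive_form.

Lemma complement_square_sum (W : innerModType B) (S A Q Y : adjop W) :
  S ** A + (Y - (S ** A + S ** A) + S ** (Q ** A) + S ** (idop W - Q) ** A) = Y.
Proof. by alg W. Qed.

(* With [|<x,x>| <= 1] and [a = <x,y>], the form of [y - x a] exhibits [<y,y>] as
   [a^* a] plus the squares [a^* (1 - <x,x>) a] and [<y - x a, y - x a>]. *)
Lemma cauchy_schwarz_normalized (x y : V) : vn x <= 1 -> nr (ip x y : B) <= vn y.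
Proof.
move=> x1.
have CS := selfmod_cauchy_schwarz; have cB := selfmod_complete.
pose Q : adjop (selfmod B) := mulop (ip x x).
have Q1 : opbd Q 1.
  apply: opbd_le (opbd_mulop _); rewrite -vn_sqr.
  by have := vn_ge0 x; nra.
have Qs : star Q = Q by rewrite -mulop_star ip_star.
pose a : B := ip x y; pose A := mulop a; pose z := y - ract x a.
have [W Wb WW] := Vpos z.
pose f := idop (selfmod B) - csqrt Q.
have fs : star f = f by exact: csqrt_complement_star.
have ff : f ** f = idop _ - Q by exact: csqrt_complement.
have Ab : bounded A by exists (nr a); exact: opbd_mulop.
have fb : bounded f.
  apply: boundedD => //; first exact: bounded_id.
  by apply: boundedN; exists 1; exact: opbd_csqrt.
have [U Ub UU] := star_mul_sum CS cB Wb (boundedM fb Ab).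
apply: mulop_opbd; apply: (opbd_star_mul_sum CS cB Ab Ub); first exact: vn_ge0.
rewrite -UU -WW starM fs amulA -(amulA (star A)) ff.
suff -> : star A ** A + (mulop (ip z z) + star A ** (idop _ - Q) ** A)
    = mulop (ip y y) by rewrite vn_sqr; exact: opbd_mulop.
have -> : ip z z = ip y y - (star a ** a + star a ** a) + star a ** (ip x x ** a) :> B.
  rewrite /z ipDr !ipDl !ipNr !ipNl ip_ractl !ip_ract -/a.
  have -> : ip y x = star a :> B by rewrite ip_star.
  by rewrite opprK opprD ip_ractl amulA -!addrA.
rewrite mulopD mulopB mulopD !mulopM mulop_star -/A -/Q.
exact: complement_square_sum.
Qed.

Lemma positive_form_cauchy_schwarz : cauchy_schwarz V.
Proof.
move=> x y; apply/ler_addgt0Pr => e e0.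
have p0 : 0 < vn y + 1 by rewrite ltr_wpDl ?vn_ge0.
have e'0 : 0 < e / (vn y + 1) by rewrite divr_gt0.
(* [vn x] is enlarged so that it can be inverted; after multiplication by [vn y] the excess costs at
   most e. *)
pose r := vn x + e / (vn y + 1).
have r0 : 0 < r by rewrite ltr_wpDl ?vn_ge0.
have := @cauchy_schwarz_normalized (r^-1%:C *: x) y.
rewrite vnZ ipZl nrZ nrconj !nr_real gtr0_norm ?invr_gt0// mulrC ler_pdivrMr// mul1r.
rewrite mulrC ler_pdivrMr// => h; rewrite (le_trans (h _))//.
  by rewrite lerDl ltW.
rewrite mulrDr [X in X + _]mulrC lerD2l mulrCA ger_pMr// ler_pdivrMr//.
by rewrite mul1r lerDl.
Qed.

End PositiveForm.

Lemma hilb_positive_form : positive_form E.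
Proof.
move=> x; have [b ->] := ip_ge0 x; exists (mulop b).
  by exists (nr b); exact: opbd_mulop.
by rewrite mulopM mulop_star.
Qed.

Lemma hilb_cauchy_schwarz : cauchy_schwarz E.
Proof. exact: positive_form_cauchy_schwarz hilb_positive_form. Qed.

Lemma dsum_cauchy_schwarz : cauchy_schwarz (dsum E).
Proof.
apply: positive_form_cauchy_schwarz => -[b x].
have [T Tb TT] := hilb_positive_form x.
have bb : bounded (mulop b) by exists (nr b); exact: opbd_mulop.
have [U Ub UU] := star_mul_sum selfmod_cauchy_schwarz selfmod_complete bb Tb.
exists U => //; rewrite -UU -TT -mulop_star -mulopM -mulopD.
by [].
Qed.

End CompleteModules.

(** * Geometric approximation of operators *)

Section HalvingSequences.
Variables (R : realType) (B : cstarAlgType R[i]) (V : innerModType B).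
Hypotheses (CS : cauchy_schwarz V) (cV : complete_module V).

Lemma half_powers_small (e : R) : 0 < e -> exists n, (2^-1) ^+ n <= e.
Proof.
move=> e0; pose d n : R := - (2^-1) ^+ n.
have dS n : (2^-1) ^+ n.+1 = 2^-1 * (2^-1) ^+ n :> R by rewrite exprS.
have d0 n : 0 < (2^-1) ^+ n :> R by rewrite exprn_gt0// invr_gt0.
have e20 : 0 < 2^-1 * e by rewrite mulr_gt0// invr_gt0.
have [] := @bounded_increasing_cauchy _ d 0 _ _ _ e20.
- by move=> n; rewrite /d dS; have := d0 n; lra.
- by move=> n; rewrite /d; have := d0 n; lra.
- move=> N /(_ N N.+1 (leqnn N) (leqnSn N)); rewrite /d dS => dN.
  by exists N; lra.
Qed.

Lemma cauchy_halving (s : nat -> adjop V) (m : R) :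
  (forall n, opbd (s n.+1 - s n) (m * (2^-1) ^+ n)) -> exists T, oplim s T.
Proof.
move=> sd; have m0 : 0 <= m by have := opbd_ge0 (sd 0%N); rewrite mulr1.
pose d n : R := - (2 * m * (2^-1) ^+ n).
have dd n : d n.+1 - d n = m * (2^-1) ^+ n by rewrite /d exprS; field.
have p n : 0 <= (2^-1) ^+ n :> R by rewrite exprn_ge0// invr_ge0.
apply: (oplim_exists CS cV (d := d) (M := 0)) => n.
- by rewrite -subr_ge0 dd mulr_ge0.
- by rewrite oppr_le0 !mulr_ge0.
- by rewrite dd.
Qed.

(** e <= 1 absorbs the quadratic error term and keeps the estimate linear in e. *)
Lemma opbd_near (T S a b : adjop V) (m n e : R) :
  opbd T m -> opbd S n -> opbd (T - a) e -> opbd (S - b) e -> e <= 1 ->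
  opbd (T ** S - a ** b) ((m + n + 1) * e).
Proof.
move=> Tm Sn Ta Sb e1.
have -> : T ** S - a ** b = T ** (S - b) + (T - a) ** (S - (S - b)) by alg V.
apply: (@opbd_le _ _ _ _ (m * e + e * (n + e))).
  by have := opbd_ge0 Ta; have := opbd_ge0 Tm; have := opbd_ge0 Sn; nra.
by apply: opbdD => //; apply: opbdM => //; apply: opbdB.
Qed.

End HalvingSequences.

(** * Graphs of *-homomorphisms *)

Section StarRelation.
Variables (R : realType) (B C : cstarAlgType R[i]).
Variables (W : innerModType B) (V : innerModType C).
Hypotheses (CSW : cauchy_schwarz W) (cW : complete_module W).
Hypothesis CSV : cauchy_schwarz V.

(* The graph of a *-homomorphism whose domain need not be closed. For self-adjoint
   [a], [1 - sqrt (1 - a^2)] is of the form [M (a a)], so [sr_ideal] allows square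
   roots although the domain is not complete. *)
Record star_rel (G : adjop W -> adjop V -> Prop) : Prop := StarRel {
  srD : forall a b a' b', G a a' -> G b b' -> G (a + b) (a' + b');
  srZ : forall (c : R[i]) a a', G a a' -> G (c *: a) (c *: a');
  srM : forall a b a' b', G a a' -> G b b' -> G (a ** b) (a' ** b');
  srS : forall a a', G a a' -> G (star a) (star a');
  sr_fun0 : forall a', G 0 a' -> a' = 0;
  sr_ideal : forall a a' M, G a a' -> bounded M -> exists b', G (M ** (a ** a)) b';
  sr_bounded : forall a a', G a a' -> bounded a
}.

Variable G : adjop W -> adjop V -> Prop.
Hypothesis Gs : star_rel G.

Lemma srN a a' : G a a' -> G (- a) (- a').
Proof. by move=> /(srZ Gs (- 1)); rewrite !scaleN1r. Qed.

Lemma srB a b a' b' : G a a' -> G b b' -> G (a - b) (a' - b').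
Proof. by move=> aa /srN; exact: srD. Qed.

Lemma sr_fun a a' b' : G a a' -> G a b' -> a' = b'.
Proof.
move=> aa ab; apply/subr0_imp/(sr_fun0 Gs).
by rewrite -[X in G X](subrr a); exact: srB.
Qed.

Lemma half_in01 : 0 <= (2^-1 : R) < 1.
Proof. by lra. Qed.

Lemma sr_contract1 a a' : G a a' -> star a = a -> opbd a 1 -> opbd a' 1.
Proof.
move=> aa sa a1.
have sa' : star a' = a'.
  by apply: (sr_fun _ aa); rewrite -sa; exact: srS.
have ab : bounded a by exists 1.
pose q := a ** a.
have q1 : opbd q 1 by rewrite -[X in opbd _ X]mulr1; exact: opbdM.
have qs : star q = q by rewrite starM sa.
pose D := csqrt q.
have D1 : opbd D 1 by exact: opbd_csqrt.
have Deq : D + D - D ** D = q by exact: csqrt_eq.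
have Da : D ** a = a ** D by apply: csqrt_comm => //; rewrite /q; alg W.
have Ds : star D = D by exact: csqrt_star.
have E1 : opbd (2^-1 *: D) 2^-1 by rewrite -[X in opbd _ X]mulr1; exact: opbd_half.
(* From 2 D - D^2 = q, D is half of (1 - D/2)^-1 applied to q, that is (q + M q) / 2. So D lies in
   the domain: M q = M (a a) is what [sr_ideal] admits. *)
have [M [Mb _ MP]] := neumann CSW cW half_in01 E1.
have DE : D = 2^-1 *: (q + M ** q).
  have e : M ** D = (2^-1 *: D + M ** (2^-1 *: D)) ** D by rewrite -MP.
  by rewrite -Deq; alg_by W (esym e).
have [b' bb] := sr_ideal Gs aa Mb.
have [D' DD] : exists D', G D D'.
  by exists (2^-1 *: (a' ** a' + b')); rewrite DE; apply: srZ => //; apply: srD => //; exact: srM.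
have Ds' : star D' = D'.
  by apply: (sr_fun _ DD); rewrite -Ds; exact: srS.
have Da' : D' ** a' = a' ** D'.
  by apply: (@sr_fun (a ** D)); [rewrite -Da|]; exact: srM.
have Deq' : D' + D' - D' ** D' = a' ** a'.
  apply: (@sr_fun q); last exact: srM.
  by rewrite -Deq; apply: srB; [exact: srD|exact: srM].
have sY : star (idop V - D') = idop V - D' by rewrite starD starN_op star_idop Ds'.
apply: (opbd_commuting CSV (Y := idop V - D') (W := idop V)) => //.
- by rewrite sY sa'; alg_by V (esym Da').
- by rewrite sY sa' -Deq'; alg V.
- by rewrite expr1n; exact: opbd1.
Qed.

(** The C*-identity reduces to the self-adjoint [star a ** a], scaled to bound 1; m + e replaces m,
    which may be 0. *)
Lemma sr_contract a a' (m : R) : G a a' -> opbd a m -> opbd a' m.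
Proof.
move=> aa am; apply: opbd_lim => e e0.
have r0 : 0 < m + e by rewrite ltr_wpDl ?(opbd_ge0 am).
have {am} ar : opbd a (m + e) by apply: opbd_le am; rewrite lerDl ltW.
set r := m + e in r0 ar *.
have rr0 : 0 < r * r by rewrite mulr_gt0.
have h : G ((r * r)^-1%:C *: (star a ** a)) ((r * r)^-1%:C *: (star a' ** a')).
  by apply: srZ => //; apply: srM => //; exact: srS.
have hs : star ((r * r)^-1%:C *: (star a ** a)) = (r * r)^-1%:C *: (star a ** a).
  by rewrite starZr_op starM starK.
have h1 : opbd ((r * r)^-1%:C *: (star a ** a)) 1.
  have := opbdZr (r * r)^-1 (opbdM (opbd_star CSW ar) ar).
  by rewrite gtr0_norm ?invr_gt0// mulVf ?gt_eqF.
apply: (opbd_cstar CSV); first exact: ltW.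
have := opbdZr (r * r) (sr_contract1 h hs h1).
rewrite gtr0_norm// mulr1 scalerA -rmorphM /= mulfV ?gt_eqF// rmorph1 scale1r.
by rewrite expr2.
Qed.

End StarRelation.

(** * Norm closure of the graph of a homomorphism *)

Section Closure.
Variables (R : realType) (B C : cstarAlgType R[i]).
Variables (W : innerModType B) (V : innerModType C).
Hypotheses (CSW : cauchy_schwarz W) (cW : complete_module W).
Hypotheses (CSV : cauchy_schwarz V) (cV : complete_module V).
Variable G : adjop W -> adjop V -> Prop.
Hypothesis Gs : star_rel G.

Definition relclosure T T' := forall e : R, 0 < e ->
  exists a a', [/\ G a a', opbd (T - a) e & opbd (T' - a') e].

Lemma relclosure_sub a a' : G a a' -> relclosure a a'.
Proof.
move=> aa e e0; exists a, a'; rewrite !subrr.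
by split=> //; apply: opbd_le (ltW e0) (opbd0 _).
Qed.

(** Allows estimates up to a constant factor and for e <= 1 only, as products produce them. *)
Lemma relclosure_scaled T T' (K : R) :
  (forall e, 0 < e -> e <= 1 ->
     exists a a', [/\ G a a', opbd (T - a) (K * e) & opbd (T' - a') (K * e)]) ->
  relclosure T T'.
Proof.
move=> h e e0.
have K0 : 0 < `|K| + 1 by rewrite ltr_wpDl.
pose e' := Num.min 1 (e / (`|K| + 1)).
have e'0 : 0 < e' by rewrite lt_min ltr01 divr_gt0.
have [|a [a' [aa Ta Ta']]] := h e' e'0; first by rewrite ge_min lexx.
have Ke : K * e' <= e.
  have : e' <= e / (`|K| + 1) by rewrite ge_min lexx orbT.
  rewrite ler_pdivlMr//; have := ler_norm K; nra.
by exists a, a'; split=> //; exact: opbd_le Ke _.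
Qed.

Lemma relclosure_bounded T T' : relclosure T T' -> bounded T /\ bounded T'.
Proof.
move=> /(_ 1 ltr01)[a [a' [aa Ta Ta']]].
have [m am] := sr_bounded Gs aa; have am' := sr_contract CSW cW CSV Gs aa am.
rewrite -(subrK a T) -(subrK a' T').
by split; exists (1 + m); exact: opbdD.
Qed.

Lemma relclosure_contract T T' (m : R) : relclosure T T' -> opbd T m -> opbd T' m.
Proof.
move=> TT Tm; apply: opbd_lim => e e0.
have e30 : 0 < e / 2 by rewrite divr_gt0.
have [a [a' [aa Ta Ta']]] := TT _ e30.
have am : opbd a (m + e / 2).
  by rewrite -(subKr T a); exact: opbdB.
rewrite -(subrK a' T'); apply: opbd_le (opbdD CSV Ta' (sr_contract CSW cW CSV Gs aa am)).
by rewrite addrCA -splitr.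
Qed.

(** Contractivity turns approximations of T within 2^-n into a Cauchy sequence of partners:
    consecutive ones differ by at most 2^-n + 2^-(n+1), below twice 2^-n. *)
Lemma relclosure_ext T :
  (forall e : R, 0 < e -> exists a a', G a a' /\ opbd (T - a) e) ->
  exists T', relclosure T T'.
Proof.
move=> h.
have p n : 0 < (2^-1) ^+ n :> R by rewrite exprn_gt0// invr_gt0.
have /choice[s sP] : forall n, exists aa, G aa.1 aa.2 /\ opbd (T - aa.1) ((2^-1) ^+ n).
  by move=> n; have [a [a' aa]] := h _ (p n); exists (a, a').
have [n|T' TT'] := @cauchy_halving _ _ _ CSV cV (fun n => (s n).2) 2.
  apply: (sr_contract CSW cW CSV Gs (srB Gs (sP n.+1).1 (sP n).1)).
  have -> : (s n.+1).1 - (s n).1 = (T - (s n).1) - (T - (s n.+1).1) by alg W.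
  apply: opbd_le (opbdB CSW (sP n).2 (sP n.+1).2).
  by rewrite exprS; have := p n; lra.
exists T' => e e0; have [N1 h1] := TT' _ e0; have [N2 h2] := half_powers_small e0.
exists (s (maxn N1 N2)).1, (s (maxn N1 N2)).2; split; first exact: (sP _).1.
  apply: opbd_le (sP _).2; apply: le_trans h2.
  by rewrite ler_wiXn2l ?leq_maxr ?invr_ge0// invf_le1 ?ler1n.
by apply: h1; rewrite leq_maxl.
Qed.

(** Single-valuedness survives the closure by contractivity: a partner of 0 has bound 0. For
    [sr_ideal], a partner of M T^2 is the limit of partners of M a^2. *)
Lemma relclosure_star_rel : star_rel relclosure.
Proof.
split.
- move=> T S T' S' TT SS e e0; have e20 : 0 < e / 2 by rewrite divr_gt0.
  have [a [a' [aa Ta Ta']]] := TT _ e20; have [b [b' [bb Sb Sb']]] := SS _ e20.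
  exists (a + b), (a' + b'); split; first exact: srD.
  + by rewrite opprD addrACA (splitr e); exact: opbdD.
  + by rewrite opprD addrACA (splitr e); exact: opbdD.
- move=> c T T' TT; apply: (@relclosure_scaled _ _ (nr c)) => e e0 _.
  have [a [a' [aa Ta Ta']]] := TT _ e0; exists (c *: a), (c *: a').
  by split; [exact: srZ|rewrite -scalerBr; exact: opbdZ|rewrite -scalerBr; exact: opbdZ].
- move=> T S T' S' TT SS.
  have [[m Tm] [m' Tm']] := relclosure_bounded TT.
  have [[n Sn] [n' Sn']] := relclosure_bounded SS.
  have m0 := opbd_ge0 Tm; have m'0 := opbd_ge0 Tm'.
  have n0 := opbd_ge0 Sn; have n'0 := opbd_ge0 Sn'.
  apply: (@relclosure_scaled _ _ ((m + n + 1) + (m' + n' + 1))) => e e0 e1.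
  have [a [a' [aa Ta Ta']]] := TT _ e0; have [b [b' [bb Sb Sb']]] := SS _ e0.
  exists (a ** b), (a' ** b'); split; first exact: srM.
  + apply: opbd_le (opbd_near CSW Tm Sn Ta Sb e1).
    by rewrite ler_wpM2r ?(ltW e0)// lerDl !addr_ge0.
  + apply: opbd_le (opbd_near CSV Tm' Sn' Ta' Sb' e1).
    by rewrite ler_wpM2r ?(ltW e0)// lerDr !addr_ge0.
- move=> T T' TT e e0; have [a [a' [aa Ta Ta']]] := TT _ e0.
  exists (star a), (star a'); split; first exact: srS.
  + by rewrite -starN_op -starD; exact: opbd_star.
  + by rewrite -starN_op -starD; exact: opbd_star.
- move=> T' /relclosure_contract/(_ (opbd0 W)) T0.
  by apply: (opbd_eq0 CSV) => e e0; apply: opbd_le (ltW e0) T0.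
- move=> T T' M TT [k Mk]; apply: relclosure_ext => e e0.
  have [[m Tm] _] := relclosure_bounded TT.
  have m0 := opbd_ge0 Tm; have k0 := opbd_ge0 Mk.
  pose K := k * (m + m + 1) + 1.
  have K0 : 0 < K by rewrite ltr_wpDl// mulr_ge0// !addr_ge0.
  pose e' := Num.min 1 (e / K).
  have e'0 : 0 < e' by rewrite lt_min ltr01 divr_gt0.
  have e'1 : e' <= 1 by rewrite ge_min lexx.
  have [a [a' [aa Ta _]]] := TT _ e'0.
  have [b' bb] := sr_ideal Gs aa (bounded_opbd Mk).
  exists (M ** (a ** a)), b'; split=> //.
  have -> : M ** (T ** T) - M ** (a ** a) = M ** (T ** T - a ** a) by alg W.
  apply: opbd_le (opbdM Mk (opbd_near CSW Tm Tm Ta Ta e'1)).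
  have : e' <= e / K by rewrite ge_min lexx orbT.
  rewrite ler_pdivlMr// /K mulrDr mulr1 => h.
  by rewrite mulrA mulrC (le_trans _ h)// lerDl ltW.
- by move=> T T' /relclosure_bounded[].
Qed.

Lemma relclosure_closed T T' :
  (forall e : R, 0 < e ->
     exists a a', [/\ relclosure a a', opbd (T - a) e & opbd (T' - a') e]) ->
  relclosure T T'.
Proof.
move=> h e e0; have e20 : 0 < e / 2 by rewrite divr_gt0.
have [S [S' [SS TS TS']]] := h _ e20; have [a [a' [aa Sa Sa']]] := SS _ e20.
exists a, a'; split=> //.
- by rewrite -(subrK S T) -addrA (splitr e); exact: opbdD.
- by rewrite -(subrK S' T') -addrA (splitr e); exact: opbdD.
Qed.

End Closure.

(** * From dense range to surjectivity *)

Section DenseRange.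
Variables (R : realType) (B C : cstarAlgType R[i]).
Variables (W : innerModType B) (V : innerModType C).
Hypotheses (CSW : cauchy_schwarz W) (cW : complete_module W).
Hypotheses (CSV : cauchy_schwarz V) (cV : complete_module V).
Variable G : adjop W -> adjop V -> Prop.
Hypothesis Gs : star_rel G.
Hypothesis Gcl : forall T T', relclosure G T T' -> G T T'.

(* [f = b / (1 + b^2 / 4)] is bounded by 1 and close to [b] where [b] is small. *)
Lemma damped_exists (b : adjop W) : star b = b -> bounded b ->
  exists f, [/\ star f = f, opbd f 1 & f = b - 4^-1 *: (f ** (b ** b))].
Proof.
move=> sb bb.
have [_ [t bt]] := pos_square CSW cW sb bb.
have t0 := opbd_ge0 bt.
(* s and q are chosen so that 1 + b^2 / 4 = s (1 - q), with q of bound t / (4 s) < 1; the Neumann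
   series then inverts it. *)
pose s := 1 + t / 4; have s0 : 0 < s by rewrite ltr_wpDr// divr_ge0.
pose q := (s^-1 / 4)%:C *: (t%:C *: idop W - b ** b).
have q01 : 0 <= (s^-1 / 4 * t : R) < 1.
  rewrite !mulr_ge0 ?invr_ge0 ?(ltW s0)//=.
  have -> : s^-1 / 4 * t = (t / 4) / s by rewrite -mulrA mulrC [4^-1 * t]mulrC.
  by rewrite ltr_pdivrMr// mul1r /s ltrDr.
have qb : opbd q (s^-1 / 4 * t).
  have := opbdZr (s^-1 / 4) bt; rewrite ger0_norm//.
  by rewrite !mulr_ge0 ?invr_ge0 ?(ltW s0).
have qE : q = idop W - s^-1%:C *: (idop W + 4^-1%:C *: (b ** b)).
  have e : (s^-1%:C : R[i]) * (1 + (t / 4)%:C) = 1.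
    by rewrite -(rmorph1 (real_complex R)) -rmorphD -rmorphM /= mulVf ?gt_eqF.
  have -> : idop W = (s^-1%:C * (1 + (t / 4)%:C)) *: idop W by rewrite e scale1r.
  rewrite {2}e scale1r /q; alg W.
have [M [Mb M1 M2]] := neumann CSW cW q01 qb.
have bq : q ** b = b ** q by rewrite qE; alg W.
(* The commutator x satisfies x = q x, and 1 - q is invertible. *)
have Mbc : M ** b = b ** M.
  apply: subr0_imp; set x := M ** b - b ** M.
  have xq : x = q ** x.
    have -> : q ** x = (q ** M) ** b - (q ** b) ** M + (q ** b - q ** b) by rewrite /x; alg W.
    have qM : q ** M = M - q by rewrite {2}M1; alg W.
    by rewrite bq qM -amulA qM /x; alg_by W bq.
  have qx : q ** x = 0.
    clearbody x; have e : M ** x = (q + M ** q) ** x by rewrite -M2.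
    have e' : M ** x = M ** (q ** x) by rewrite -xq.
    by apply: (lin_comb (esym e)); rewrite e'; alg W.
  by rewrite xq.
pose f := s^-1%:C *: (b + M ** b).
have fb : f ** b = b ** f by rewrite /f !(amulZl, amulZr) amulDl amulDr amulA -Mbc -amulA.
have fq : s^-1%:C *: (f + 4^-1%:C *: (b ** b ** f)) = s^-1%:C *: b.
  have e : s^-1%:C *: (M ** b) = s^-1%:C *: ((q + q ** M) ** b) by rewrite -M1.
  have -> : s^-1%:C *: (f + 4^-1%:C *: (b ** b ** f)) = f - q ** f by rewrite qE; alg W.
  by rewrite /f; alg_by W e.
have c4 : 4^-1%:C = 4^-1 :> R[i] by rewrite fmorphV /= rmorph_nat.
have fA : f = b - 4^-1 *: (b ** b ** f).
  have : s%:C *: (s^-1%:C *: (f + 4^-1%:C *: (b ** b ** f))) = s%:C *: (s^-1%:C *: b).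
    by rewrite fq.
  rewrite !scalerA -rmorphM /= mulfV ?gt_eqF// rmorph1 !scale1r c4 => h.
  by rewrite -[X in X - _]h addrK.
have sf : star f = b - 4^-1 *: (star f ** (b ** b)).
  rewrite {1}fA starD starN_op starZ !starM sb; congr (_ - _ *: _).
  by rewrite -[RHS]c4 -c4; apply/eqP; rewrite eq_complex /= oppr0 !eqxx.
(* [star f ** f] is expanded in two ways, with the equation of f and with its adjoint;
   self-adjointness of f then follows without computing [star M]. *)
have sfb : star f ** b = b ** f.
  have e1 : star f ** f = star f ** (b - 4^-1 *: (b ** b ** f)) by rewrite -fA.
  have e2 : star f ** f = (b - 4^-1 *: (star f ** (b ** b))) ** f by rewrite -sf.
  by apply: (lin_comb (etrans (esym e1) e2)); alg W.
have bbf : f ** (b ** b) = b ** b ** f by rewrite (amulA f b b) fb -(amulA b f b) fb amulA.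
have fs : star f = f by rewrite sf amulA sfb -fb -amulA bbf -fA.
exists f; split=> //; last by rewrite bbf.
(* For b = 2 tan theta, f is sin (2 theta) and Y is cos (2 theta), hence Y^2 + f^2 = 1. *)
pose Y := idop W - 2^-1%:C *: (b ** f).
have sY : star Y = Y.
  by rewrite starD starN_op star_idop starZr_op starM sb fs fb.
apply: (opbd_commuting CSW (Y := Y) (W := idop W)) => //.
- rewrite sY fs; have e : b ** f ** f = f ** (b ** f) by rewrite amulA fb.
  have {}e : 2^-1%:C *: (b ** f ** f) = 2^-1%:C *: (f ** (b ** f)) by rewrite e.
  by rewrite /Y; alg_by W (esym e).
- rewrite sY fs.
  have e1 : f ** f = (b - 4^-1 *: (b ** b ** f)) ** f by rewrite -fA.
  have e2 : 4^-1 *: (b ** f ** (b ** f)) = 4^-1 *: (b ** b ** f ** f).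
    by rewrite amulA -(amulA b f b) fb !amulA.
  have -> : Y ** Y = idop W - b ** f + 4^-1 *: (b ** f ** (b ** f)) by rewrite /Y; alg W.
  by rewrite e2 e1; alg W.
- by rewrite expr1n; exact: opbd1.
Qed.

Definition in_range_closure T' := forall e : R, 0 < e ->
  exists a a', G a a' /\ opbd (T' - a') e.

Lemma star_half_sum (T : adjop V) :
  star (2^-1%:C *: (T + star T)) = 2^-1%:C *: (T + star T).
Proof. by rewrite starZr_op starD starK addrC. Qed.

Lemma opbd_halfr (T : adjop V) (m : R) :
  opbd T m -> opbd (2^-1%:C *: T) (2^-1 * m).
Proof. by move=> /(opbdZr 2^-1); rewrite ger0_norm// invr_ge0. Qed.

(** The preimage b of an approximant b' may be large. Damping replaces it by f of bound 1, whose
    image differs from b' only by f' b'^2 / 4; with b' within 1/8 of c' the error is at most 1/8 +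
    (9/8)^2 / 4 < 1/2. *)
Lemma lift_step c' : star c' = c' -> opbd c' 1 -> in_range_closure c' ->
  exists f f', [/\ G f f', star f = f, opbd f 1 & opbd (c' - f') 2^-1].
Proof.
move=> sc c1 cG; have e80 : 0 < 8^-1 :> R by rewrite invr_gt0.
have [a [a' [aa ca]]] := cG _ e80.
pose b := 2^-1%:C *: (a + star a); pose b' := 2^-1%:C *: (a' + star a').
have bb : G b b' by apply: srZ => //; apply: srD => //; exact: srS.
have sb : star b = b by rewrite starZr_op starD starK addrC.
have cb : opbd (c' - b') 8^-1.
  have -> : c' - b' = 2^-1%:C *: ((c' - a') + star (c' - a')).
    by rewrite starD starN_op sc /b'; alg V.
  have -> : 8^-1 = 2^-1 * (8^-1 + 8^-1) :> R by field.
  by apply: opbd_halfr; apply: opbdD => //; exact: opbd_star.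
have b'1 : opbd b' (9 / 8).
  rewrite -(subKr c' b'); have -> : 9 / 8 = 1 + 8^-1 :> R by field.
  exact: opbdB.
have [f [sf f1 fE]] := damped_exists sb (sr_bounded Gs bb).
have [g' gg] := sr_ideal Gs bb (bounded_opbd f1).
have ff : G f (b' - 4^-1 *: g').
  by rewrite fE; apply: srB => //; apply: srZ => //; rewrite -fE.
pose f' := b' - 4^-1 *: g'; rewrite -/f' in ff.
have gE : g' = f' ** (b' ** b').
  by apply: (sr_fun Gs gg); apply: srM => //; exact: srM.
exists f, f'; split=> //.
have f'1 := sr_contract CSW cW CSV Gs ff f1.
have -> : c' - f' = (c' - b') + 4^-1%:C *: (f' ** (b' ** b')).
  rewrite -gE /f'; have -> : 4^-1%:C = 4^-1 :> R[i] by rewrite fmorphV /= rmorph_nat.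
  by alg V.
have := opbdD CSV cb (opbdZr 4^-1 (opbdM f'1 (opbdM b'1 b'1))).
by apply: opbd_le; rewrite ger0_norm ?invr_ge0//; lra.
Qed.

(** Twice the remainder of a step again satisfies [P], so c' is the sum of the 2^-n f'_n. As every
    f_n has bound 1, the sum of the 2^-n f_n converges, and closedness of G relates the two sums. *)
Lemma lift_selfadjoint c' : star c' = c' -> opbd c' 1 -> in_range_closure c' ->
  exists c, G c c'.
Proof.
pose P (x : adjop V) := [/\ star x = x, opbd x 1 & in_range_closure x].
have step (x : {x | P x}) : exists z : adjop W * adjop V * {x | P x},
    [/\ G z.1.1 z.1.2, opbd z.1.1 1 & sval z.2 = 2%:C *: (sval x - z.1.2)].
  case: x => x [sx x1 xG] /=.
  have [f [f' [ff sf f1 xf]]] := lift_step sx x1 xG.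
  have sf' : star f' = f' by apply: (sr_fun Gs _ ff); rewrite -sf; exact: srS.
  suff Py : P (2%:C *: (x - f')) by exists (f, f', exist P _ Py).
  split; first by rewrite starZr_op starD starN_op sx sf'.
    by have := opbdZr 2 xf; rewrite ger0_norm// mulfV ?pnatr_eq0.
  move=> e e0; have e20 : 0 < 2^-1 * e by rewrite mulr_gt0// invr_gt0.
  have [a [a' [aa xa]]] := xG _ e20.
  exists (2%:C *: (a - f)), (2%:C *: (a' - f')); split.
    by apply: srZ => //; exact: srB.
  have -> : 2%:C *: (x - f') - 2%:C *: (a' - f') = 2%:C *: (x - a') by alg V.
  by have := opbdZr 2 xa; rewrite ger0_norm// mulVKf ?pnatr_eq0.
have [next nextP] := choice step.
move=> sc c1 cG; have Pc : P c' by [].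
pose x n := iter n (fun y => (next y).2) (exist P c' Pc).
pose f n := (next (x n)).1.1; pose f' n := (next (x n)).1.2.
pose S := fix S n : adjop W := if n is n'.+1 then S n' + (2^-1 ^+ n')%:C *: f n' else 0.
pose S' := fix S n : adjop V := if n is n'.+1 then S n' + (2^-1 ^+ n')%:C *: f' n' else 0.
have p n : 0 <= 2^-1 ^+ n :> R by rewrite exprn_ge0// invr_ge0.
have fP n : G (f n) (f' n) by have [] := nextP (x n).
have f1 n : opbd (f n) 1 by have [] := nextP (x n).
have xS n : sval (x n.+1) = 2%:C *: (sval (x n) - f' n) by have [] := nextP (x n).
(* Starting at 1 makes the pair (0, 0) unnecessary; the index n below is a successor for this
   reason. *)
have SS n : (0 < n)%N -> G (S n) (S' n).
  elim: n => [//|[|n] IH] _ /=; first by rewrite !add0r; exact: srZ.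
  by apply: srD; [exact: Gs|exact: IH|exact: srZ].
have cS n : c' - S' n = (2^-1 ^+ n)%:C *: sval (x n).
  elim: n => [|n IH]; first by rewrite expr0 rmorph1 scale1r subr0.
  rewrite xS /= exprS rmorphM /= opprD addrA IH.
  have h2 : (2^-1%:C : R[i]) * 2%:C = 1 by rewrite -rmorphM /= mulVf ?pnatr_eq0.
  rewrite scalerA mulrAC h2 mul1r scalerBr; congr (_ - _).
have [|T TP] := cauchy_halving CSW cW (s := S) (m := 1).
  move=> n /=; rewrite addrC addKr.
  by have := opbdZr (2^-1 ^+ n) (f1 n); rewrite ger0_norm// mulr1 mul1r.
exists T; apply: Gcl => e e0.
have [N1 h1] := TP _ e0; have [N2 h2] := half_powers_small e0.
pose n := (maxn N1 N2).+1.
have n1 : (N1 <= n)%N by rewrite leqW// leq_maxl.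
have n2 : (N2 <= n)%N by rewrite leqW// leq_maxr.
exists (S n), (S' n); split; [exact: SS|exact: h1|].
rewrite cS; have [_ x1 _] := svalP (x n).
apply: opbd_le (opbdZr _ x1); rewrite ger0_norm// mulr1 (le_trans _ h2)//.
by rewrite ler_wiXn2l ?invr_ge0// invf_le1 ?ler1n.
Qed.

(** Real and imaginary parts are lifted separately; the sign in y is such that c' = x - i y. *)
Lemma dense_range_surjective c' : in_range_closure c' -> exists c, G c c'.
Proof.
have lift_sa (x : adjop V) : star x = x -> in_range_closure x -> exists c, G c x.
  move=> sx xG; have xb : bounded x.
    have [a [a' [aa xa]]] := xG 1 ltr01; have [m am] := sr_bounded Gs aa.
    rewrite -(subrK a' x); exists (1 + m).
    by apply: opbdD => //; exact: (sr_contract CSW cW CSV Gs aa am).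
  have [r [r0 x1 <-]] := bounded_scale xb.
  have [||c cx] := lift_selfadjoint _ x1; first by rewrite starZr_op sx.
    move=> e e0; have [a [a' [aa xa]]] := xG _ (mulr_gt0 r0 e0).
    exists (r^-1%:C *: a), (r^-1%:C *: a'); split; first exact: srZ.
    rewrite -scalerBr; have := opbdZr r^-1 xa.
    by rewrite gtr0_norm ?invr_gt0// mulKf ?gt_eqF.
  by exists (r%:C *: c); exact: srZ.
move=> cG; pose x := 2^-1%:C *: (c' + star c').
pose y : adjop V := 2^-1%:C *: ('i *: (c' - star c')).
have sy : star y = y.
  by rewrite starZr_op starZ starD starN_op starK conjCi scaleNr -scalerN opprB.
have [|a aa] := lift_sa x (star_half_sum c').
  move=> e e0; have [a [a' [aa ca]]] := cG _ e0.
  exists (2^-1%:C *: (a + star a)), (2^-1%:C *: (a' + star a')); split.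
    by apply: srZ => //; apply: srD => //; exact: srS.
  have -> : x - 2^-1%:C *: (a' + star a') = 2^-1%:C *: ((c' - a') + star (c' - a')).
    by rewrite starD starN_op /x; alg V.
  have -> : e = 2^-1 * (e + e) by field.
  by apply: opbd_halfr; apply: opbdD => //; exact: opbd_star.
have [|b bb] := lift_sa y sy.
  move=> e e0; have [d [d' [dd cd]]] := cG _ e0.
  exists (2^-1%:C *: ('i *: (d - star d))), (2^-1%:C *: ('i *: (d' - star d'))); split.
    by apply: srZ => //; apply: srZ => //; apply: srB => //; exact: srS.
  have -> : y - 2^-1%:C *: ('i *: (d' - star d'))
      = 2^-1%:C *: ('i *: ((c' - d') - star (c' - d'))).
    by rewrite starD starN_op /y; alg V.
  have -> : e = 2^-1 * (1 * (e + e)) by field.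
  apply: opbd_halfr; rewrite -[X in X * _](nr_i R); apply: opbdZ.
  by apply: opbdB => //; exact: opbd_star.
exists (a - 'i *: b).
have -> : c' = x - 'i *: y.
  have ii : 'i *: y = - (2^-1%:C *: (c' - star c')).
    by rewrite /y !scalerA mulrAC -expr2 sqrCi mulN1r scaleNr.
  rewrite ii /x; have -> : 2^-1%:C = 2^-1 :> R[i] by rewrite fmorphV /= rmorph_nat.
  by alg V.
by apply: srB => //; exact: srZ.
Qed.

End DenseRange.

(** * The relations induced by a ternary homomorphism *)

Lemma gt0_complex (R : realType) (e : R[i]) : 0 < e -> exists2 r : R, 0 < r & e = r%:C.
Proof.
case: e => a b; rewrite ltcE /= => /andP[/eqP -> a0].
by exists a.
Qed.

Section HilbertOperators.
Variables (R : realType) (B : cstarAlgType R[i]) (E : hilbModType B).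

Lemma nr_ract (x : E) (b : B) : nr (ract x b) <= nr x * nr b.
Proof.
rewrite -(@ler_pXn2r _ 2) ?nnegrE ?mulr_ge0 ?nr_ge0//.
rewrite -!vn_hilb !vn_sqr ip_ract ip_ractl.
rewrite (le_trans (nrM _ _))// (le_trans (ler_wpM2r (nr_ge0 _) (nrM _ _)))//.
by rewrite nr_star -vn_sqr exprMn -mulrA mulrCA -expr2.
Qed.

Lemma compact_opbd (T : adjop E) : compact_op T -> bounded T.
Proof.
move=> /Defs.compact_bounded[M /gt0_complex[m m0 ->] Tm]; exists m.
split=> [|x]; first exact: ltW.
by rewrite !vn_hilb -lecR rmorphM /= -!nrE.
Qed.

Lemma compact_comp (M T : adjop E) : bounded M -> compact_op T -> compact_op (M ** T).
Proof.
move=> [m Mm] cT _ /gt0_complex[e e0 ->].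
have m0 := opbd_ge0 Mm.
have p0 : 0 < e / (m + 1) by rewrite divr_gt0// ltr_wpDl.
have pC : 0 < (e / (m + 1))%:C :> R[i] by rewrite ltcR.
have [S fS TS] := cT _ pC; exists (M ** S) => [|x].
  move: S fS {TS}; apply: lspan_ind => [|S S' fS fS'|c S fS|_ [y [z ->]]].
  - by rewrite amulr0; exact: lspan0.
  - by rewrite amulDr; exact: lspanD.
  - by rewrite amulZr; exact: lspanZ.
  - by rewrite adjop_comp_rank1; apply: lspan_gen; exists (M y), z.
have -> : (M ** T) x - (M ** S) x = M (T x - S x).
  by rewrite adjop_add -[in RHS](scaleN1r (S x)) adjop_scale scaleN1r.
have {}TS : nr (T x - S x) <= e / (m + 1) * nr x.
  by rewrite -lecR rmorphM /= -!nrE.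
rewrite !nrE -rmorphM lecR -(vn_hilb (M _)); apply: (le_trans (Mm.2 _)); rewrite vn_hilb.
rewrite (le_trans (ler_wpM2l m0 TS))// mulrA ler_wpM2r ?nr_ge0//.
by rewrite mulrCA ger_pMr// ler_pdivrMr ?ltr_wpDl// mul1r lerDl.
Qed.

Lemma compact_opbdP (T : adjop E) : compact_op T <->
  forall e : R, 0 < e -> exists2 S, finite_rank S & opbd (T - S) e.
Proof.
split=> [cT e e0|h _ /gt0_complex[e e0 ->]].
  have eC : 0 < e%:C :> R[i] by rewrite ltcR.
  have [S fS TS] := cT _ eC; exists S => //; split=> [|x]; first exact: ltW.
  by rewrite !vn_hilb -lecR rmorphM /= -!nrE; exact: TS.
have [S fS [_ TS]] := h _ e0; exists S => // x.
by have := TS x; rewrite !vn_hilb -lecR rmorphM /= -!nrE.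
Qed.

Lemma range_ideal_nrP (b : B) : range_ideal E b <-> forall e : R, 0 < e ->
  exists2 w, lspan [set b | exists x y : E, b = ip x y]%classic w & nr (b - w) <= e.
Proof.
split=> [/Defs.closureE h e e0|h].
  have eC : 0 < e%:C :> R[i] by rewrite ltcR.
  have [w Iw bw] := h _ eC; exists w => //.
  by rewrite -lecR -nrE ltW.
apply/Defs.closureE => _ /gt0_complex[e e0 ->].
have e20 : 0 < e / 2 by rewrite divr_gt0.
have [w Iw bw] := h _ e20; exists w => //.
by rewrite nrE ltcR (le_lt_trans bw)// ltr_pdivrMr// ltr_pMr// ltr1n.
Qed.

(** [mulop] is isometric and B is complete. This brings limits of operators on [selfmod B] back to
    elements of B. *)
Lemma mulop_closed (T : adjop (selfmod B)) :
  (forall e : R, 0 < e -> exists b, opbd (T - mulop b) e) -> exists b, T = mulop b.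
Proof.
move=> h; have CS := @selfmod_cauchy_schwarz _ B.
have p n : 0 < (2^-1) ^+ n :> R by rewrite exprn_gt0// invr_gt0.
have [s sP] := choice (fun n => h _ (p n)).
pose d n : R := - (4 * (2^-1) ^+ n).
have dd n : d n.+1 - d n = 2 * (2^-1) ^+ n by rewrite /d exprS; field.
have [n|n|n|l lP] := @complete_nr _ B s d 0.
- by rewrite -subr_ge0 dd mulr_ge0// ltW.
- by rewrite oppr_le0 mulr_ge0// ltW.
- rewrite dd; apply: mulop_opbd; rewrite mulopB.
  have -> : mulop (s n.+1) - mulop (s n) = (T - mulop (s n)) - (T - mulop (s n.+1)).
    by rewrite opprB [RHS]addrC addrA subrK.
  apply: opbd_le (opbdB CS (sP n) (sP n.+1)).
  by rewrite exprS; have := p n; lra.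
exists l; apply: subr0_imp; apply: (@opbd_eq0_scaled _ _ _ CS _ 2) => // e e0.
have [N1 h1] := lP _ e0; have [N2 h2] := half_powers_small e0.
set n := maxn N1 N2.
have -> : T - mulop l = (T - mulop (s n)) - mulop (l - s n).
  by rewrite mulopB opprB addrA subrK.
rewrite mulr_natl mulr2n; apply: opbdB => //.
  apply: opbd_le (sP n); rewrite (le_trans _ h2)//.
  by rewrite ler_wiXn2l ?leq_maxr ?invr_ge0// invf_le1 ?ler1n.
by apply: opbd_le (opbd_mulop _); apply: h1; rewrite leq_maxl.
Qed.

End HilbertOperators.

Section TernaryRelations.
Variables (R : realType) (B C : cstarAlgType R[i]).
Variables (E : hilbModType B) (F : hilbModType C) (u : E -> F).
Hypotheses (u_lin : linear u)
  (u_ternary : forall x y z, u (ract x (ip y z)) = ract (u x) (ip (u y) (u z))).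

Lemma linear_mapD x y : u (x + y) = u x + u y.
Proof. by have := u_lin 1 x y; rewrite !scale1r. Qed.

Lemma linear_map0 : u 0 = 0.
Proof. by apply: (addrI (u 0)); rewrite -linear_mapD !addr0. Qed.

Lemma linear_mapZ c x : u (c *: x) = c *: u x.
Proof. by have := u_lin c x 0; rewrite !addr0 linear_map0 addr0. Qed.

(** A span of pairs and not a map: that linear relations among the <x, y> persist among the <u x, u
    y> is the content of [ip_pairs_fun0]. *)
Definition ip_pairs : set (B * C) :=
  lspan [set p | exists x y, p = (ip x y : B, ip (u x) (u y) : C)]%classic.

Definition rank1_pairs : set (adjop E * adjop F) :=
  lspan [set p | exists x y, p = (rank1 x y, rank1 (u x) (u y))]%classic.

Lemma ip_pairs_ract p : ip_pairs p -> forall x, u (ract x p.1) = ract (u x) p.2.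
Proof.
move: p; apply: lspan_ind => [x|p q hp hq x|c p hp x|_ [y [z ->]] x] /=.
- by rewrite !ract0r linear_map0.
- by rewrite !ractDr linear_mapD hp hq.
- by rewrite !ractZr linear_mapZ hp.
- exact: u_ternary.
Qed.

Lemma rank1_pairs_app p : rank1_pairs p -> forall x, u (p.1 x) = p.2 (u x).
Proof.
move: p; apply: lspan_ind => [x|p q hp hq x|c p hp x|_ [y [z ->]] x] /=.
- exact: linear_map0.
- by rewrite linear_mapD hp hq.
- by rewrite linear_mapZ hp.
- exact: u_ternary.
Qed.

Lemma ip_pairsM p q : ip_pairs p -> ip_pairs q -> ip_pairs (p.1 ** q.1, p.2 ** q.2).
Proof.
move=> + Pq; move: p; apply: lspan_ind => [|p p' hp hp'|c p hp|_ [x [y ->]]].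
- by rewrite !amull0; exact: lspan0.
- by rewrite !amulDl; exact: (lspanD hp hp').
- by rewrite !amulZl; exact: (lspanZ c hp).
- rewrite -!ip_ract /= -(ip_pairs_ract Pq).
  by apply: lspan_gen; exists x, (ract y q.1).
Qed.

Lemma ip_pairsS p : ip_pairs p -> ip_pairs (star p.1, star p.2).
Proof.
move: p; apply: lspan_ind => [|p p' hp hp'|c p hp|_ [x [y ->]]].
- by rewrite !star0; exact: lspan0.
- by rewrite !starD; exact: (lspanD hp hp').
- by rewrite !starZ; exact: (lspanZ _ hp).
- by rewrite !ip_star; apply: lspan_gen; exists y, x.
Qed.

Lemma ip_pairs_ideal d p : ip_pairs p -> exists c, ip_pairs (d ** p.1, c).
Proof.
move: p; apply: lspan_ind => [|p p' [c hc] [c' hc']|a p [c hc]|_ [x [y ->]]] /=.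
- by exists 0; rewrite amulr0; exact: lspan0.
- by exists (c + c'); rewrite amulDr; exact: (lspanD hc hc').
- by exists (a *: c); rewrite amulZr; exact: (lspanZ a hc).
- exists (ip (u (ract x (star d))) (u y)).
  rewrite -{1}(starK d) -ip_ractl.
  by apply: lspan_gen; exists (ract x (star d)), y.
Qed.

Lemma ip_pairs_fun0 c : ip_pairs (0, c) -> c = 0.
Proof.
move=> P0; have h x : ract (u x) c = 0.
  by rewrite -(ip_pairs_ract P0) ract0r linear_map0.
(* c is itself a combination of products <u x, u y>, whose adjoints annihilate it; the pair (0, c)
   yields [star c ** c = 0]. *)
have : forall p, ip_pairs p -> star p.2 ** c = 0.
  apply: lspan_ind => [|p p' hp hp'|a p hp|_ [x [y ->]]] /=.
  - by rewrite star0 amull0.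
  - by rewrite starD amulDl hp hp' addr0.
  - by rewrite starZ amulZl hp scaler0.
  - by rewrite ip_star -ip_ract h ip0r.
move=> /(_ _ P0) /= cc; apply: nr_eq0; apply/eqP.
by rewrite -sqrf_eq0 -nr_cstar cc nr0.
Qed.

Lemma rank1_pairsM p q : rank1_pairs p -> rank1_pairs q ->
  rank1_pairs (p.1 ** q.1, p.2 ** q.2).
Proof.
move=> Pp; move: q; apply: lspan_ind => [|q q' hq hq'|c q hq|_ [x [y ->]]].
- by rewrite !amulr0; exact: lspan0.
- by rewrite !amulDr; exact: (lspanD hq hq').
- by rewrite !amulZr; exact: (lspanZ c hq).
- rewrite !adjop_comp_rank1 -(rank1_pairs_app Pp).
  by apply: lspan_gen; exists (p.1 x), y.
Qed.

Lemma rank1_pairsS p : rank1_pairs p -> rank1_pairs (star p.1, star p.2).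
Proof.
move: p; apply: lspan_ind => [|p p' hp hp'|c p hp|_ [x [y ->]]].
- have -> : (star (0 : adjop E), star (0 : adjop F)) = 0 by congr pair; exact: adjopE.
  exact: lspan0.
- by rewrite !starD; exact: (lspanD hp hp').
- by rewrite !starZ; exact: (lspanZ _ hp).
- by rewrite !rank1_star; apply: lspan_gen; exists y, x.
Qed.

Lemma rank1_pairs_ideal M p : rank1_pairs p -> exists k, rank1_pairs (M ** p.1, k).
Proof.
move: p; apply: lspan_ind => [|p p' [c hc] [c' hc']|a p [c hc]|_ [x [y ->]]] /=.
- by exists 0; rewrite amulr0; exact: lspan0.
- by exists (c + c'); rewrite amulDr; exact: (lspanD hc hc').
- by exists (a *: c); rewrite amulZr; exact: (lspanZ a hc).
- exists (rank1 (u (M x)) (u y)); rewrite adjop_comp_rank1.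
  by apply: lspan_gen; exists (M x), y.
Qed.

Lemma rank1_pairs_fun0 k : rank1_pairs (0, k) -> k = 0.
Proof.
move=> P0; have h x : k (u x) = 0 by rewrite -(rank1_pairs_app P0) linear_map0.
have : forall p, rank1_pairs p -> k ** p.2 = 0.
  apply: lspan_ind => [|p p' hp hp'|a p hp|_ [x [y ->]]] /=.
  - by rewrite amulr0.
  - by rewrite amulDr hp hp' addr0.
  - by rewrite amulZr hp scaler0.
  - by rewrite adjop_comp_rank1 h; apply: adjopE => z; exact: ract0l.
(* The adjoint of the pair (0, k) is inserted, which gives [k ** star k = 0]. *)
move=> /(_ _ (rank1_pairsS P0)) /= kk.
have CS := @hilb_cauchy_schwarz _ _ F.
have k0 : star k = 0.
  apply: (opbd_eq0 CS) => e e0; apply: (opbd_cstar CS); first exact: ltW.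
  by rewrite starK kk; apply: opbd_le (opbd0 _); exact: sqr_ge0.
by rewrite -(starK k) k0; exact: adjopE.
Qed.

Definition rel11 (T : adjop (selfmod B)) (T' : adjop (selfmod C)) :=
  exists b c, [/\ ip_pairs (b, c), T = mulop b & T' = mulop c].

Definition rel22 (T : adjop E) (T' : adjop F) := rank1_pairs (T, T').

Lemma rel11_star_rel : star_rel rel11.
Proof.
split.
- move=> _ _ _ _ [b [c [bc -> ->]]] [b' [c' [bc' -> ->]]].
  by exists (b + b'), (c + c'); rewrite !mulopD; split=> //; exact: (lspanD bc bc').
- move=> a _ _ [b [c [bc -> ->]]].
  by exists (a *: b), (a *: c); rewrite !mulopZ; split=> //; exact: (lspanZ a bc).
- move=> _ _ _ _ [b [c [bc -> ->]]] [b' [c' [bc' -> ->]]].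
  by exists (b ** b'), (c ** c'); rewrite !mulopM; split=> //; exact: (ip_pairsM bc bc').
- move=> _ _ [b [c [bc -> ->]]].
  by exists (star b), (star c); rewrite !mulop_star; split=> //; exact: (ip_pairsS bc).
- move=> _ [b [c [bc b0 ->]]].
  have {}b0 : b = 0.
    by apply: mulop_inj; rewrite -b0; apply: adjopE => x; exact/esym/amull0.
  move: bc; rewrite b0 => /ip_pairs_fun0 ->.
  by apply: adjopE => x; exact: amull0.
(* M commutes with the right action, so [M ** (a ** a)] is left multiplication by (M b) b. One
   factor b turns M into an element of B, the other keeps the product in the span; hence the square
   in [sr_ideal]. *)
- move=> _ _ M [b [c [bc -> _]]] _.
  have [c' bc'] := ip_pairs_ideal (M b : B) bc.
  exists (mulop c'), ((M b : B) ** b), c'; split=> //.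
  apply: adjopE => x /=.
  rewrite -[b ** (b ** x)]/(ract (b : selfmod B) (b ** x)) adjop_ract.
  exact: amulA.
- by move=> _ _ [b [c [_ -> _]]]; exists (nr b); exact: opbd_mulop.
Qed.

Lemma finite_rank_opbd (T : adjop E) : finite_rank T -> bounded T.
Proof.
move=> fT; apply: compact_opbd; apply/compact_opbdP => e e0; exists T => //.
by rewrite subrr; apply: opbd_le (opbd0 _); exact: ltW.
Qed.

Lemma rank1_pairs_finite p : rank1_pairs p -> finite_rank p.1 /\ finite_rank p.2.
Proof.
move: p; apply: lspan_ind => [|p p' [h1 h2] [h1' h2']|a p [h1 h2]|_ [x [y ->]]] /=.
- by split; exact: lspan0.
- by split; exact: lspanD.
- by split; exact: lspanZ.
- by split; apply: lspan_gen; [exists x, y|exists (u x), (u y)].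
Qed.

Lemma rel22_star_rel : star_rel rel22.
Proof.
split.
- by move=> T S T' S' h h'; exact: (lspanD h h').
- by move=> c T T' h; exact: (lspanZ c h).
- by move=> T S T' S' h h'; exact: (rank1_pairsM h h').
- by move=> T T' h; exact: (rank1_pairsS h).
- by move=> T' h; exact: rank1_pairs_fun0.
- move=> T T' M h _; have [k hk] := rank1_pairs_ideal M h.
  by exists (k ** T'); rewrite amulA; exact: (rank1_pairsM hk h).
- by move=> T T' /rank1_pairs_finite[/finite_rank_opbd].
Qed.

End TernaryRelations.

(** * Homomorphisms of linking algebras *)

Section BlockOperators.
Variables (K : numClosedFieldType) (B : cstarAlgType K) (E : hilbModType B).
Implicit Types (b c : B) (x y : E) (k l : adjop E).

Lemma blockopD b x y k b' x' y' k' : blockop b x y k + blockop b' x' y' k' =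
  blockop (b + b') (x + x') (y + y') (k + k').
Proof.
apply: adjopE => -[c z]; apply: (congr2 pair) => /=.
  by rewrite amulDl ipDl addrACA.
by rewrite ractDl addrACA.
Qed.

Lemma blockopZ (a : K) b x y k : a *: blockop b x y k =
  blockop (a *: b) (a^* *: x) (a *: y) (a *: k).
Proof.
apply: adjopE => -[c z]; apply: (congr2 pair) => /=.
  by rewrite amulZl ipZl conjCK scalerDr.
by rewrite ractZl scalerDr.
Qed.

Lemma blockopM b x y k b' x' y' k' : blockop b x y k ** blockop b' x' y' k' =
  blockop (b ** b' + ip x y') (ract x' (star b) + star k' x)
    (ract y b' + k y') (rank1 y x' + k ** k').
Proof.
apply: adjopE => -[c z]; apply: (congr2 pair) => /=.
  rewrite amulDl ipDl amulDr ipDr amulA ip_ractl starK ip_ract.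
  by rewrite -(adjopP' k') addrACA.
by rewrite ractDr ractDl adjop_add ractA adjop_ract addrACA.
Qed.

Lemma blockop_star b x y k : star (blockop b x y k) = blockop (star b) y x (star k).
Proof. exact: adjopE. Qed.

Lemma blockop0 : blockop 0 0 0 0 = 0 :> adjop (dsum E).
Proof.
by apply: adjopE => -[c z]; apply: (congr2 pair) => /=;
  rewrite ?amul0l ?ract0l ?ip0l ?addr0.
Qed.

Variable I : corner11 E.

Lemma linking_blockopP (M : linking_over I) : exists b x y k,
  [/\ sa_set I b, compact_op k & sa_val M = blockop b x y k].
Proof. by case: M => M LM; exact: LM. Qed.

End BlockOperators.

Section LinkingExtension.
Variables (R : realType) (B C : cstarAlgType R[i]).
Variables (E : hilbModType B) (F : hilbModType C) (u : E -> F).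
Hypotheses (u_lin : linear u)
  (u_ternary : forall x y z, u (ract x (ip y z)) = ract (u x) (ip (u y) (u z))).

Let CSE := @hilb_cauchy_schwarz _ _ E.
Let CSF := @hilb_cauchy_schwarz _ _ F.
Let cE := @hilb_complete _ _ E.
Let cF := @hilb_complete _ _ F.
Let CSB := @selfmod_cauchy_schwarz _ B.
Let CSC := @selfmod_cauchy_schwarz _ C.
Let cB := @selfmod_complete _ B.
Let cC := @selfmod_complete _ C.
Let sr11 := rel11_star_rel u_lin u_ternary.
Let sr22 := rel22_star_rel u_lin u_ternary.

Definition cl11 (b : B) (c : C) := relclosure (rel11 u) (mulop b) (mulop c).
Definition cl22 (k : adjop E) (l : adjop F) := relclosure (rel22 u) k l.

Let cl11_sr := relclosure_star_rel CSB cB CSC cC sr11.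
Let cl22_sr := relclosure_star_rel CSE cE CSF cF sr22.

Lemma cl11_ip x y : cl11 (ip x y) (ip (u x) (u y)).
Proof.
apply: relclosure_sub; exists (ip x y), (ip (u x) (u y)); split=> //.
by apply: lspan_gen; exists x, y.
Qed.

Lemma cl22_rank1 x y : cl22 (rank1 x y) (rank1 (u x) (u y)).
Proof. by apply: relclosure_sub; apply: lspan_gen; exists x, y. Qed.

(** Continuity of u is not assumed; it comes from contractivity of <x, x> |-> <u x, u x>. *)
Lemma ternary_contractive x : nr (u x) <= nr x.
Proof.
rewrite -(@ler_pXn2r _ 2) ?nnegrE ?nr_ge0// -!vn_hilb !vn_sqr.
apply: mulop_opbd.
exact: (relclosure_contract CSB cB CSC sr11 (cl11_ip x x) (opbd_mulop _)).
Qed.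

Lemma eq_of_close (V : normedModType R[i]) (x y : V) (m : R) : 0 <= m ->
  (forall e : R, 0 < e -> nr (x - y) <= m * e) -> x = y.
Proof.
move=> m0 h; apply/subr0_imp/nr_eq0/le_anti; rewrite nr_ge0 andbT.
apply/ler_addgt0Pr => e e0; rewrite add0r.
have p0 : 0 < m + 1 by rewrite ltr_wpDl.
apply: le_trans (h _ (divr_gt0 e0 p0)) _.
by rewrite mulrCA ger_pMr// ler_pdivrMr// mul1r lerDl.
Qed.

Lemma linear_mapB x y : u (x - y) = u x - u y.
Proof. by rewrite -scaleN1r (linear_mapD u_lin) (linear_mapZ u_lin) scaleN1r. Qed.

Lemma cl11_ract b c x : cl11 b c -> u (ract x b) = ract (u x) c.
Proof.
move=> bc; apply: (@eq_of_close _ _ _ (nr x + nr (u x))) => [|e e0].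
  by rewrite addr_ge0 ?nr_ge0.
have [_ [_ [[b0 [c0 [bc0 -> ->]]] hb hc]]] := bc _ e0.
rewrite -!mulopB in hb hc.
have -> : u (ract x b) - ract (u x) c
    = u (ract x (b - b0)) - ract (u x) (c - c0).
  rewrite -(scaleN1r b0) -(scaleN1r c0) !ractDr !ractZr !scaleN1r linear_mapB.
  by rewrite (ip_pairs_ract u_lin u_ternary bc0) opprB addrA subrK.
rewrite (le_trans (nrD _ _))// nrN mulrDl lerD//.
  rewrite (le_trans (ternary_contractive _))// (le_trans (nr_ract _ _))//.
  by rewrite ler_wpM2l ?nr_ge0//; exact: mulop_opbd.
rewrite (le_trans (nr_ract _ _))//.
by rewrite ler_wpM2l ?nr_ge0//; exact: mulop_opbd.
Qed.

Lemma cl22_app k l x : cl22 k l -> u (k x) = l (u x).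
Proof.
move=> kl; apply: (@eq_of_close _ _ _ (nr x + nr (u x))) => [|e e0].
  by rewrite addr_ge0 ?nr_ge0.
have [k0 [l0 [kl0 [_ hk] [_ hl]]]] := kl _ e0.
have -> : u (k x) - l (u x) = u ((k - k0) x) - (l - l0) (u x).
  rewrite !adjop_addE !adjop_oppE linear_mapB.
  by rewrite (rank1_pairs_app u_lin u_ternary kl0) opprB addrA subrK.
have := hk x; have := hl (u x); rewrite !vn_hilb => hl' hk'.
rewrite (le_trans (nrD _ _))// nrN mulrDl lerD//.
  by rewrite (le_trans (ternary_contractive _))// mulrC.
by rewrite mulrC.
Qed.

Lemma ip_pairs_dense b (e : R) : range_ideal E b -> 0 < e ->
  exists2 p, ip_pairs u p & nr (b - p.1) <= e.
Proof.
move=> /range_ideal_nrP Ib /Ib[w Iw bw].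
suff [c wc] : exists c, ip_pairs u (w, c) by exists (w, c).
move: w Iw {bw}; apply: lspan_ind => [|w w' [c h] [c' h']|a w [c h]|_ [x [y ->]]].
- by exists 0; exact: lspan0.
- by exists (c + c'); exact: (lspanD h h').
- by exists (a *: c); exact: (lspanZ a h).
- by exists (ip (u x) (u y)); apply: lspan_gen; exists x, y.
Qed.

Lemma rank1_pairs_dense k (e : R) : compact_op k -> 0 < e ->
  exists2 p, rank1_pairs u p & opbd (k - p.1) e.
Proof.
move=> /compact_opbdP ck /ck[w Iw kw].
suff [l wl] : exists l, rank1_pairs u (w, l) by exists (w, l).
move: w Iw {kw}; apply: lspan_ind => [|w w' [c h] [c' h']|a w [c h]|_ [x [y ->]]].
- by exists 0; exact: lspan0.
- by exists (c + c'); exact: (lspanD h h').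
- by exists (a *: c); exact: (lspanZ a h).
- by exists (rank1 (u x) (u y)); apply: lspan_gen; exists x, y.
Qed.

(** The closure yields a partner among the operators on [selfmod C]; [mulop_closed] identifies it
    with an element of C. *)
Lemma cl11_exists b : range_ideal E b -> exists2 c, range_ideal F c & cl11 b c.
Proof.
move=> Ib.
have [T' TT] : exists T', relclosure (rel11 u) (mulop b) T'.
  apply: (relclosure_ext CSB cB CSC cC sr11) => e e0.
  have [[w c] wc bw] := ip_pairs_dense Ib e0.
  exists (mulop w), (mulop c); split; first by exists w, c.
  by rewrite -mulopB; apply: opbd_le (opbd_mulop _).
have [e e0|c cT] := @mulop_closed _ C T'.
  by have [_ [_ [[w [c [_ _ ->]]] _ h]]] := TT _ e0; exists c.
rewrite cT in TT; exists c => //; apply/range_ideal_nrP => e e0.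
have [_ [_ [[w [d [wd _ ->]]] _]]] := TT _ e0.
rewrite -mulopB => /mulop_opbd h; exists d => //.
have : forall p, ip_pairs u p ->
    lspan [set c | exists x y : F, c = ip x y]%classic p.2.
  apply: lspan_ind => [|p p' h1 h2|a p h1|_ [x [y ->]]].
  - exact: lspan0.
  - exact: lspanD.
  - exact: lspanZ.
  - by apply: lspan_gen; exists (u x), (u y).
by move=> /(_ _ wd).
Qed.

Lemma cl22_exists k : compact_op k -> exists2 l, compact_op l & cl22 k l.
Proof.
move=> ck.
have [l kl] : exists l, relclosure (rel22 u) k l.
  apply: (relclosure_ext CSE cE CSF cF sr22) => e e0.
  by have [[w l] wl kw] := rank1_pairs_dense ck e0; exists w, l.
exists l => //; apply/compact_opbdP => e e0.
have [w [l0 [/rank1_pairs_finite[_ fl] _ h]]] := kl _ e0.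
by exists l0.
Qed.

Variables (I : corner11 E) (J : corner11 F).

(** The graph of the matrix map. Its diagonal entries are related by closed graphs, so the algebraic
    laws can be checked before any map is chosen. *)
Definition linking_rel (M : linking_over I) (N : linking_over J) :=
  exists b x y k c l, [/\ sa_val M = blockop b x y k,
    sa_val N = blockop c (u x) (u y) l, cl11 b c & cl22 k l].

Lemma linking_relD M N M' N' : linking_rel M N -> linking_rel M' N' ->
  linking_rel (M + M') (N + N').
Proof.
move=> [b [x [y [k [c [l [eM eN bc kl]]]]]]] [b' [x' [y' [k' [c' [l' [eM' eN' bc' kl']]]]]]].
exists (b + b'), (x + x'), (y + y'), (k + k'), (c + c'), (l + l'); split.
- by rewrite -blockopD -eM -eM'.
- by rewrite !(linear_mapD u_lin) -blockopD -eN -eN'.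
- by rewrite /cl11 !mulopD; apply: (srD cl11_sr).
- by apply: (srD cl22_sr).
Qed.

Lemma linking_relZ a M N : linking_rel M N -> linking_rel (a *: M) (a *: N).
Proof.
move=> [b [x [y [k [c [l [eM eN bc kl]]]]]]].
exists (a *: b), (a^* *: x), (a *: y), (a *: k), (a *: c), (a *: l); split.
- by rewrite -blockopZ -eM.
- by rewrite !(linear_mapZ u_lin) -blockopZ -eN.
- by rewrite /cl11 !mulopZ; apply: (srZ cl11_sr).
- by apply: (srZ cl22_sr).
Qed.

Lemma linking_relM M N M' N' : linking_rel M N -> linking_rel M' N' ->
  linking_rel (M ** M') (N ** N').
Proof.
move=> [b [x [y [k [c [l [eM eN bc kl]]]]]]] [b' [x' [y' [k' [c' [l' [eM' eN' bc' kl']]]]]]].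
exists (b ** b' + ip x y'), (ract x' (star b) + star k' x), (ract y b' + k y'),
  (rank1 y x' + k ** k'), (c ** c' + ip (u x) (u y')),
  (rank1 (u y) (u x') + l ** l').
have bcS : cl11 (star b) (star c) by rewrite /cl11 !mulop_star; exact: (srS cl11_sr).
have klS : cl22 (star k') (star l') by exact: (srS cl22_sr).
split.
- by rewrite -blockopM -eM -eM'.
- rewrite !(linear_mapD u_lin) (cl11_ract _ bcS) (cl11_ract _ bc') (cl22_app _ klS) (cl22_app _ kl).
  by rewrite -blockopM -eN -eN'.
- rewrite /cl11 !mulopD !mulopM; apply: (srD cl11_sr); last exact: cl11_ip.
  exact: (srM cl11_sr).
- by apply: (srD cl22_sr); [exact: cl22_rank1|exact: (srM cl22_sr)].
Qed.

Lemma linking_relS M N : linking_rel M N -> linking_rel (star M) (star N).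
Proof.
move=> [b [x [y [k [c [l [eM eN bc kl]]]]]]].
exists (star b), y, x, (star k), (star c), (star l); split.
- by rewrite -blockop_star -eM.
- by rewrite -blockop_star -eN.
- by rewrite /cl11 !mulop_star; exact: (srS cl11_sr).
- exact: (srS cl22_sr).
Qed.

Lemma linking_rel_fun M N N' : linking_rel M N -> linking_rel M N' -> N = N'.
Proof.
move=> [b [x [y [k [c [l [eM eN bc kl]]]]]]] [b' [x' [y' [k' [c' [l' [eM' eN' bc' kl']]]]]]].
move: eM'; rewrite eM => /blockop_inj[eb ex ey ek].
subst b' x' y' k'.
apply: sa_val_inj; rewrite eN eN'.
by rewrite (mulop_inj (sr_fun cl11_sr bc bc')) (sr_fun cl22_sr kl kl').
Qed.

Lemma linking_rel_e21 x : linking_rel (e21 I x) (e21 J (u x)).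
Proof.
exists 0, 0, x, 0, 0, 0; split.
- by [].
- by rewrite (linear_map0 u_lin).
- by apply: relclosure_sub; exists 0, 0; split=> //; exact: lspan0.
- by apply: relclosure_sub; exact: lspan0.
Qed.

Hypotheses (I_range : (sa_set I `<=` range_ideal E)%classic)
  (J_range : (range_ideal F `<=` sa_set J)%classic).

Lemma linking_rel_total M : exists N, linking_rel M N.
Proof.
have [b [x [y [k [Ib ck eM]]]]] := linking_blockopP M.
have [c Jc bc] := cl11_exists (I_range Ib).
have [l cl kl] := cl22_exists ck.
have JN : linking_set J (blockop c (u x) (u y) l).
  by exists c, (u x), (u y), l; split=> //; exact: J_range.
exists (Subalg (JN : sa_set (linking_subalg J) _)).
by exists b, x, y, k, c, l.
Qed.

(** The second clause keeps the graph at hand: it computes [Phi] on preimages found by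
    [linking_rel_surjective]. *)
Lemma ternary_extension : exists2 Phi : linking_over I -> linking_over J,
  hom_extension Phi u & forall M N, linking_rel M N -> Phi M = N.
Proof.
have [Phi PhiP] := choice linking_rel_total.
have PhiE M N : linking_rel M N -> Phi M = N.
  by move=> MN; exact: linking_rel_fun (PhiP M) MN.
exists Phi => //; split; last by move=> x; apply: PhiE; exact: linking_rel_e21.
split.
- by move=> a M N; apply: PhiE; apply: linking_relD => //; exact: linking_relZ.
- by move=> M N; apply: PhiE; exact: linking_relM.
- by move=> M; apply: PhiE; exact: linking_relS.
Qed.

End LinkingExtension.

Section LinkingUnits.
Variables (R : realType) (B : cstarAlgType R[i]) (E : hilbModType B) (I : corner11 E).

Lemma rank10 (x : E) : rank1 x 0 = 0.
Proof. by apply: adjopE => z /=; rewrite ip0l ract0r. Qed.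

Lemma rank01 (x : E) : rank1 0 x = 0.
Proof. by apply: adjopE => z /=; rewrite ract0l. Qed.

Lemma star_op0 : star (0 : adjop E) = 0.
Proof. exact: adjopE. Qed.

Lemma adjop_0 (T : adjop E) : T 0 = 0.
Proof. by rewrite -(scale0r (0 : E)) adjop_scale !scale0r. Qed.

Lemma zero_op (x : E) : (0 : adjop E) x = 0. Proof. by []. Qed.

Definition blockE := (blockop_star, blockopM, blockopD, blockopZ, rank10, rank01,
  star_op0, adjop_0, zero_op, (@star0 _ B), (@amull0 _ B), (@amulr0 _ B),
  (@amull0 _ (adjop E)), (@amulr0 _ (adjop E)), (@ip0l _ B E), (@ip0r _ B E),
  (@ract0l _ B E), (@ract0r _ B E), (@addr0 B), (@add0r B), (@addr0 E), (@add0r E),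
  (@addr0 (adjop E)), (@add0r (adjop E)), (@scaler0 _ B), (@scaler0 _ E),
  (@scaler0 _ (adjop E))).

Lemma e21_linear (a : R[i]) x y : e21 I (a *: x + y) = a *: e21 I x + e21 I y.
Proof. by apply: sa_val_inj; rewrite /= !blockE. Qed.

Lemma e21_ternary x y z :
  e21 I (ract x (ip y z)) = e21 I x ** star (e21 I y) ** e21 I z.
Proof. by apply: sa_val_inj; rewrite /= !blockE. Qed.

Lemma e11D b c : e11 (b + c) = e11 b + e11 c :> linking_over I.
Proof. by apply: sa_val_inj; rewrite /= !blockE. Qed.

Lemma e11Z (a : R[i]) b : e11 (a *: b) = a *: e11 b :> linking_over I.
Proof. by apply: sa_val_inj; rewrite /= !blockE. Qed.

Lemma e11M b c : e11 (b ** c) = e11 b ** e11 c :> linking_over I.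
Proof. by apply: sa_val_inj; rewrite /= !blockE. Qed.

Lemma e11S b : e11 (star b) = star (e11 b) :> linking_over I.
Proof. by apply: sa_val_inj; rewrite /= !blockE. Qed.

Lemma e22D k l : e22 I (k + l) = e22 I k + e22 I l.
Proof. by apply: sa_val_inj; rewrite /= !blockE. Qed.

Lemma e22Z (a : R[i]) k : e22 I (a *: k) = a *: e22 I k.
Proof. by apply: sa_val_inj; rewrite /= !blockE. Qed.

Lemma e22M k l : e22 I (k ** l) = e22 I k ** e22 I l.
Proof. by apply: sa_val_inj; rewrite /= !blockE. Qed.

Lemma e22S k : e22 I (star k) = star (e22 I k).
Proof. by apply: sa_val_inj; rewrite /= !blockE. Qed.

Lemma e11_ip x y (b : subalg I) : sa_val b = ip x y -> e11 b = star (e21 I x) ** e21 I y.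
Proof. by move=> e; apply: sa_val_inj; rewrite /= e !blockE. Qed.

Lemma e22_rank1 x y (k : subalg (compact_subalg E)) : sa_val k = rank1 x y ->
  e22 I k = e21 I x ** star (e21 I y).
Proof. by move=> e; apply: sa_val_inj; rewrite /= e !blockE. Qed.

Lemma e21_e11 x b (z : E) : z = ract x (sa_val b) -> e21 I x ** e11 b = e21 I z.
Proof. by move=> ->; apply: sa_val_inj; rewrite /= !blockE. Qed.

Lemma e22_e21 x k (z : E) : z = (sa_val k : adjop E) x -> e22 I k ** e21 I x = e21 I z.
Proof. by move=> ->; apply: sa_val_inj; rewrite /= !blockE. Qed.

Lemma linkmx_sum b x y k : linkmx b x y k = e11 b + star (e21 I x) + e21 I y + e22 I k.
Proof. by apply: sa_val_inj; rewrite /= !blockE. Qed.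

Lemma e21_inj : injective (e21 I).
Proof. by move=> x y /linkmx_inj[]. Qed.

Lemma blockop_col0 b x y k : (forall z, blockop b x y k ((0, z) : dsum E) = 0) ->
  blockop b x y k = blockop b 0 y 0.
Proof.
move=> h; have hz z : ip x z = 0 :> B /\ k z = 0.
  by have := h z => -[] /=; rewrite amul0r ract0r !add0r.
have -> : x = 0 by apply: ip_nondeg => z; rewrite -ip_star (hz z).1 star0.
by have -> : k = 0 by apply: adjopE => z; exact: (hz z).2.
Qed.

Lemma blockop_row0 b x y k : (forall c, blockop b x y k ((c, 0) : dsum E) = 0) ->
  blockop b x y k = blockop 0 x 0 k.
Proof.
move=> h; have hc c : b ** c = 0 /\ ract y c = 0.
  by have := h c => -[] /=; rewrite ip0r adjop_0 !addr0.
have -> : b = 0.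
  apply: nr_eq0; apply/eqP; rewrite -nr_star -sqrf_eq0 -nr_cstar starK.
  by rewrite (hc _).1 nr0.
have -> // : y = 0.
have yy : ip y y ** ip y y = 0 by rewrite -ip_ract (hc _).2 ip0r.
apply: nr_eq0; apply/eqP; rewrite -vn_hilb -sqrf_eq0 vn_sqr -sqrf_eq0 -nr_cstar.
by rewrite ip_star yy nr0.
Qed.

End LinkingUnits.

(** * Arbitrary extensions: block form and uniqueness *)

Section ExtensionRigidity.
Variables (R : realType) (B C : cstarAlgType R[i]).
Variables (E : hilbModType B) (F : hilbModType C) (u : E -> F).
Variables (I : corner11 E) (J : corner11 F).
Hypotheses (I_range : (sa_set I `<=` range_ideal E)%classic)
  (I_ideal : forall d b, sa_set I b -> sa_set I (d ** b)).

Let CSE := @hilb_cauchy_schwarz _ _ E.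
Let cE := @hilb_complete _ _ E.
Let CSB := @selfmod_cauchy_schwarz _ B.
Let cB := @selfmod_complete _ B.
Let CSD := @dsum_cauchy_schwarz _ _ F.

Section OneExtension.
Variable Phi : linking_over I -> linking_over J.
Hypothesis Phi_ext : hom_extension Phi u.

Lemma extD M N : Phi (M + N) = Phi M + Phi N.
Proof. by have [[h _ _] _] := Phi_ext; have := h 1 M N; rewrite !scale1r. Qed.

Lemma ext0 : Phi 0 = 0.
Proof. by apply: (addrI (Phi 0)); rewrite -extD !addr0. Qed.

Lemma extZ c M : Phi (c *: M) = c *: Phi M.
Proof. by have [[h _ _] _] := Phi_ext; have := h c M 0; rewrite !addr0 ext0 addr0. Qed.

Lemma extM M N : Phi (M ** N) = Phi M ** Phi N.
Proof. by have [[_ h _] _] := Phi_ext. Qed.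

Lemma extS M : Phi (star M) = star (Phi M).
Proof. by have [[_ _ h] _] := Phi_ext. Qed.

Lemma ext21 x : Phi (e21 I x) = e21 J (u x).
Proof. by have [_ h] := Phi_ext. Qed.

Lemma ext_ternary_hom : ternary_hom u.
Proof.
split=> [c x y|x y z]; apply: (@e21_inj _ _ _ J).
  by rewrite -ext21 !e21_linear extD extZ !ext21.
by rewrite -ext21 !e21_ternary !extM extS !ext21.
Qed.

Lemma ext_linkmx b x y k : Phi (linkmx b x y k) =
  Phi (e11 b) + star (e21 J (u x)) + e21 J (u y) + Phi (e22 I k).
Proof. by rewrite linkmx_sum !extD extS !ext21. Qed.

(** [Phi] is not yet known to respect the corners, so its values are taken among all operators on
    [dsum F]. *)
Definition ext_rel11 (T : adjop (selfmod B)) (T' : adjop (dsum F)) :=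
  exists b : subalg I, T = mulop (sa_val b) /\ T' = sa_val (Phi (e11 b)).

Definition ext_rel22 (T : adjop E) (T' : adjop (dsum F)) :=
  exists k : subalg (compact_subalg E), T = sa_val k /\ T' = sa_val (Phi (e22 I k)).

Lemma ext_rel11_star_rel : star_rel ext_rel11.
Proof.
split.
- move=> _ _ _ _ [b [-> ->]] [b' [-> ->]]; exists (b + b').
  by rewrite -mulopD e11D extD.
- by move=> c _ _ [b [-> ->]]; exists (c *: b); rewrite -mulopZ e11Z extZ.
- move=> _ _ _ _ [b [-> ->]] [b' [-> ->]]; exists (b ** b').
  by rewrite -mulopM e11M extM.
- by move=> _ _ [b [-> ->]]; exists (star b); rewrite -mulop_star e11S extS.
- move=> _ [b [b0 ->]].
  have -> : b = 0.
    apply: sa_val_inj; apply: mulop_inj; rewrite -b0.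
    by apply: adjopE => x; exact/esym/amull0.
  by rewrite -(scale0r (0 : subalg I)) e11Z scale0r ext0.
- move=> _ _ M [b [-> _]] _.
  pose d : B := M (sa_val b : B).
  pose db : subalg I := Subalg (I_ideal d (sa_valP b) : sa_set I _).
  exists (sa_val (Phi (e11 db))), db; split=> //.
  apply: adjopE => x /=.
  rewrite -[sa_val b ** (sa_val b ** x)]/(ract (sa_val b : selfmod B) (sa_val b ** x)).
  by rewrite adjop_ract; exact: amulA.
- by move=> _ _ [b [-> _]]; exists (nr (sa_val b : B)); exact: opbd_mulop.
Qed.

Lemma ext_rel22_star_rel : star_rel ext_rel22.
Proof.
split.
- move=> _ _ _ _ [b [-> ->]] [b' [-> ->]]; exists (b + b').
  by rewrite e22D extD.
- by move=> c _ _ [b [-> ->]]; exists (c *: b); rewrite e22Z extZ.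
- move=> _ _ _ _ [b [-> ->]] [b' [-> ->]]; exists (b ** b').
  by rewrite e22M extM.
- by move=> _ _ [b [-> ->]]; exists (star b); rewrite e22S extS.
- move=> _ [b [b0 ->]].
  have -> : b = 0 by exact: sa_val_inj.
  by rewrite -(scale0r (0 : subalg (compact_subalg E))) e22Z scale0r ext0.
- move=> _ _ M [k [-> _]] Mb.
  have ck : compact_op (M ** (sa_val k ** sa_val k)).
    by apply: compact_comp => //; apply: compactM; exact: (sa_valP k).
  pose l : subalg (compact_subalg E) := Subalg (ck : sa_set (compact_subalg E) _).
  by exists (sa_val (Phi (e22 I l))), l.
- by move=> _ _ [k [-> _]]; apply: compact_opbd; exact: (sa_valP k).
Qed.

(** <x, y> in the 11-corner is [star (e21 I x) ** e21 I y], which ties [Phi] to u on the span. *)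
Lemma ext_e11_pairs p : ip_pairs u p -> sa_set I p.1 /\
  forall b : subalg I, sa_val b = p.1 -> sa_val (Phi (e11 b)) = blockop p.2 0 0 0.
Proof.
move: p; apply: lspan_ind => [|p q [Ip hp] [Iq hq]|c p [Ip hp]|_ [x [y ->]]] /=.
- split=> [|b b0]; first exact: sa0.
  have -> : b = 0 by exact: sa_val_inj.
  by rewrite -(scale0r (0 : subalg I)) e11Z scale0r ext0 blockop0.
- split=> [|b bE]; first exact: saD.
  have -> : b = Subalg Ip + Subalg Iq by exact: sa_val_inj.
  by rewrite e11D extD /= hp// hq// blockopD !addr0.
- split=> [|b bE]; first exact: saZ.
  have -> : b = c *: Subalg Ip by exact: sa_val_inj.
  by rewrite e11Z extZ /= hp// blockopZ !scaler0.
- split=> [|b bE]; first exact: c11_ip.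
  by rewrite (e11_ip bE) extM extS !ext21 /= !blockE.
Qed.

Lemma ext_e22_pairs p : rank1_pairs u p -> compact_op p.1 /\
  forall k : subalg (compact_subalg E), sa_val k = p.1 ->
    sa_val (Phi (e22 I k)) = blockop 0 0 0 p.2.
Proof.
move: p; apply: lspan_ind => [|p q [Ip hp] [Iq hq]|c p [Ip hp]|_ [x [y ->]]] /=.
- split=> [|b b0]; first exact: (sa0 (compact_subalg E)).
  have -> : b = 0 by exact: sa_val_inj.
  by rewrite -(scale0r (0 : subalg (compact_subalg E))) e22Z scale0r ext0 blockop0.
- split=> [|b bE]; first exact: Defs.compactD.
  have -> : b = Subalg (Ip : sa_set (compact_subalg E) _)
      + Subalg (Iq : sa_set (compact_subalg E) _) by exact: sa_val_inj.
  by rewrite e22D extD /= hp// hq// blockopD !addr0.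
- split=> [|b bE]; first exact: Defs.compactZ.
  have -> : b = c *: Subalg (Ip : sa_set (compact_subalg E) _) by exact: sa_val_inj.
  by rewrite e22Z extZ /= hp// blockopZ !scaler0.
- split=> [|b bE]; first exact: Defs.compact_rank1.
  by rewrite (e22_rank1 _ bE) extM extS !ext21 /= !blockE.
Qed.

Lemma ext_e11_near (b : subalg I) p (e : R) : ip_pairs u p -> nr (sa_val b - p.1 : B) <= e ->
  opbd (sa_val (Phi (e11 b)) - blockop p.2 0 0 0) e.
Proof.
move=> Pp bp; have [Ip hp] := ext_e11_pairs Pp.
have h1 : ext_rel11 (mulop (sa_val b)) (sa_val (Phi (e11 b))) by exists b.
have h2 : ext_rel11 (mulop p.1) (blockop p.2 0 0 0).
  by exists (Subalg Ip); rewrite hp.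
apply: (sr_contract CSB cB CSD ext_rel11_star_rel (srB ext_rel11_star_rel h1 h2)).
by rewrite -mulopB; apply: opbd_le (opbd_mulop _).
Qed.

Lemma ext_e22_near (k : subalg (compact_subalg E)) p (e : R) :
  rank1_pairs u p -> opbd (sa_val k - p.1) e ->
  opbd (sa_val (Phi (e22 I k)) - blockop 0 0 0 p.2) e.
Proof.
move=> Pp kp; have [Ip hp] := ext_e22_pairs Pp.
have h1 : ext_rel22 (sa_val k) (sa_val (Phi (e22 I k))) by exists k.
have h2 : ext_rel22 p.1 (blockop 0 0 0 p.2).
  by exists (Subalg (Ip : sa_set (compact_subalg E) _)); rewrite hp.
exact: (sr_contract CSE cE CSD ext_rel22_star_rel (srB ext_rel22_star_rel h1 h2)).
Qed.

Lemma vanish_of_near (P : adjop (dsum F)) (z : dsum F) :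
  (forall e : R, 0 < e -> exists N : adjop (dsum F),
     [/\ N z = 0, star N z = 0 & opbd (P - N) e]) ->
  P z = 0 /\ star P z = 0.
Proof.
have close (Q : adjop (dsum F)) :
    (forall e : R, 0 < e -> exists N : adjop (dsum F), N z = 0 /\ opbd (Q - N) e) -> Q z = 0.
  move=> h; apply: (vn_eq0 CSD); apply/le_anti; rewrite vn_ge0 andbT.
  apply/ler_addgt0Pr => e e0; rewrite add0r.
  have p0 : 0 < vn z + 1 by rewrite ltr_wpDl ?vn_ge0.
  have [N [Nz [_ /(_ z)]]] := h _ (divr_gt0 e0 p0).
  rewrite adjop_addE adjop_oppE Nz subr0 => /le_trans; apply.
  by rewrite mulrAC -mulrA ger_pMr// ler_pdivrMr// mul1r lerDl.
move=> h; split; apply: close => e e0; have [N [Nz sNz PN]] := h _ e0.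
  by exists N.
by exists (star N); split=> //; rewrite -starN_op -starD; exact: opbd_star.
Qed.

(** The image is a norm limit of matrices with only a 11-entry, so it and its adjoint kill all
    vectors (0, z). The first fact removes its second column, the second the remaining 21-entry. *)
Lemma ext_e11 b : exists c, Phi (e11 b) = e11 c.
Proof.
have [c [r [s [l eP]]]] := linkmxP (Phi (e11 b)).
exists c; rewrite eP; apply: sa_val_inj => /=.
have h z : blockop (sa_val c) r s (sa_val l) ((0, z) : dsum F) = 0 /\
    star (blockop (sa_val c) r s (sa_val l)) ((0, z) : dsum F) = 0.
  apply: vanish_of_near => e e0.
  have [p Pp bp] := ip_pairs_dense u (I_range (sa_valP b)) e0.
  exists (blockop p.2 0 0 0); rewrite blockop_star; split.
  - by rewrite /= !blockE.
  - by rewrite /= !blockE.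
  - by have := ext_e11_near Pp bp; rewrite eP.
have e1 := blockop_col0 (fun z => (h z).1).
have e2 : blockop (star (sa_val c)) s r (star (sa_val l)) =
    blockop (star (sa_val c)) 0 r 0.
  by apply: blockop_col0 => z; rewrite -blockop_star (h z).2.
have [_ s0 _ _] := blockop_inj e2.
by rewrite e1 s0.
Qed.

Lemma ext_e22 k : exists l, Phi (e22 I k) = e22 J l.
Proof.
have [c [r [s [l eP]]]] := linkmxP (Phi (e22 I k)).
exists l; rewrite eP; apply: sa_val_inj => /=.
have h z : blockop (sa_val c) r s (sa_val l) ((z, 0) : dsum F) = 0 /\
    star (blockop (sa_val c) r s (sa_val l)) ((z, 0) : dsum F) = 0.
  apply: vanish_of_near => e e0.
  have [p Pp bp] := rank1_pairs_dense u (sa_valP k) e0.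
  exists (blockop 0 0 0 p.2); rewrite blockop_star; split.
  - by rewrite /= !blockE.
  - by rewrite /= !blockE -[adj_adj p.2 0]/((star p.2 : adjop F) 0) adjop_0.
  - by have := ext_e22_near Pp bp; rewrite eP.
have e1 := blockop_row0 (fun z => (h z).1).
have e2 : blockop (star (sa_val c)) s r (star (sa_val l)) =
    blockop 0 s 0 (star (sa_val l)).
  by apply: blockop_row0 => z; rewrite -blockop_star (h z).2.
have [_ _ r0 _] := blockop_inj e2.
by rewrite e1 r0.
Qed.

Lemma ext_block_form : block_form Phi u.
Proof.
have [phi phiP] := choice ext_e11; have [psi psiP] := choice ext_e22.
exists phi, psi => b x y k.
by rewrite ext_linkmx phiP psiP [RHS]linkmx_sum.
Qed.

Lemma ext_blockwise : blockwise Phi.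
Proof.
split=> _ [_ [x _ <-] <-].
- by have [c ->] := ext_e11 x; exists c.
- exists (u x) => //.
  have e12E (K' : numClosedFieldType) (A : cstarAlgType K') (X : hilbModType A)
      (L : corner11 X) z : e12 L z = star (e21 L z).
    by apply: sa_val_inj => /=; rewrite blockop_star star0; congr blockop; exact: adjopE.
  by rewrite !e12E extS ext21.
- by exists (u x); rewrite ?ext21.
- by have [l ->] := ext_e22 x; exists l.
Qed.

End OneExtension.

(** On each diagonal entry both extensions are within e of the same matrix, which depends only on
    u. *)
Lemma ext_unique Phi Psi : hom_extension Phi u -> hom_extension Psi u ->
  Psi = Phi :> (linking_over I -> linking_over J).
Proof.
move=> hPhi hPsi; apply/funext => M.
have [b [x [y [k ->]]]] := linkmxP M.
rewrite (ext_linkmx hPhi) (ext_linkmx hPsi); congr (_ + _ + _ + _).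
  apply: sa_val_inj; apply: subr0_imp.
  apply: (@opbd_eq0_scaled _ _ _ CSD _ 2) => // e e0.
  have [p Pp bp] := ip_pairs_dense u (I_range (sa_valP b)) e0.
  set S := sa_val _; set T := sa_val _.
  have -> : S - T = (S - blockop p.2 0 0 0) - (T - blockop p.2 0 0 0).
    by rewrite opprB addrA subrK.
  rewrite mulr_natl mulr2n; apply: opbdB => //; exact: ext_e11_near.
apply: sa_val_inj; apply: subr0_imp.
apply: (@opbd_eq0_scaled _ _ _ CSD _ 2) => // e e0.
have [p Pp bp] := rank1_pairs_dense u (sa_valP k) e0.
set S := sa_val _; set T := sa_val _.
have -> : S - T = (S - blockop 0 0 0 p.2) - (T - blockop 0 0 0 p.2).
  by rewrite opprB addrA subrK.
rewrite mulr_natl mulr2n; apply: opbdB => //; exact: ext_e22_near.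
Qed.

End ExtensionRigidity.

(** * Injectivity and surjectivity of the extension *)

Section InjectivitySurjectivity.
Variables (R : realType) (B C : cstarAlgType R[i]).
Variables (E : hilbModType B) (F : hilbModType C) (u : E -> F).

Section Surjective.
Hypotheses (u_lin : linear u)
  (u_ternary : forall x y z, u (ract x (ip y z)) = ract (u x) (ip (u y) (u z))).
Hypothesis u_surj : forall y, exists x, u x = y.

Let CSE := @hilb_cauchy_schwarz _ _ E.
Let CSF := @hilb_cauchy_schwarz _ _ F.
Let cE := @hilb_complete _ _ E.
Let cF := @hilb_complete _ _ F.
Let CSB := @selfmod_cauchy_schwarz _ B.
Let CSC := @selfmod_cauchy_schwarz _ C.
Let cB := @selfmod_complete _ B.
Let cC := @selfmod_complete _ C.
Let sr11 := rel11_star_rel u_lin u_ternary.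
Let sr22 := rel22_star_rel u_lin u_ternary.

(** Surjectivity of u reaches only the span of the products in F; [dense_range_surjective] passes to
    its closure. *)
Lemma cl11_lift c : range_ideal F c -> exists2 b, range_ideal E b & cl11 u b c.
Proof.
move=> /range_ideal_nrP Fc.
have [|T Tc] := dense_range_surjective CSB cB CSC
    (relclosure_star_rel CSB cB CSC cC sr11)
    (relclosure_closed CSB CSC (G := rel11 u)) (c' := mulop c).
  move=> e e0; have [w Fw cw] := Fc _ e0.
  suff [v vw] : exists v, ip_pairs u (v, w).
    exists (mulop v), (mulop w); split; first by apply: relclosure_sub; exists v, w.
    by rewrite -mulopB; apply: opbd_le (opbd_mulop _).
  move: w Fw {cw}; apply: lspan_ind => [|w w' [v h] [v' h']|a w [v h]|_ [x' [y' ->]]].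
  - by exists 0; exact: lspan0.
  - by exists (v + v'); exact: (lspanD h h').
  - by exists (a *: v); exact: (lspanZ a h).
  - have [x <-] := u_surj x'; have [y <-] := u_surj y'.
    by exists (ip x y); apply: lspan_gen; exists x, y.
have [e e0|b bT] := @mulop_closed _ B T.
  by have [_ [_ [[b [d [_ -> _]]] h _]]] := Tc _ e0; exists b.
rewrite bT in Tc; exists b => //; apply/range_ideal_nrP => e e0.
have [_ [_ [[w [d [wd -> _]]] h _]]] := Tc _ e0.
move: h; rewrite -mulopB => /mulop_opbd h; exists w => //.
have : forall p, ip_pairs u p ->
    lspan [set b | exists x y : E, b = ip x y]%classic p.1.
  apply: lspan_ind => [|p p' h1 h2|a p h1|_ [x [y ->]]].
  - exact: lspan0.
  - exact: lspanD.
  - exact: lspanZ.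
  - by apply: lspan_gen; exists x, y.
by move=> /(_ _ wd).
Qed.

Lemma cl22_lift l : compact_op l -> exists2 k, compact_op k & cl22 u k l.
Proof.
move=> /compact_opbdP cl.
have [|k kl] := dense_range_surjective CSE cE CSF
    (relclosure_star_rel CSE cE CSF cF sr22)
    (relclosure_closed CSE CSF (G := rel22 u)) (c' := l).
  move=> e e0; have [w Fw cw] := cl _ e0.
  suff [v vw] : exists v, rank1_pairs u (v, w).
    by exists v, w; split=> //; exact: relclosure_sub.
  move: w Fw {cw}; apply: lspan_ind => [|w w' [v h] [v' h']|a w [v h]|_ [x' [y' ->]]].
  - by exists 0; exact: lspan0.
  - by exists (v + v'); exact: (lspanD h h').
  - by exists (a *: v); exact: (lspanZ a h).
  - have [x <-] := u_surj x'; have [y <-] := u_surj y'.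
    by exists (rank1 x y); apply: lspan_gen; exists x, y.
exists k => //; apply/compact_opbdP => e e0.
have [w [l0 [/rank1_pairs_finite[fw _] h _]]] := kl _ e0.
by exists w.
Qed.

Lemma linking_rel_surjective (I : corner11 E) (J : corner11 F) :
  (range_ideal E `<=` sa_set I)%classic -> (sa_set J `<=` range_ideal F)%classic ->
  forall N : linking_over J, exists M : linking_over I, linking_rel u M N.
Proof.
move=> EI JF N; have [c [x' [y' [l [Jc cl eN]]]]] := linking_blockopP N.
have [b Ib bc] := cl11_lift (JF _ Jc); have [k ck kl] := cl22_lift cl.
have [x ux] := u_surj x'; have [y uy] := u_surj y'.
have IM : linking_set I (blockop b x y k).
  by exists b, x, y, k; split=> //; exact: EI.
exists (Subalg (IM : sa_set (linking_subalg I) _)).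
by exists b, x, y, k, c, l; rewrite ux uy.
Qed.

End Surjective.

Variables (I : corner11 E) (J : corner11 F).
Hypotheses (I_range : (sa_set I `<=` range_ideal E)%classic)
  (I_ideal : forall d b, sa_set I b -> sa_set I (d ** b)).
Variable Phi : linking_over I -> linking_over J.
Hypothesis Phi_ext : hom_extension Phi u.

Lemma ext_surjective_map : (forall N, exists M, Phi M = N) -> forall y, exists x, u x = y.
Proof.
move=> sPhi y; have [M MN] := sPhi (e21 J y).
have [phi [psi h]] := ext_block_form I_range I_ideal Phi_ext.
have [b [x [z [k eM]]]] := linkmxP M.
by move: MN; rewrite eM h => /linkmx_inj[_ _ zy _]; exists z.
Qed.

(** From x b = 0 comes <y, x> b = 0, so [star w ** b = 0] for w in the span; let w tend to b. *)
Lemma range_ideal_annihilator (b : B) : range_ideal E b ->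
  (forall x : E, ract x b = 0) -> b = 0.
Proof.
move=> /range_ideal_nrP Ib xb.
have w0 : forall w, lspan [set b | exists x y : E, b = ip x y]%classic w -> star w ** b = 0.
  apply: lspan_ind => [|w w' h h'|a w h|_ [x [y ->]]].
  - by rewrite star0 amull0.
  - by rewrite starD amulDl h h' addr0.
  - by rewrite starZ amulZl h scaler0.
  - by rewrite ip_star -ip_ract xb ip0r.
have bb : star b ** b = 0.
  apply: (@eq_of_close _ _ _ _ (nr b)) => [|e e0]; first exact: nr_ge0.
  have [w Ew bw] := Ib _ e0.
  rewrite subr0 -[star b ** b]subr0 -(w0 _ Ew) -scaleN1r -amulZl scaleN1r -amulDl.
  have -> : star b - star w = star (b - w).
    by rewrite [RHS]starD -(scaleN1r w) starZ rmorphN1 scaleN1r.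
  by rewrite (le_trans (nrM _ _))// mulrC nr_star ler_wpM2l ?nr_ge0.
by apply: nr_eq0; apply/eqP; rewrite -sqrf_eq0 -nr_cstar bb nr0.
Qed.

(** Multiplying a kernel element by some [e21 I x] lands in the 21-corner, where u decides. So a
    diagonal entry b in the kernel gives x b = 0 for all x, and an entry k gives k x = 0. *)
Lemma ext_injective : injective Phi <-> injective u.
Proof.
split=> [iPhi x y uxy|iu M N MN].
  by apply: (@e21_inj _ _ _ I); apply: iPhi; rewrite !(ext21 Phi_ext) uxy.
have u0 x : u x = 0 -> x = 0.
  move=> ux; apply: iu; rewrite ux.
  by have [ul _] := ext_ternary_hom Phi_ext; rewrite (linear_map0 ul).
have e210 : e21 J (0 : F) = 0 by apply: sa_val_inj; rewrite /= blockop0.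
have key x (Q : linking_over I) z : Phi Q = 0 ->
    e21 I z = e21 I x ** Q \/ e21 I z = Q ** e21 I x -> z = 0.
  move=> Q0 h; apply: u0; apply: (@e21_inj _ _ _ J); rewrite -(ext21 Phi_ext) e210.
  by case: h => ->; rewrite (extM Phi_ext) Q0 ?amulr0 ?amull0.
suff h Q : Phi Q = 0 -> Q = 0.
  apply: subr0_imp; apply: h.
  by rewrite -scaleN1r (extD Phi_ext) (extZ Phi_ext) MN scaleN1r subrr.
have [b [x [y [k ->]]]] := linkmxP Q.
have [c ec] := ext_e11 I_range I_ideal Phi_ext b.
have [l el] := ext_e22 Phi_ext k.
rewrite (ext_linkmx Phi_ext) ec el -linkmx_sum => h0.
have /blockop_inj[c0 x0 y0 l0] :
    blockop (sa_val c) (u x) (u y) (sa_val l) = blockop 0 0 0 0.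
  by rewrite blockop0; exact: (congr1 (@sa_val _ _ _) h0).
have hb : Phi (e11 b) = 0 by rewrite ec; apply: sa_val_inj; rewrite /= c0 blockop0.
have hk : Phi (e22 I k) = 0 by rewrite el; apply: sa_val_inj; rewrite /= l0 blockop0.
have eb : sa_val b = 0.
  apply: range_ideal_annihilator (I_range (sa_valP b)) _ => z.
  by apply: (key z _ _ hb); left; rewrite (@e21_e11 _ _ _ _ z b _ erefl).
have ek : sa_val k = 0.
  apply: adjopE => z; apply: (key z _ _ hk); right.
  by rewrite (@e22_e21 _ _ _ _ z k _ erefl).
by apply: sa_val_inj; rewrite /= eb ek (u0 _ x0) (u0 _ y0) blockop0.
Qed.

End InjectivitySurjectivity.

(** * Generalized isometries and the equivalences *)

Lemma generalized_isometry_ternary (R : realType) (B C : cstarAlgType R[i])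
    (E : hilbModType B) (F : hilbModType C) (u : E -> F) :
  generalized_isometry u -> ternary_hom u.
Proof.
move=> [phi [phi_lin phiM phiS] uphi].
have phi0 : phi 0 = 0.
  by apply: (addrI (phi 0)); have := phi_lin 1 0 0; rewrite !scale1r !addr0 => <-.
have phiD a b : phi (a + b) = phi a + phi b.
  by have := phi_lin 1 a b; rewrite !scale1r.
have phiZ c a : phi (c *: a) = c *: phi a.
  by have := phi_lin c a 0; rewrite !addr0 phi0 addr0.
have zero (y : F) : ip y y = 0 -> y = 0.
  by move=> yy; apply: nr_eq0; rewrite -vn_hilb /vn yy nr0 sqrtr0.
split=> [c x y|x y z]; apply: subr0_imp; apply: zero; set w := _ - _.
  (* The defect w is orthogonal to the values of u because [phi] is linear, and w is a combination
     of such values; hence <w, w> = 0. No linearity of u enters. *)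
  have wv v : ip w (u v) = 0.
    rewrite /w ipDl ipNl ipDl ipZl !uphi -phiZ -phiD -[c^* *: _]ipZl -ipDl.
    by rewrite subrr.
  by rewrite {2}/w ipDr ipNr ipDr ipZr !wv scaler0 addr0 subrr.
have wv v : ip w (u v) = 0.
  rewrite /w ipDl ipNl ip_ractl !uphi -phiS -phiM ip_ractl.
  by rewrite subrr.
by rewrite {2}/w ipDr ipNr ip_ract !wv amull0 subrr.
Qed.

(** Fullness puts every b into the domain of the closed graph, which is then the graph of the
    required homomorphism. *)
Lemma ternary_generalized_isometry (R : realType) (B C : cstarAlgType R[i])
    (E : hilbModType B) (F : hilbModType C) (u : E -> F) :
  full E -> ternary_hom u -> generalized_isometry u.
Proof.
move=> fE [u_lin u_ternary].
have [|phi phiP] := choice (_ : forall b, exists c, cl11 u b c).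
  move=> b; have [|c _ bc] := @cl11_exists _ _ _ _ _ _ u_lin u_ternary b.
    by rewrite [range_ideal E]fE; exact: Logic.I.
  by exists c.
have sr := relclosure_star_rel (@selfmod_cauchy_schwarz _ B) (@selfmod_complete _ B)
  (@selfmod_cauchy_schwarz _ C) (@selfmod_complete _ C) (rel11_star_rel u_lin u_ternary).
have phiE b c : cl11 u b c -> phi b = c.
  by move=> bc; apply: mulop_inj; exact: (sr_fun sr (phiP b) bc).
exists phi; last by move=> x x'; apply/esym/phiE; exact: cl11_ip.
split=> [a b c|b c|b]; apply: phiE; rewrite /cl11.
- by rewrite !mulopD !mulopZ; exact: (srD sr (srZ sr a (phiP b)) (phiP c)).
- by rewrite !mulopM; exact: (srM sr (phiP b) (phiP c)).
- by rewrite !mulop_star; exact: (srS sr (phiP b)).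
Qed.

Lemma range_ideal_mull (R : realType) (B : cstarAlgType R[i]) (E : hilbModType B)
    (d b : B) : range_ideal E b -> range_ideal E (d ** b).
Proof.
move=> Eb; rewrite -(starK (d ** b)) starM.
by apply: range_idealS; apply: range_ideal_mulr; exact: range_idealS.
Qed.

Theorem theorem3p10 (R : realType) (B C : cstarAlgType R[i])
    (E : hilbModType B) (F : hilbModType C) (u : E -> F) :
  (full E ->
    [/\ generalized_isometry u <-> ternary_hom u,
        ternary_hom u <->
          (exists Phi : linking E -> linking F, hom_extension Phi u)
      & forall Phi : linking E -> linking F, hom_extension Phi u ->
          [/\ blockwise Phi, block_form Phi u
            & forall Psi : linking E -> linking F,
                hom_extension Psi u -> Psi = Phi]]) /\
  (ternary_hom u <->
    (exists Phi : reduced_linking E -> reduced_linking F,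
       hom_extension Phi u)) /\
  (forall Phi : reduced_linking E -> reduced_linking F, hom_extension Phi u ->
    [/\ blockwise Phi, block_form Phi u,
        forall Psi : reduced_linking E -> reduced_linking F,
          hom_extension Psi u -> Psi = Phi,
        (forall N, exists M, Phi M = N) <-> (forall y, exists x, u x = y)
      & injective Phi <-> injective u]).
Proof.
split; last split.
- move=> fE.
  (* Fullness places the whole corner B inside the range ideal, as extension and rigidity
     require. *)
  have I_range : (sa_set (full_corner E) `<=` range_ideal E)%classic.
    by move=> b _; rewrite [range_ideal E]fE.
  split.
  + by split; [exact: generalized_isometry_ternary|exact: ternary_generalized_isometry].
  + split=> [[u_lin u_ternary]|[Phi]]; last exact: ext_ternary_hom.
    have [//|Phi hPhi _] := ternary_extension u_lin u_ternary I_range (J := full_corner F).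
    by exists Phi.
  + move=> Phi hPhi.
    have I_ideal d b : sa_set (full_corner E) b -> sa_set (full_corner E) (d ** b) by [].
    split; [exact: ext_blockwise hPhi|exact: ext_block_form hPhi|].
    by move=> Psi; exact: ext_unique.
- split=> [[u_lin u_ternary]|[Phi]]; last exact: ext_ternary_hom.
  have [//|//|Phi hPhi _] := ternary_extension u_lin u_ternary
    (I := range_corner E) (J := range_corner F).
  by exists Phi.
move=> Phi hPhi.
have I_range : (sa_set (range_corner E) `<=` range_ideal E)%classic by [].
have I_ideal d b : sa_set (range_corner E) b -> sa_set (range_corner E) (d ** b).
  exact: range_ideal_mull.
split.
- exact: ext_blockwise hPhi.
- exact: ext_block_form hPhi.
- by move=> Psi; exact: ext_unique.
- split=> [|u_surj N]; first exact: ext_surjective_map hPhi.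
  (* The extension built from the graph is computed by it; uniqueness identifies it with [Phi], and
     the graph reaches every N when u is surjective. *)
  have [u_lin u_ternary] := ext_ternary_hom hPhi.
  have [//|//|Psi hPsi PsiE] := ternary_extension u_lin u_ternary
    (I := range_corner E) (J := range_corner F).
  have [//|//|M MN] := linking_rel_surjective u_lin u_ternary u_surj
    (I := range_corner E) (J := range_corner F) _ _ N.
  by exists M; rewrite -(ext_unique I_range I_ideal hPhi hPsi); exact: PsiE.
- exact: ext_injective hPhi.
Qed.
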